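(* Let $(\mathcal P_t)_{t\ge0}$ be a decohering QMS on $\mathcal B(\mathcal H)$ which is reversible, and assume that for some $2<p\le\infty$ there exist $t_p,M_p>0$ such that $\|\mathcal P_{t_p}(X)\|_{(2,p),\mathcal N}\le M_p\|X\|_{2,\sigma_{\mathrm{Tr}}}$ for all positive semidefinite $X$. Then $\mathrm{LSI}_{2,\mathcal N}\big(\frac{p\,t_p}{p-2},\frac{p}{p-2}\ln M_p\big)$ holds (with $\frac{p}{p-2}:=1$ when $p=\infty$).
   Context: $\mathcal H$ finite-dimensional of dimension $d_{\mathcal H}$; QMS $\mathcal P_t=e^{t\mathcal L}$ (unital completely positive maps), decohering = has a full-rank invariant state; $\mathcal N$ its decoherence-free algebra ($X$ with $\mathcal P_t(X^*X)=\mathcal P_t(X)^*\mathcal P_t(X)$, $\mathcal P_t(XX^* )=\mathcal P_t(X)\mathcal P_t(X)^*$ for all $t$), $E_{\mathcal N}$ the unique conditional expectation onto $\mathcal N$ with $\mathcal P_t(X-E_{\mathcal N}[X])\to0$, $E_{\mathcal N*}$ its predual, $\sigma_{\mathrm{Tr}}=E_{\mathcal N*}(\mathbb I/d_{\mathcal H})$. $\Gamma^s(X)=\sigma_{\mathrm{Tr}}^{s/2}X\sigma_{\mathrm{Tr}}^{s/2}$, $\|X\|_{p,\sigma_{\mathrm{Tr}}}=\|\Gamma^{1/p}(X)\|_p$ (Schatten), $\langle X,Y\rangle_{\sigma_{\mathrm{Tr}}}=\mathrm{Tr}[\sigma_{\mathrm{Tr}}^{1/2}X^*\sigma_{\mathrm{Tr}}^{1/2}Y]$;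 reversible means $\mathcal L$ is self-adjoint for this inner product. For $1\le a\le b\le\infty$, $1/r=1/a-1/b$: $\|X\|_{(a,b),\mathcal N}=\inf\{\|A\|_{2r,\sigma_{\mathrm{Tr}}}\|B\|_{2r,\sigma_{\mathrm{Tr}}}\|Y\|_{b,\sigma_{\mathrm{Tr}}}:A,B\in\mathcal N,X=AYB\}$. $\mathcal E_{2,\mathcal L}(X)=-\langle X,\mathcal L X\rangle_{\sigma_{\mathrm{Tr}}}$; with $Z=\Gamma^{1/2}(X)$, $\mathrm{Ent}_{2,\mathcal N}(X)=\mathrm{Tr}[Z^2(\ln Z-\frac12\ln E_{\mathcal N}[\sigma_{\mathrm{Tr}}^{-1/2}Z^2\sigma_{\mathrm{Tr}}^{-1/2}]-\frac12\ln\sigma_{\mathrm{Tr}})]$. $\mathrm{LSI}_{2,\mathcal N}(c,d)$: $\mathrm{Ent}_{2,\mathcal N}(X)\le c\,\mathcal E_{2,\mathcal L}(X)+d\|X\|^2_{2,\sigma_{\mathrm{Tr}}}$ for all $X>0$. *)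

(* Defs.v *)
(* Hilbert space H = C^(n.+1) with C = R[i] (R : realType), B(H) = 'M[R[i]]_n.+1. *)
From HB Require Import structures.
From mathcomp Require Import all_boot all_order all_algebra.
From mathcomp Require Import all_classical all_reals all_analysis.
From mathcomp Require Import complex.
Set Implicit Arguments.
Unset Strict Implicit.
Unset Printing Implicit Defensive.
Import Order.TTheory GRing.Theory Num.Theory.
Import numFieldNormedType.Exports numFieldTopology.Exports.
Local Open Scope classical_set_scope.
Local Open Scope ring_scope.

(* The standard (numeric-field) topology on C = R[i], so that matrices over C
   get the (entrywise) product topology of matrix_topology.v. *)
HB.instance Definition _ (R : realType) := PseudoPointedMetric.copy R[i] (R[i])^o.

Section QMSDefs.
Variable R : realType.
Local Notation C := (R[i]).

Definition adj m k (A : 'M[C]_(m, k)) : 'M[C]_(k, m) := (map_mx Num.conj A)^T.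

(* positive semidefinite / positive definite (order of C: 0 <= z iff z real >= 0) *)
Definition psdmx k (A : 'M[C]_k) : Prop :=
  forall v : 'cV[C]_k, 0 <= (adj v *m A *m v) 0 0.
Definition pdmx k (A : 'M[C]_k) : Prop :=
  forall v : 'cV[C]_k, v != 0 -> 0 < (adj v *m A *m v) 0 0.

(* Functional calculus f(A) for a Hermitian matrix A, via the spectral
   decomposition A = P^-1 diag(lambda) P (P unitary) of mathcomp's spectral.v;
   f : R -> R is applied to the (real) eigenvalues. *)
Definition mxfun k (f : R -> R) (A : 'M[C]_k) : 'M[C]_k :=
  invmx (spectralmx A) *m
  diag_mx (map_mx (fun z : C => ((f (complex.Re z))%:C)%C) (spectral_diag A)) *m
  spectralmx A.

Definition mxpow k (s : R) (A : 'M[C]_k) : 'M[C]_k := mxfun (fun x => x `^ s) A.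
Definition mxln k (A : 'M[C]_k) : 'M[C]_k := mxfun (@ln R) A.

Definition singval k (X : 'M[C]_k) (i : 'I_k) : R :=
  Num.sqrt (complex.Re (spectral_diag (adj X *m X) 0 i)).

Definition schatten k (p : \bar R) (X : 'M[C]_k) : R :=
  match p with
  | r%:E => (\sum_(i < k) singval X i `^ r) `^ r^-1
  | +oo%E => \big[Num.max/0]_(i < k) singval X i
  | -oo%E => 0
  end.

Definition einv (p : \bar R) : R :=
  match p with r%:E => r^-1 | _ => 0 end.

Definition Gam k (sigma : 'M[C]_k) (s : R) (X : 'M[C]_k) : 'M[C]_k :=
  mxpow (s / 2) sigma *m X *m mxpow (s / 2) sigma.

Definition wnorm k (sigma : 'M[C]_k) (p : \bar R) (X : 'M[C]_k) : R :=
  schatten p (Gam sigma (einv p) X).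

Definition wip k (sigma : 'M[C]_k) (X Y : 'M[C]_k) : C :=
  \tr (mxpow (1/2) sigma *m adj X *m mxpow (1/2) sigma *m Y).

(* amalgamated (a,b)-norm over the algebra N; 1/r = 1/a - 1/b *)
Definition two_r (a b : \bar R) : \bar R :=
  if einv a - einv b == 0 then +oo%E else (2 / (einv a - einv b))%:E.
Definition abnorm k (N : 'M[C]_k -> Prop) (sigma : 'M[C]_k) (a b : \bar R)
  (X : 'M[C]_k) : R :=
  inf [set v : R | exists (A B Y : 'M[C]_k),
        [/\ N A, N B, X = A *m Y *m B &
            v = wnorm sigma (two_r a b) A * wnorm sigma (two_r a b) B
                * wnorm sigma b Y]].

(* complete positivity: id_m (x) Phi is positive for every m *)
Definition cpmap k (Phi : 'M[C]_k -> 'M[C]_k) : Prop :=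
  forall (m : nat) (B : 'I_m -> 'I_m -> 'M[C]_k),
    psdmx (\mxblock_(i < m, j < m) B i j) ->
    psdmx (\mxblock_(i < m, j < m) Phi (B i j)).

Definition linmap k (Phi : 'M[C]_k -> 'M[C]_k) : Prop :=
  forall (a : C) (X Y : 'M[C]_k), Phi (a *: X + Y) = a *: Phi X + Phi Y.

Definition is_exp_semigroup k (L : 'M[C]_k -> 'M[C]_k) (P : R -> 'M[C]_k -> 'M[C]_k)
  : Prop :=
  forall t : R, 0 <= t -> forall X : 'M[C]_k,
    (fun N : nat => \sum_(j < N) ((t ^+ j / (j`!)%:R)%:C)%C *: iter j L X)
      @ \oo --> P t X.

Definition is_QMS k (L : 'M[C]_k -> 'M[C]_k) (P : R -> 'M[C]_k -> 'M[C]_k) : Prop :=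
  [/\ linmap L, is_exp_semigroup L P &
      forall t : R, 0 <= t -> P t 1%:M = 1%:M /\ cpmap (P t)].

Definition decohering k (P : R -> 'M[C]_k -> 'M[C]_k) : Prop :=
  exists rho : 'M[C]_k, [/\ pdmx rho, \tr rho = 1 &
    forall t : R, 0 <= t -> forall X, \tr (rho *m P t X) = \tr (rho *m X)].

Definition dfa k (P : R -> 'M[C]_k -> 'M[C]_k) (X : 'M[C]_k) : Prop :=
  forall t : R, 0 <= t ->
    P t (adj X *m X) = adj (P t X) *m P t X /\
    P t (X *m adj X) = P t X *m adj (P t X).

Definition cond_exp k (N : 'M[C]_k -> Prop) (E : 'M[C]_k -> 'M[C]_k) : Prop :=
  [/\ linmap E, (forall X, N (E X)), (forall A, N A -> E A = A),
      (forall A B X, N A -> N B -> E (A *m X *m B) = A *m E X *m B) &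
      (forall X, psdmx X -> psdmx (E X))].

Definition is_EN k (P : R -> 'M[C]_k -> 'M[C]_k) (E : 'M[C]_k -> 'M[C]_k) : Prop :=
  cond_exp (dfa P) E /\
  forall X : 'M[C]_k, P t (X - E X) @[t --> +oo] --> (0 : 'M[C]_k).

(* sigma_Tr = E_{N*}(I/d) : Tr[sigma Y] = Tr[(I/d) E_N(Y)] for all Y *)
Definition is_sigmaTr k (E : 'M[C]_k -> 'M[C]_k) (sigma : 'M[C]_k) : Prop :=
  forall Y : 'M[C]_k, \tr (sigma *m Y) = \tr (E Y) / k%:R.

Definition reversible k (L : 'M[C]_k -> 'M[C]_k) (sigma : 'M[C]_k) : Prop :=
  forall X Y, wip sigma X (L Y) = wip sigma (L X) Y.

Definition energy2 k (L : 'M[C]_k -> 'M[C]_k) (sigma X : 'M[C]_k) : C :=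
  - wip sigma X (L X).

Definition ent2 k (E : 'M[C]_k -> 'M[C]_k) (sigma X : 'M[C]_k) : C :=
  let Z := Gam sigma (1/2) X in
  \tr (Z *m Z *m (mxln Z
        - (1/2 : C) *: mxln (E (mxpow (-(1/2)) sigma *m (Z *m Z) *m mxpow (-(1/2)) sigma))
        - (1/2 : C) *: mxln sigma)).

Definition LSI2 k (L E : 'M[C]_k -> 'M[C]_k) (sigma : 'M[C]_k) (c d : R) : Prop :=
  forall X : 'M[C]_k, pdmx X ->
    ent2 E sigma X <= ((c%:C)%C * energy2 L sigma X + ((d * wnorm sigma 2%:E X ^+ 2)%:C)%C).

Definition pratio (p : \bar R) : R :=
  match p with r%:E => r / (r - 2) | _ => 1 end.

End QMSDefs.

(* Main.v *)
Require Import Defs.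
From HB Require Import structures.
From mathcomp Require Import all_boot all_order all_algebra.
From mathcomp Require Import all_classical all_reals all_analysis.
From mathcomp Require Import complex ring lra.
Import Order.TTheory GRing.Theory Num.Theory.
Import numFieldNormedType.Exports.
Set Implicit Arguments.
Unset Strict Implicit.
Unset Printing Implicit Defensive.
Local Open Scope ring_scope.

(* Put Z = Gamma^{1/2}(X), gamma = (p-2)/p and tau = E_N[sigma^{-1/2} Z^2 sigma^{-1/2}],
   so that Tr[Z^2 D] = Tr[sigma tau D] for D in N. Stein interpolation is applied to
     F(w) = Tr[Z^{1+gamma w} (sigma tau)^{-gamma w/4} Gamma^{1/2}(P_{w tp} X) (sigma tau)^{-gamma w/4}].
   Reversibility makes P unitary at imaginary times, so |F| <= Tr[Z^2] on Re w = 0.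
   On Re w = 1 the operator P_{i y tp} X is no longer positive: 2-positivity bounds the
   trace by two traces of images of positive operators, to which the hypothesis applies
   after a Hoelder inequality for the amalgamated norm. That inequality is a second
   interpolation, through the powers of the factors A, Y, B; it gives |F| <= M_p Tr[Z^2].
   Since F(0) = Tr[Z^2], comparing the derivatives at 0 in F(s) <= Tr[Z^2] M_p^s gives
   gamma Ent - tp Energy <= Tr[Z^2] ln M_p. All the analytic functions involved are finite
   sums c_j e^{mu_j w} with mu_j real, for which the three lines theorem is elementary. *)

(** * Three lines theorem for exponential polynomials *)

(** The hypothesis controls only images of positive X, and only through factorisations over N; both
    facts shape the interpolant. Elements of N commute with sigma, so the complex powers of sigma
    tau split into powers of tau and of sigma. At Re w = 1 the sigma exponent 1/4 - gamma/4 equals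
    1/(2p), which turns Gamma^{1/2} into the Gamma^{1/p} of the p-norm. The two factors (sigma
    tau)^{-gamma w/4} contribute -gamma/2 to the derivative at 0, whence the coefficients 1/2 in
    Ent. The phases of sigma and tau at w = 1 + i y are absorbed by replacing Z with a unitary
    conjugate, which satisfies the same trace identity with the same tau; this is why the Hoelder
    estimates assume that identity rather than the definition of tau. In the three lines theorem the
    strip is unbounded and a maximum need not exist, so the maximum principle is run at near-maxima
    with a discrete Laplacian, for which explicit Taylor constants suffice. *)

Local Notation cmod := (@ComplexField.Normc.normc _).

(** One integration by the mean value theorem; three of them turn a bound on a third derivative into
    a cubic remainder. *)
Lemma flat_step (R : realType) (f df : R -> R) (c K : R) (k : nat) :
  (forall x : R, is_derive x 1 f (df x)) -> f 0 = 0 ->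
  (forall x, 0 <= x <= K -> `|df x| <= c * x ^+ k) ->
  forall x, 0 <= x <= K -> `|f x| <= c * x ^+ k.+1.
Proof.
move=> dfE f0 dfB x /andP[x0 xK].
have [c0|] := lerP 0 c; last first.
  (* A negative [c] contradicts the bound on [df], at 0 if [k = 0] and at [x] otherwise, unless
     [x = 0], where [f] vanishes. *)
  move=> cN; have [k0|k0] := eqVneq k 0%N.
    have := dfB 0; rewrite lexx (le_trans x0 xK) => /(_ isT).
    by rewrite k0 expr0 mulr1 => /(le_trans (normr_ge0 _)); rewrite leNgt cN.
  move: x0; rewrite le_eqVlt => /orP[/eqP <-|x0]; first by rewrite f0 normr0 expr0n mulr0.
  have := dfB x; rewrite (ltW x0) xK => /(_ isT) /(le_trans (normr_ge0 _)).
  by rewrite pmulr_lge0 ?exprn_gt0// leNgt cN.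
have cf : {within `[0, x], continuous f}%classic.
  apply: derivable_within_continuous => y _.
  by have := dfE y => /@ex_derive.
have [y yx] := MVT_segment x0 (fun z _ => dfE z) cf.
rewrite f0 !subr0 => ->; rewrite normrM (ger0_norm x0) exprSr mulrA ler_wpM2r//.
move: yx; rewrite in_itv/= => /andP[y0 yx].
rewrite (le_trans (dfB _ _)) ?y0 ?(le_trans yx)//.
by rewrite ler_wpM2l// lerXn2r// nnegrE.
Qed.

(** * Taylor remainders of cos, cosh and exp with explicit constants *)

Section scalar_bounds.
Variable R : realType.
Implicit Types x K a : R.

Lemma cos_taylor2 x : 0 <= x -> `|2 * cos x - 2 + x ^+ 2| <= 2 * x ^+ 3.
Proof.
move=> x0.
have s3 (y : R) : 0 <= y <= x -> `|2 * sin y| <= 2 * y ^+ 0.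
  move=> _; rewrite normrM ger0_norm// expr0 ler_pM2l//.
  by rewrite ler_norml sin_geN1 sin_le1.
have s2 : forall y : R, 0 <= y <= x -> `|- 2 * cos y + 2| <= 2 * y ^+ 1.
  apply: (flat_step (f := fun y => - 2 * cos y + 2) (df := fun y => 2 * sin y)) => //; last by rewrite cos0; ring.
  by move=> y; apply: is_derive_eq; rewrite /GRing.scale/=; ring.
have s1 : forall y : R, 0 <= y <= x -> `|- 2 * sin y + 2 * y| <= 2 * y ^+ 2.
  apply: (flat_step (f := fun y => - 2 * sin y + 2 * y) (df := fun y => - 2 * cos y + 2)) => //; last by rewrite sin0; ring.
  by move=> y; apply: is_derive_eq; rewrite /GRing.scale/=; ring.
apply: (flat_step (f := fun y => 2 * cos y - 2 + y ^+ 2) (df := fun y => - 2 * sin y + 2 * y) (K := x) _ _ s1);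
  last 1 first.
- by rewrite x0 lexx.
- by move=> y; apply: is_derive_eq; rewrite /GRing.scale/=; ring.
- by rewrite cos0; ring.
Qed.

Lemma cosh_taylor2 x K : 0 <= x <= K ->
  `|expR x + expR (- x) - 2 - x ^+ 2| <= (2 * expR K) * x ^+ 3.
Proof.
move=> xK.
have s3 (y : R) : 0 <= y <= K -> `|expR y - expR (- y)| <= (2 * expR K) * y ^+ 0.
  move=> /andP[y0 yK]; rewrite expr0 mulr1 (le_trans (ler_normB _ _))//.
  rewrite !ger0_norm ?expR_ge0// mulr2n mulrDl !mul1r lerD// ler_expR//.
  by rewrite (le_trans _ (le_trans y0 yK))// oppr_le0.
have s2 : forall y : R, 0 <= y <= K -> `|expR y + expR (- y) - 2| <= (2 * expR K) * y ^+ 1.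
  apply: (flat_step (f := fun y => expR y + expR (- y) - 2) (df := fun y => expR y - expR (- y))) => //;
    last by rewrite oppr0 expR0; ring.
  by move=> y; apply: is_derive_eq; rewrite /GRing.scale/=; ring.
have s1 : forall y : R, 0 <= y <= K -> `|expR y - expR (- y) - 2 * y| <= (2 * expR K) * y ^+ 2.
  apply: (flat_step (f := fun y => expR y - expR (- y) - 2 * y) (df := fun y => expR y + expR (- y) - 2)) => //;
    last by rewrite oppr0 expR0; ring.
  by move=> y; apply: is_derive_eq; rewrite /GRing.scale/=; ring.
apply: (flat_step (f := fun y => expR y + expR (- y) - 2 - y ^+ 2) (df := fun y => expR y - expR (- y) - 2 * y) (K := K) _ _ s1) => //;
    last by rewrite oppr0 expR0; ring.
by move=> y; apply: is_derive_eq; rewrite /GRing.scale/=; ring.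
Qed.

Lemma expR_lip a s : 0 <= s <= 1 -> `|expR (a * s) - 1| <= (`|a| * expR `|a|) * s.
Proof.
move=> s1.
rewrite -[in leRHS](expr1 s).
apply: (flat_step (f := fun s => expR (a * s) - 1) (df := fun y => a * expR (a * y)) (K := 1)) => //.
- by move=> y; apply: is_derive_eq; rewrite /GRing.scale/=; ring.
- by rewrite mulr0 expR0; ring.
move=> y /andP[y0 y1]; rewrite expr0 mulr1 normrM ler_wpM2l// ger0_norm ?expR_ge0//.
rewrite ler_expR (le_trans (ler_norm _))// normrM ler_piMr// ger0_norm//.
Qed.

Lemma expR_taylor1 a : exists c, forall s, 0 <= s <= 1 ->
  `|expR (a * s) - 1 - a * s| <= c * s ^+ 2.
Proof.
exists (`|a| * (`|a| * expR `|a|)) => s s1.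
apply: (flat_step (f := fun s => expR (a * s) - 1 - a * s)
  (df := fun y => a * (expR (a * y) - 1)) (K := 1)) => //.
- by move=> y; apply: is_derive_eq; rewrite /GRing.scale/=; ring.
- by rewrite mulr0 expR0; ring.
by move=> y y1; rewrite normrM -[leRHS]mulrA ler_wpM2l// expr1 expR_lip.
Qed.

End scalar_bounds.

(** * A maximum principle on the strip *)

Section strip.
Variable R : realType.

(* The perturbation [eps * s ^+ 2] makes the discrete Laplacian strictly
   positive, so a near-maximum cannot be interior. *)
Lemma strip_max_principle (g : R -> R -> R) (c1 c2 B : R) :
  (forall s y, 0 <= s <= 1 -> g s y <= B) ->
  (forall y, g 0 y <= 1) -> (forall y, g 1 y <= 1) ->
  (forall s y, 0 <= s <= 1 -> g s y <= g 0 y + c1 * s) ->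
  (forall s y, 0 <= s <= 1 -> g s y <= g 1 y + c1 * (1 - s)) ->
  (forall h s y, 0 <= h -> h <= s -> s <= 1 - h ->
    - c2 * h ^+ 3 <= g (s + h) y + g (s - h) y + g s (y + h) + g s (y - h) - 4 * g s y) ->
  forall s y, 0 <= s <= 1 -> g s y <= 1.
Proof.
move=> gB g0 g1 lip0 lip1 lap s0 y0 s01.
rewrite leNgt; apply/negP => gt1.
(* A quarter of the excess over 1: the perturbation, the growth in a boundary layer and the distance
   to the supremum cost at most one [e] each. *)
pose e := (g s0 y0 - 1) / 4.
have e0 : 0 < e by rewrite /e divr_gt0// subr_gt0.
pose phi s y := g s y + e * s ^+ 2.
pose A := [set v : R | exists s y, 0 <= s <= 1 /\ v = phi s y]%classic.
have supA : has_sup A.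
  split; first by exists (phi s0 y0), s0, y0.
  exists (B + e) => _ [s [y [sI ->]]]; rewrite /phi lerD ?gB// ler_piMr ?(ltW e0)//.
  by case/andP: sI => ? ?; rewrite exprn_ile1.
have phiS s y : 0 <= s <= 1 -> phi s y <= sup A.
  by move=> sI; apply: ub_le_sup; [case: supA|exists s, y].
pose c := 1 + `|c1| + `|c2|.
have c_gt0 : 0 < c by rewrite /c -addrA ltr_pwDl// addr_ge0.
(* This step keeps the growth of [g] across a boundary layer of width [h] below [e], and the cubic
   error below [e * h ^+ 2]. *)
pose h := Num.min (1 / 2) (e / c).
have h0 : 0 < h by rewrite /h lt_min divr_gt0// divr_gt0.
have h12 : h <= 1 / 2 by rewrite /h ge_min lexx.
have hc : c * h <= e.
  by rewrite mulrC -ler_pdivlMr// /h ge_min lexx orbT.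
have c1c : `|c1| <= c by rewrite /c; have := normr_ge0 c2; lra.
have c2c : `|c2| <= c by rewrite /c; have := normr_ge0 c1; lra.
have c1h : c1 * h <= e.
  apply: le_trans hc; rewrite ler_wpM2r ?(ltW h0)//.
  by apply: le_trans c1c; rewrite ler_norm.
have c2h : c2 * h <= e.
  apply: le_trans hc; rewrite ler_wpM2r ?(ltW h0)//.
  by apply: le_trans c2c; rewrite ler_norm.
(* The perturbation has discrete Laplacian [2 * e * h ^+ 2]; after the cubic error at least
   [e * h ^+ 2] remains, while at an [eta]-near maximum the Laplacian is below [4 * eta]. *)
pose eta := e * h ^+ 2 / 4.
have eta0 : 0 < eta by rewrite /eta divr_gt0// mulr_gt0// exprn_gt0.
have etae : eta < e.
  rewrite /eta ltr_pdivrMr// ltr_pM2l//; have : h ^+ 2 <= 1 by rewrite exprn_ile1 ?(ltW h0)//; lra.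
  by move=> ?; lra.
have [_ [s [y [sI ->]]] near_sup] := sup_adherent eta0 supA.
have S1 : 1 + 4 * e <= sup A.
  apply: le_trans (phiS s0 y0 s01); rewrite /phi.
  have : 0 <= e * s0 ^+ 2 by rewrite mulr_ge0 ?(ltW e0)// sqr_ge0.
  by rewrite /e; lra.
have /andP[s_ge0 s_le1] := sI.
have es1 : e * s ^+ 2 <= e by rewrite ler_piMr ?(ltW e0)// exprn_ile1.
have c1mono u : 0 <= u <= h -> c1 * u <= e.
  move=> /andP[u0 uh]; have [c1N|c1P] := lerP c1 0; last first.
    by apply: le_trans c1h; rewrite ler_wpM2l// ltW.
  by apply: le_trans (ltW e0); rewrite mulr_le0_ge0.
have phi_bd : g s y <= 1 + e -> False.
  by move: near_sup; rewrite /phi; move=> *; lra.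
have hs : h <= s.
  rewrite leNgt; apply/negP => sh; apply: phi_bd.
  by rewrite (le_trans (lip0 s y sI))// lerD ?g0 ?c1mono// s_ge0 ltW.
have sh : s <= 1 - h.
  rewrite leNgt; apply/negP => shh; apply: phi_bd.
  rewrite (le_trans (lip1 s y sI))// lerD ?g1 ?c1mono//.
  by apply/andP; split; lra.
have := lap h s y (ltW h0) hs sh.
have p1 : phi (s + h) y <= sup A by apply: phiS; apply/andP; split; lra.
have p2 : phi (s - h) y <= sup A by apply: phiS; apply/andP; split; lra.
have p3 := phiS s (y + h) sI.
have p4 := phiS s (y - h) sI.
have hh : c2 * h ^+ 3 <= e * h ^+ 2.
  by rewrite exprS mulrA ler_wpM2r// sqr_ge0.
move: p1 p2 p3 p4 near_sup; rewrite /phi /eta.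
have -> : e * (s + h) ^+ 2 = e * s ^+ 2 + 2 * (e * s * h) + e * h ^+ 2 by ring.
have -> : e * (s - h) ^+ 2 = e * s ^+ 2 - 2 * (e * s * h) + e * h ^+ 2 by ring.
have : 0 < e * h ^+ 2 by rewrite mulr_gt0// exprn_gt0.
rewrite mulNr; lra.
Qed.

End strip.

Section three_lines.
Variable R : realType.
Local Notation C := R[i].
Implicit Types (a s y : R) (z : C).

Lemma normr_cmod z : `|z| = ((cmod z)%:C)%C. Proof. by []. Qed.

Lemma cmod_ge0 z : 0 <= cmod z.
Proof. by rewrite -lecR -normr_cmod normr_ge0. Qed.

Lemma Re_le_cmod z : `|complex.Re z| <= cmod z.
Proof. by rewrite -lecR -normr_cmod normc_ge_Re. Qed.

Lemma cmod_conj z : cmod (Num.conj z) = cmod z.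
Proof. by apply: complexI; rewrite -!normr_cmod norm_conjC. Qed.

Lemma cmod_real a : cmod ((a%:C)%C) = `|a|.
Proof. by rewrite /= expr0n addr0 sqrtr_sqr. Qed.

Lemma cmod_sqr z : cmod z ^+ 2 = complex.Re (z * Num.conj z).
Proof.
by apply: complexI; rewrite rmorphXn/= -normr_cmod normCK RRe_real// -normCK rpredX// normr_real.
Qed.

Lemma conjM z w : Num.conj (z * w) = Num.conj z * Num.conj w.
Proof. exact: rmorphM. Qed.

Lemma Re_sum (I : Type) (l : seq I) (P : pred I) (F : I -> C) :
  complex.Re (\sum_(i <- l | P i) F i) = \sum_(i <- l | P i) complex.Re (F i).
Proof. by apply: (big_morph (@complex.Re R)) => // -[? ?] []. Qed.

Lemma cmod_sum (I : Type) (l : seq I) (P : pred I) (F : I -> C) :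
  cmod (\sum_(i <- l | P i) F i) <= \sum_(i <- l | P i) cmod (F i).
Proof.
elim/big_ind2 : _ => [|z a w b za wb|//]; first by rewrite ComplexField.Normc.normc0.
by rewrite (le_trans (le_normcD _ _))// lerD.
Qed.

(** This is exp(a w) at w = s + i y; with a real exponent its modulus depends on s only and its
    conjugate is its value at -y. *)
Definition cexp a s y : C := ((expR (a * s) * cos (a * y)) +i* (expR (a * s) * sin (a * y)))%C.

Lemma cexpD a s y s' y' : cexp a (s + s') (y + y') = cexp a s y * cexp a s' y'.
Proof.
rewrite /cexp !mulrDr expRD cosD sinD.
by apply/eqP; rewrite eq_complex; apply/andP; split; apply/eqP => /=; ring.
Qed.

Lemma cexpDl a b s y : cexp (a + b) s y = cexp a s y * cexp b s y.
Proof.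
rewrite /cexp !mulrDl expRD cosD sinD.
by apply/eqP; rewrite eq_complex; apply/andP; split; apply/eqP => /=; ring.
Qed.

Lemma cexp_conj a s y : Num.conj (cexp a s y) = cexp a s (- y).
Proof.
rewrite /cexp mulrN cosN sinN.
by apply/eqP; rewrite eq_complex; apply/andP; split; apply/eqP => /=; ring.
Qed.

Lemma cexpr a s : cexp a s 0 = ((expR (a * s))%:C)%C.
Proof. by rewrite /cexp mulr0 cos0 sin0 mulr1 mulr0. Qed.

Lemma cmod_cexp a s y : cmod (cexp a s y) = expR (a * s).
Proof.
apply/eqP; rewrite -(@eqrXn2 _ 2)// ?cmod_ge0 ?expR_ge0//.
rewrite cmod_sqr cexp_conj -cexpD subrr cexpr/= -expRM_natl.
by rewrite -mulr_natl mulrDr; apply/eqP; congr expR; ring.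
Qed.

Definition exppoly (f : R -> R -> C) := exists l : seq (C * R),
  forall s y, f s y = \sum_(x <- l) x.1 * cexp x.2 s y.

Lemma eq_exppoly f g : (forall s y, f s y = g s y) -> exppoly g -> exppoly f.
Proof. by move=> fg [l lP]; exists l => s y; rewrite fg. Qed.

Lemma exppoly_cexp a : exppoly (cexp a).
Proof. by exists [:: (1, a)] => s y; rewrite big_seq1 mul1r. Qed.

Lemma exppoly_cst z : exppoly (fun _ _ => z).
Proof.
exists [:: (z, 0)] => s y.
by rewrite big_seq1 /cexp !mul0r cos0 sin0 expR0 mulr1 mulr0 mulr1.
Qed.

Lemma exppolyD f g : exppoly f -> exppoly g -> exppoly (fun s y => f s y + g s y).
Proof. by move=> [l lP] [m mP]; exists (l ++ m) => s y; rewrite big_cat lP mP. Qed.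

Lemma exppolyM f g : exppoly f -> exppoly g -> exppoly (fun s y => f s y * g s y).
Proof.
move=> [l lP] [m mP]; exists [seq (u.1 * v.1, u.2 + v.2) | u <- l, v <- m] => s y.
rewrite lP mP big_allpairs_dep/= mulr_suml; apply: eq_bigr => u _.
by rewrite mulr_sumr; apply: eq_bigr => v _; rewrite cexpDl; ring.
Qed.

Lemma exppoly_sum (I : Type) (l : seq I) (P : pred I) (F : I -> R -> R -> C) :
  (forall i, exppoly (F i)) -> exppoly (fun s y => \sum_(i <- l | P i) F i s y).
Proof.
move=> FP; elim: l => [|i l IH].
  by apply: eq_exppoly (exppoly_cst 0) => s y; rewrite big_nil.
case Pi : (P i).
  by apply: eq_exppoly (exppolyD (FP i) IH) => s y; rewrite big_cons Pi.
by apply: eq_exppoly IH => s y; rewrite big_cons Pi.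
Qed.

Lemma exppoly_affine f a b : exppoly f -> exppoly (fun s y => f (a + b * s) (b * y)).
Proof.
move=> [l lP]; exists [seq (x.1 * ((expR (x.2 * a))%:C)%C, x.2 * b) | x <- l] => s y.
rewrite lP big_map; apply: eq_bigr => x _ /=; rewrite -[b * y]add0r cexpD cexpr.
by rewrite /cexp !mulrA.
Qed.

(** A cross term of the squared modulus of F varies as exp((a + b) s) cos((a - b) y) up to phase;
    the second-order part of its discrete Laplacian is (a + b)^2 - (a - b)^2 = 4 a b. *)
Lemma lapl_remainder a b h : 0 <= h <= 1 ->
  `|expR ((a + b) * h) + expR (- ((a + b) * h)) + 2 * cos ((a - b) * h) - 4 - 4 * (a * b) * h ^+ 2|
  <= (2 * expR `|a + b| * `|a + b| ^+ 3 + 2 * `|a - b| ^+ 3) * h ^+ 3.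
Proof.
move=> /andP[h0 h1].
have e1 : `|expR ((a + b) * h) + expR (- ((a + b) * h)) - 2 - ((a + b) * h) ^+ 2|
   <= (2 * expR `|a + b|) * (`|a + b| * h) ^+ 3.
  have <- : expR (`|a + b| * h) + expR (- (`|a + b| * h)) = expR ((a + b) * h) + expR (- ((a + b) * h)).
    by case: (ger0P (a + b)) => // _; rewrite mulNr opprK addrC.
  have <- : (`|a + b| * h) ^+ 2 = ((a + b) * h) ^+ 2 by rewrite !exprMn real_normK ?num_real.
  by apply: cosh_taylor2; rewrite mulr_ge0//= ler_piMr.
have e2 : `|2 * cos ((a - b) * h) - 2 + ((a - b) * h) ^+ 2| <= 2 * (`|a - b| * h) ^+ 3.
  have <- : cos (`|a - b| * h) = cos ((a - b) * h).
    by case: (ger0P (a - b)) => // _; rewrite mulNr cosN.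
  have <- : (`|a - b| * h) ^+ 2 = ((a - b) * h) ^+ 2 by rewrite !exprMn real_normK ?num_real.
  by apply: cos_taylor2; rewrite mulr_ge0.
have -> : (2 * expR `|a + b| * `|a + b| ^+ 3 + 2 * `|a - b| ^+ 3) * h ^+ 3 =
  2 * expR `|a + b| * (`|a + b| * h) ^+ 3 + 2 * (`|a - b| * h) ^+ 3 by ring.
apply: le_trans (lerD e1 e2); apply: le_trans (ler_normD _ _).
by rewrite le_eqVlt; apply/orP; left; apply/eqP; congr (`|_|); ring.
Qed.

Section quadratic.
Variables (l : seq (C * R)).

Let F s y := \sum_(x <- l) x.1 * cexp x.2 s y.

(* Squared moduli of the translates of [F] are Hermitian forms in the summands of [F]. *)
Let quad (w : C * R -> C) (q : R -> R -> R) :=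
  \sum_(u <- l) \sum_(v <- l) complex.Re (w u * Num.conj (w v)) * q u.2 v.2.

Lemma quad_sum (w : C * R -> C) (e : R -> C) (q : R -> R -> R) :
  (forall a b, e a * Num.conj (e b) = ((q a b)%:C)%C) ->
  cmod (\sum_(u <- l) w u * e u.2) ^+ 2 = quad w q.
Proof.
move=> eq; rewrite cmod_sqr rmorph_sum/= mulr_suml Re_sum; apply: eq_bigr => u _.
rewrite mulr_sumr Re_sum; apply: eq_bigr => v _.
rewrite rmorphM mulrACA eq.
by case: (w u * Num.conj (w v)) => x y /=; rewrite mulr0 subr0.
Qed.

Lemma quadD w p q : quad w (fun a b => p a b + q a b) = quad w p + quad w q.
Proof.
rewrite -big_split; apply: eq_bigr => u _ /=; rewrite -big_split.
by apply: eq_bigr => v _ /=; rewrite mulrDr.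
Qed.

Lemma quadZ w c q : quad w (fun a b => c * q a b) = c * quad w q.
Proof.
rewrite mulr_sumr; apply: eq_bigr => u _; rewrite mulr_sumr; apply: eq_bigr => v _.
by rewrite mulrCA.
Qed.

Lemma quad_bound w (W : C * R -> R) q k c : (forall u, cmod (w u) <= W u) -> 0 <= c ->
  (forall a b, `|q a b| <= k a b * c) ->
  `|quad w q| <= (\sum_(u <- l) \sum_(v <- l) W u * W v * k u.2 v.2) * c.
Proof.
move=> wW c0 qk; rewrite mulr_suml.
apply: le_trans (ler_norm_sum _ _ _) _; apply: ler_sum => u _.
rewrite mulr_suml.
apply: le_trans (ler_norm_sum _ _ _) _; apply: ler_sum => v _.
rewrite normrM -mulrA ler_pM//.
apply: le_trans (Re_le_cmod _) _.
by rewrite ComplexField.Normc.normcM cmod_conj ler_pM ?cmod_ge0.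
Qed.

Let g s y := cmod (F s y) ^+ 2.

(** Discrete form of Laplacian |F|^2 = 4 |F'|^2: the form with kernel [a * b] is exactly the squared
    modulus of F', hence nonnegative, and the rest is cubic in [h]. *)
Lemma sqmod_laplacian h s y : 0 <= h -> h <= s -> s <= 1 - h ->
  - (\sum_(u <- l) \sum_(v <- l) (cmod u.1 * expR `|u.2|) * (cmod v.1 * expR `|v.2|) *
    (2 * expR `|u.2 + v.2| * `|u.2 + v.2| ^+ 3 + 2 * `|u.2 - v.2| ^+ 3)) * h ^+ 3 <=
  g (s + h) y + g (s - h) y + g s (y + h) + g s (y - h) - 4 * g s y.
Proof.
move=> h0 hs sh.
pose w (u : C * R) := u.1 * cexp u.2 s y.
have gE (s' y' : R) : F (s + s') (y + y') = \sum_(u <- l) w u * cexp u.2 s' y'.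
  by apply: eq_bigr => u _; rewrite cexpD mulrA.
have ge s' : g (s + s') y = quad w (fun a b => expR ((a + b) * s')).
  rewrite /g -[y]addr0 gE; apply: (@quad_sum w (fun a => cexp a s' 0) _) => a b.
  by rewrite cexp_conj oppr0 -cexpDl cexpr.
have gc : g s (y + h) + g s (y - h) = quad w (fun a b => 2 * cos ((a - b) * h)).
  rewrite /g -[s]addr0 !gE !cmod_sqr !rmorph_sum/= !mulr_suml !Re_sum -big_split; apply: eq_bigr => u _/=.
  rewrite !mulr_sumr !Re_sum -big_split; apply: eq_bigr => v _ /=.
  rewrite !(conjM (w v)) (mulrACA (w u) (cexp u.2 0 h)) (mulrACA (w u) (cexp u.2 0 (- h))) !cexp_conj opprK.
  case: (w u * _) => p q /=; rewrite !mulr0 expR0 !mul1r !mulrN !cosN !sinN mulrBl cosB; ring.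
have g0 : g s y = quad w (fun a b => 1).
  rewrite -[s]addr0 ge; apply: eq_bigr => u _; apply: eq_bigr => v _.
  by rewrite mulr0 expR0.
have gp : 0 <= quad w (fun a b => a * b).
  rewrite -(@quad_sum _ (fun a => (a%:C)%C)) ?sqr_ge0// => a b.
  by rewrite (conj_Creal (x := (b%:C)%C)) ?rmorphM// complex_real.
set D := (X in _ <= X).
have -> : D = quad w (fun a b => expR ((a + b) * h) + expR (- ((a + b) * h)) + 2 * cos ((a - b) * h) - 4 - 4 * (a * b) * h ^+ 2) + 4 * h ^+ 2 * quad w (fun a b => a * b).
  have -> : D = g (s + h) y + g (s + - h) y + (g s (y + h) + g s (y - h)) + - 4 * g s y.
    by rewrite /D; ring.
  rewrite gc !ge g0 -!quadZ -!quadD.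
  by apply: eq_bigr => u _; apply: eq_bigr => v _; rewrite mulrN; ring.
rewrite -[leLHS]addr0 lerD//; last by rewrite !mulr_ge0// sqr_ge0.
rewrite mulNr lerNl (le_trans (ler_norm _))// normrN.
apply: (quad_bound (k := fun a b => 2 * expR `|a + b| * `|a + b| ^+ 3 + 2 * `|a - b| ^+ 3)
   (W := fun u => cmod u.1 * expR `|u.2|)).
- move=> u; rewrite ComplexField.Normc.normcM cmod_cexp ler_wpM2l ?cmod_ge0// ler_expR.
  rewrite (le_trans (ler_norm _))// normrM ler_piMr// ger0_norm; lra.
- by rewrite exprn_ge0.
- by move=> a b; apply: lapl_remainder; lra.
Qed.

(** The first factor [expR] is at least 1, which suffices at the edge s = 0, and pays for factoring
    out exp(a + b) at s = 1; one constant thus serves both edges. *)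
Let c1 := \sum_(u <- l) \sum_(v <- l) cmod u.1 * cmod v.1 *
  (expR `|u.2 + v.2| * (`|u.2 + v.2| * expR `|u.2 + v.2|)).

Lemma sqmod_quad y s : g s y = quad (fun u => u.1 * cexp u.2 0 y) (fun a b => expR ((a + b) * s)).
Proof.
rewrite -(@quad_sum _ (fun a => cexp a s 0)).
  by rewrite /g /F; congr (cmod _ ^+ 2); apply: eq_bigr => u _; rewrite -mulrA -cexpD add0r addr0.
by move=> a b; rewrite cexp_conj oppr0 -cexpDl cexpr.
Qed.

Lemma sqmod_lipschitz s0 s y t : 0 <= t -> (forall a b, `|expR ((a + b) * s) - expR ((a + b) * s0)| <=
   (expR `|a + b| * (`|a + b| * expR `|a + b|)) * t) -> g s y <= g s0 y + c1 * t.
Proof.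
move=> t0 H; rewrite -lerBlDl (le_trans (ler_norm _))//.
rewrite !sqmod_quad -mulN1r -quadZ -quadD.
apply: (quad_bound (W := fun u => cmod u.1) (k := fun a b => (expR `|a + b| * (`|a + b| * expR `|a + b|)))) => //.
  by move=> u; rewrite ComplexField.Normc.normcM cmod_cexp mulr0 expR0 mulr1.
by move=> a b; rewrite mulN1r.
Qed.

Lemma three_lines_seq : (forall y, cmod (F 0 y) <= 1) -> (forall y, cmod (F 1 y) <= 1) ->
  forall s y, 0 <= s <= 1 -> cmod (F s y) <= 1.
Proof.
move=> F0 F1 s y s01.
suff : g s y <= 1 by rewrite expr_le1// cmod_ge0.
apply: (@strip_max_principle R g c1 _ ((\sum_(u <- l) cmod u.1 * expR `|u.2|) ^+ 2) _ _ _ _ _ sqmod_laplacian) => //.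
- move=> t x /andP[t0 t1]; rewrite lerXn2r// ?nnegrE ?cmod_ge0// ?sumr_ge0//.
    by move=> u _; rewrite mulr_ge0 ?cmod_ge0 ?expR_ge0.
  apply: le_trans (cmod_sum _ _ _) _; apply: ler_sum => u _.
  rewrite ComplexField.Normc.normcM cmod_cexp ler_wpM2l ?cmod_ge0// ler_expR.
  by rewrite (le_trans (ler_norm _))// normrM ler_piMr// ger0_norm.
- by move=> x; rewrite expr_le1// cmod_ge0.
- by move=> x; rewrite expr_le1// cmod_ge0.
- move=> t x t01; apply: sqmod_lipschitz => [|a b]; first by case/andP: t01.
  rewrite mulr0 expR0 (le_trans (expR_lip _ t01))// ler_wpM2r//; first by case/andP: t01.
  by rewrite ler_peMl ?mulr_ge0 ?expR_ge0// -expR0 ler_expR.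
- move=> t x t01; apply: sqmod_lipschitz => [|a b]; first by lra.
  have -> : expR ((a + b) * t) - expR ((a + b) * 1) = expR (a + b) * (expR (- (a + b) * (1 - t)) - 1).
    by rewrite mulrBr -expRD mulr1; congr (expR _ - _); ring.
  rewrite normrM -mulrA ler_pM//; first by rewrite ger0_norm ?expR_ge0// ler_expR ler_norm.
  by rewrite -[`|a + b|]normrN expR_lip//; lra.
Qed.

End quadratic.

Lemma three_lines (f : R -> R -> C) : exppoly f ->
  (forall y, cmod (f 0 y) <= 1) -> (forall y, cmod (f 1 y) <= 1) ->
  forall s y, 0 <= s <= 1 -> cmod (f s y) <= 1.
Proof.
move=> [l lP] f0 f1 s y; rewrite lP; apply: three_lines_seq => x; by rewrite -lP.
Qed.

Lemma hadamard_three_lines (f : R -> R -> C) (a b : R) : exppoly f -> 0 < a -> 0 < b ->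
  (forall y, cmod (f 0 y) <= a) -> (forall y, cmod (f 1 y) <= b) ->
  forall s, 0 <= s <= 1 -> cmod (f s 0) <= a `^ (1 - s) * b `^ s.
Proof.
move=> fe a0 b0 f0 f1 s s01.
(* The normalising factor 1 / (a^(1-w) b^w) is itself an exponential with real exponent, so the
   product remains an exponential polynomial. *)
have e0 : exppoly (fun s y => ((a^-1)%:C)%C * cexp (ln a - ln b) s y * f s y).
  exact: (exppolyM (exppolyM (exppoly_cst _) (exppoly_cexp _)) fe).
have nE t y : cmod (((a^-1)%:C)%C * cexp (ln a - ln b) t y * f t y) =
    cmod (f t y) / (a `^ (1 - t) * b `^ t).
  rewrite !ComplexField.Normc.normcM cmod_real cmod_cexp ger0_norm ?invr_ge0 ?(ltW a0)//.
  rewrite mulrC; congr (_ * _).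
  rewrite /powR !gt_eqF// -expRD -[X in X^-1 * _](lnK a0) -!expRN -expRD; congr expR; ring.
have p0 t : 0 < a `^ (1 - t) * b `^ t by rewrite mulr_gt0// powR_gt0.
have := three_lines e0 _ _ 0 s01; rewrite nE ler_pdivrMr// mul1r; apply.
  by move=> y; rewrite nE subr0 powRr1 ?powRr0 ?mulr1 ?ler_pdivrMr ?mul1r ?(ltW a0).
by move=> y; rewrite nE subrr powRr1 ?powRr0 ?mul1r ?ler_pdivrMr ?mul1r ?(ltW b0).
Qed.


(** Lets a' decrease to a. If the conclusion failed, the u-th root of the midpoint of a^u and X / c
    would be an a' violating the hypothesis. *)
Lemma le_powRM_limit (X c a u : R) : 0 <= a -> 0 < u -> 0 <= c ->
  (forall a', a < a' -> X <= a' `^ u * c) -> X <= a `^ u * c.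
Proof.
move=> a0 u0; rewrite le_eqVlt => /orP[/eqP <-|c0] H.
  by have := H (a + 1); rewrite !mulr0 ltrDl ltr01; apply.
rewrite leNgt -ltr_pdivlMr//; apply/negP => aX.
pose m := (X / c + a `^ u) / 2.
have am : a `^ u < m by rewrite /m; lra.
have mX : m < X / c by rewrite /m; lra.
have m0 : 0 <= m by rewrite (le_trans (powR_ge0 _ _) (ltW am)).
have mE : (m `^ u^-1) `^ u = m by rewrite -powRrM mulVf ?powRr1// gt_eqF.
suff /H : a < m `^ u^-1 by rewrite mE -ler_pdivrMr// leNgt mX.
have aE : a = (a `^ u) `^ u^-1 by rewrite -powRrM mulfV ?powRr1// gt_eqF.
rewrite [in X in X < _]aE gt0_ltr_powR// ?invr_gt0// nnegrE ?powR_ge0//.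
Qed.

(** Edge bounds may vanish, for instance when a factor of the amalgamated norm is zero. The
    endpoints are excluded because the limit requires both exponents to be positive. *)
Lemma hadamard_three_lines_ge0 (f : R -> R -> C) (a b : R) : exppoly f -> 0 <= a -> 0 <= b ->
  (forall y, cmod (f 0 y) <= a) -> (forall y, cmod (f 1 y) <= b) ->
  forall s, 0 < s < 1 -> cmod (f s 0) <= a `^ (1 - s) * b `^ s.
Proof.
move=> fe a0 b0 f0 f1 s /andP[s0 s1].
apply: le_powRM_limit => //; rewrite ?subr_gt0 ?powR_ge0// => a' aa'.
rewrite mulrC; apply: le_powRM_limit => // [|b' bb']; first by rewrite powR_ge0.
rewrite mulrC; apply: hadamard_three_lines => //; rewrite ?(le_lt_trans _ aa') ?(le_lt_trans _ bb')//.
- by move=> y; rewrite (le_trans (f0 y))// ltW.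
- by move=> y; rewrite (le_trans (f1 y))// ltW.
- by rewrite !ltW.
Qed.

End three_lines.

(** * Hilbert-Schmidt norm *)

(* Locking keeps unification from unfolding these in failed comparisons. *)
HB.lock Definition hs2 (R : realType) m n (A : 'M[R[i]]_(m, n)) : R :=
  \sum_i \sum_j cmod (A i j) ^+ 2.
HB.lock Definition hs (R : realType) m n (A : 'M[R[i]]_(m, n)) : R := Num.sqrt (hs2 A).

Section hilbert_schmidt.
Variable R : realType.
Local Notation C := R[i].

Lemma sqr_inj_ge0 (x y : R) : 0 <= x -> 0 <= y -> x ^+ 2 = y ^+ 2 -> x = y.
Proof. by move=> x0 y0 /eqP; rewrite eqrXn2// => /eqP. Qed.

Lemma adjE m n (A : 'M[C]_(m, n)) i j : adj A i j = Num.conj (A j i).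
Proof. by rewrite /adj !mxE. Qed.

Lemma adjK m n (A : 'M[C]_(m, n)) : adj (adj A) = A.
Proof. by apply/matrixP => i j; rewrite !adjE conjCK. Qed.

Lemma adjM m n p (A : 'M[C]_(m, n)) (B : 'M[C]_(n, p)) : adj (A *m B) = adj B *m adj A.
Proof.
apply/matrixP => i j; rewrite adjE !mxE rmorph_sum; apply: eq_bigr => l _ /=.
by rewrite conjM !adjE mulrC.
Qed.

Lemma adjD m n (A B : 'M[C]_(m, n)) : adj (A + B) = adj A + adj B.
Proof. by apply/matrixP => i j; rewrite adjE !mxE rmorphD. Qed.

Lemma adjZ m n c (A : 'M[C]_(m, n)) : adj (c *: A) = Num.conj c *: adj A.
Proof. by apply/matrixP => i j; rewrite adjE !mxE conjM. Qed.

Lemma adj1 n : adj (1%:M : 'M[C]_n) = 1%:M.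
Proof. by apply/matrixP => i j; rewrite adjE !mxE eq_sym; case: eqP => _; rewrite ?conjC1 ?conjC0. Qed.

Lemma adj_diag n (d : 'rV[C]_n) : adj (diag_mx d) = diag_mx (map_mx Num.conj d).
Proof.
apply/matrixP => i j; rewrite adjE !mxE eq_sym.
by case: eqP => [->|_]; rewrite ?mulr1n ?mulr0n ?conjC0.
Qed.

Lemma mxtrace_adj n (A : 'M[C]_n) : \tr (adj A) = Num.conj (\tr A).
Proof. by rewrite /mxtrace rmorph_sum; apply: eq_bigr => i _; rewrite adjE. Qed.

Lemma hsE m n (A : 'M[C]_(m, n)) : hs A = Num.sqrt (hs2 A).
Proof. by rewrite hs.unlock. Qed.

Lemma hs2_ge0 m n (A : 'M[C]_(m, n)) : 0 <= hs2 A.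
Proof. by rewrite hs2.unlock; apply: sumr_ge0 => i _; apply: sumr_ge0 => j _; rewrite sqr_ge0. Qed.

Lemma hs_ge0 m n (A : 'M[C]_(m, n)) : 0 <= hs A.
Proof. by rewrite hsE sqrtr_ge0. Qed.

Lemma sqr_hs m n (A : 'M[C]_(m, n)) : hs A ^+ 2 = hs2 A.
Proof. by rewrite hsE sqr_sqrtr// hs2_ge0. Qed.

Lemma tr_mul_adj m n (A : 'M[C]_(m, n)) : \tr (A *m adj A) = ((hs2 A)%:C)%C.
Proof.
rewrite hs2.unlock /mxtrace rmorph_sum; apply: eq_bigr => i _; rewrite mxE rmorph_sum.
by apply: eq_bigr => j _; rewrite adjE -normCK rmorphXn.
Qed.

Lemma tr_adj_mul m n (A : 'M[C]_(m, n)) : \tr (adj A *m A) = ((hs2 A)%:C)%C.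
Proof. by rewrite mxtrace_mulC tr_mul_adj. Qed.

Lemma hs2_adj m n (A : 'M[C]_(m, n)) : hs2 (adj A) = hs2 A.
Proof. by apply: complexI; rewrite -tr_mul_adj adjK tr_adj_mul. Qed.

Lemma hs_adj m n (A : 'M[C]_(m, n)) : hs (adj A) = hs A.
Proof. by rewrite !hsE hs2_adj. Qed.

Lemma hs2_eq0 m n (A : 'M[C]_(m, n)) : hs2 A = 0 -> A = 0.
Proof.
rewrite hs2.unlock => /eqP; rewrite psumr_eq0 => [|i _]; last by apply: sumr_ge0 => j _; rewrite sqr_ge0.
move=> /allP A0; apply/matrixP => i j; rewrite mxE.
have := A0 i (mem_index_enum _); rewrite /= psumr_eq0 => [|l _]; last by rewrite sqr_ge0.
by move=> /allP/(_ j (mem_index_enum _))/=; rewrite sqrf_eq0 => /eqP/ComplexField.Normc.eq0_normc.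
Qed.

Lemma cauchy_schwarz_sum (I : finType) (x y : I -> R) :
  (\sum_i x i * y i) ^+ 2 <= (\sum_i x i ^+ 2) * (\sum_i y i ^+ 2).
Proof.
set X := \sum_i x i ^+ 2; set Y := \sum_i y i ^+ 2; set S := \sum_i x i * y i.
have X0 : 0 <= X by apply: sumr_ge0 => i _; rewrite sqr_ge0.
have H t : 0 <= X * t ^+ 2 + 2 * t * S + Y.
  have -> : X * t ^+ 2 + 2 * t * S + Y = \sum_i (x i * t + y i) ^+ 2.
    by rewrite mulr_suml mulr_sumr -!big_split; apply: eq_bigr => i _ /=; ring.
  by apply: sumr_ge0 => i _; rewrite sqr_ge0.
have [X_0|XN] := eqVneq X 0.
  have x0 i : x i = 0.
    move: X_0 => /eqP; rewrite psumr_eq0 => [|j _]; last by rewrite sqr_ge0.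
    by move=> /allP/(_ i (mem_index_enum _)); rewrite /= sqrf_eq0 => /eqP.
  by rewrite /S big1 ?expr0n ?X_0 ?mul0r// => i _; rewrite x0 mul0r.
have Xp : 0 < X by rewrite lt0r XN.
have := H (- S / X); rewrite -(ler_pM2l Xp) mulr0.
have -> : X * (X * (- S / X) ^+ 2 + 2 * (- S / X) * S + Y) = X * Y - S ^+ 2 by field.
by rewrite subr_ge0.
Qed.

Lemma cauchy_schwarz_tr m n (A : 'M[C]_(m, n)) (B : 'M[C]_(n, m)) :
  cmod (\tr (A *m B)) <= hs A * hs B.
Proof.
rewrite -(ler_pXn2r (n := 2))// ?nnegrE ?cmod_ge0 ?mulr_ge0 ?hs_ge0// exprMn !sqr_hs.
have -> : \tr (A *m B) = \sum_(u : 'I_m * 'I_n) A u.1 u.2 * B u.2 u.1.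
  by rewrite -(pair_bigA _ (fun i j => A i j * B j i))/= /mxtrace; apply: eq_bigr => i _; rewrite mxE.
rewrite -(hs2_adj B) hs2.unlock !pair_bigA/=.
have -> : \sum_(p : 'I_m * 'I_n) cmod (adj B p.1 p.2) ^+ 2 = \sum_(p : 'I_m * 'I_n) cmod (B p.2 p.1) ^+ 2.
  by apply: eq_bigr => p _; rewrite adjE cmod_conj.
apply: le_trans (cauchy_schwarz_sum _ _).
rewrite ler_pXn2r// ?nnegrE ?cmod_ge0//; last first.
  by apply: sumr_ge0 => u _; rewrite mulr_ge0 ?cmod_ge0.
apply: le_trans (cmod_sum _ _ _) _.
by apply: ler_sum => u _; rewrite ComplexField.Normc.normcM.
Qed.

(* [mxcontr c V]: the operator norm of [V] is at most [c]. *)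
Definition mxcontr n (c : R) (V : 'M[C]_n) := forall m (B : 'M[C]_(n, m)), hs (V *m B) <= c * hs B.

(** Cauchy-Schwarz bounds the square of the left side by [hs B * hs (V *m (adj V *m B))]; the
    contraction bound for [V] then allows dividing by [hs (adj V *m B)]. *)
Lemma mxcontr_adj n c (V : 'M[C]_n) : 0 <= c -> mxcontr c V -> mxcontr c (adj V).
Proof.
move=> c0 Vc m B; have [h0|hN] := eqVneq (hs (adj V *m B)) 0.
  by rewrite h0 mulr_ge0 ?hs_ge0.
have hp : 0 < hs (adj V *m B) by rewrite lt0r hN hs_ge0.
rewrite -(ler_pM2l hp) -expr2.
have -> : hs (adj V *m B) ^+ 2 = cmod (\tr (adj B *m (V *m (adj V *m B)))).
  rewrite sqr_hs -[LHS]ger0_norm ?hs2_ge0// -cmod_real -tr_adj_mul; congr (cmod (\tr _)).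
  by rewrite adjM adjK !mulmxA.
apply: le_trans (cauchy_schwarz_tr _ _) _; rewrite hs_adj mulrA [leRHS]mulrC.
by rewrite ler_wpM2l ?hs_ge0// [leRHS]mulrC Vc.
Qed.

Lemma mxcontr_mulr n m c (V : 'M[C]_n) (B : 'M[C]_(m, n)) : 0 <= c -> mxcontr c V ->
  hs (B *m V) <= c * hs B.
Proof.
by move=> c0 /(mxcontr_adj c0) Vc; rewrite -hs_adj adjM -(hs_adj B).
Qed.

Lemma mxcontr_unitary n (V : 'M[C]_n) : adj V *m V = 1%:M -> mxcontr 1 V.
Proof.
move=> VV m B; rewrite mul1r !hsE; suff -> : hs2 (V *m B) = hs2 B by [].
by apply: complexI; rewrite -!tr_adj_mul adjM -mulmxA (mulmxA _ V) VV mul1mx.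
Qed.

End hilbert_schmidt.

(** * Functional calculus of Hermitian matrices *)

Definition eig (R : realType) n (A : 'M[R[i]]_n) (i : 'I_n) : R := complex.Re (spectral_diag A 0 i).

(** Complex-valued version of [mxfun], so that imaginary powers are covered. *)
HB.lock Definition mxfc (R : realType) n (f : R -> R[i]) (A : 'M[R[i]]_n) : 'M[R[i]]_n :=
  adj (spectralmx A) *m diag_mx (\row_i f (eig A i)) *m spectralmx A.

Section functional_calculus.
Variable R : realType.
Local Notation C := R[i].

Lemma mxfcE n f (A : 'M[C]_n) : mxfc f A =
  adj (spectralmx A) *m diag_mx (\row_i f (eig A i)) *m spectralmx A.
Proof. by rewrite mxfc.unlock. Qed.

Lemma adj_spectral n (A : 'M[C]_n) : adj (spectralmx A) *m spectralmx A = 1%:M.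
Proof.
have /unitarymxP := spectral_unitarymx A; rewrite -map_trmx => /(congr1 (@trmx _ _ _)).
by move=> UU; apply: mulmx1C; rewrite /adj map_trmx; apply/unitarymxP/spectral_unitarymx.
Qed.

Lemma spectral_adj n (A : 'M[C]_n) : spectralmx A *m adj (spectralmx A) = 1%:M.
Proof. exact: mulmx1C (adj_spectral A). Qed.

Lemma mxfunE n f (A : 'M[C]_n) : mxfun f A = mxfc (fun x => ((f x)%:C)%C) A.
Proof.
rewrite /mxfun mxfcE (invmx_unitary (spectral_unitarymx A)) /adj map_trmx.
by congr (_ *m diag_mx _ *m _); apply/rowP => i; rewrite !mxE.
Qed.

Lemma eq_mxfc n f g (A : 'M[C]_n) : (forall i, f (eig A i) = g (eig A i)) -> mxfc f A = mxfc g A.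
Proof. by move=> fg; rewrite !mxfcE; congr (_ *m diag_mx _ *m _); apply/rowP => i; rewrite !mxE. Qed.

Lemma mxfcM n f g (A : 'M[C]_n) : mxfc f A *m mxfc g A = mxfc (fun x => f x * g x) A.
Proof.
rewrite !mxfcE -!mulmxA (mulmxA (spectralmx A)) spectral_adj mul1mx (mulmxA (diag_mx _)) mulmx_diag.
by congr (_ *m (diag_mx _ *m _)); apply/rowP => i; rewrite !mxE.
Qed.

Lemma mxfcD n f g (A : 'M[C]_n) : mxfc f A + mxfc g A = mxfc (fun x => f x + g x) A.
Proof.
rewrite !mxfcE -mulmxDl -mulmxDr -raddfD.
by congr (_ *m diag_mx _ *m _); apply/rowP => i; rewrite !mxE.
Qed.

Lemma mxfcZ n c f (A : 'M[C]_n) : c *: mxfc f A = mxfc (fun x => c * f x) A.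
Proof.
rewrite !mxfcE scalemxAl scalemxAr -linearZ.
by congr (_ *m diag_mx _ *m _); apply/rowP => i; rewrite !mxE.
Qed.

Lemma mxfc1 n (A : 'M[C]_n) : mxfc (fun=> 1) A = 1%:M.
Proof.
rewrite !mxfcE (_ : \row_i 1 = const_mx 1); last by apply/rowP => i; rewrite !mxE.
by rewrite diag_const_mx mulmx1 adj_spectral.
Qed.

Lemma adj_mxfc n f (A : 'M[C]_n) : adj (mxfc f A) = mxfc (fun x => Num.conj (f x)) A.
Proof.
rewrite !mxfcE !adjM adjK mulmxA adj_diag.
by congr (_ *m diag_mx _ *m _); apply/rowP => i; rewrite !mxE.
Qed.

Lemma tr_mxfc n f (A : 'M[C]_n) : \tr (mxfc f A) = \sum_i f (eig A i).
Proof.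
rewrite !mxfcE mxtrace_mulC mulmxA spectral_adj mul1mx mxtrace_diag.
by apply: eq_bigr => i _; rewrite mxE.
Qed.

Lemma selfadj_normal n (A : 'M[C]_n) : adj A = A -> A \is normalmx.
Proof. by move=> hA; apply/normalmxP; rewrite -map_trmx -/(adj A) hA. Qed.

Lemma selfadj_spectral n (A : 'M[C]_n) : adj A = A ->
  spectralmx A *m A *m adj (spectralmx A) = diag_mx (\row_i ((eig A i)%:C)%C).
Proof.
move=> hA; have /orthomx_spectralP AE := selfadj_normal hA.
have dE : spectralmx A *m A *m adj (spectralmx A) = diag_mx (spectral_diag A).
  rewrite [X in _ *m X *m _]AE invmx_unitary ?spectral_unitarymx// -map_trmx -/(adj _).
  by rewrite !mulmxA spectral_adj mul1mx -mulmxA spectral_adj mulmx1.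
rewrite dE; congr diag_mx; apply/rowP => i; rewrite mxE RRe_real//.
have : adj (spectralmx A *m A *m adj (spectralmx A)) = spectralmx A *m A *m adj (spectralmx A).
  by rewrite !adjM adjK hA mulmxA.
rewrite dE => /matrixP/(_ i i); rewrite adjE !mxE eqxx mulr1n => h.
by rewrite CrealE h.
Qed.

Lemma mxfc_id n (A : 'M[C]_n) : adj A = A -> mxfc (fun x => (x%:C)%C) A = A.
Proof.
move=> hA; rewrite !mxfcE -(selfadj_spectral hA) !mulmxA adj_spectral mul1mx.
by rewrite -mulmxA adj_spectral mulmx1.
Qed.

Lemma diag_intertwine m n (f : R -> C) (a : 'I_m -> R) (b : 'I_n -> R) (Y : 'M[C]_(n, m)) :
  Y *m diag_mx (\row_i ((a i)%:C)%C) = diag_mx (\row_i ((b i)%:C)%C) *m Y ->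
  Y *m diag_mx (\row_i f (a i)) = diag_mx (\row_i f (b i)) *m Y.
Proof.
move=> YE; apply/matrixP => i j; have /matrixP/(_ i j) := YE.
rewrite !mul_mx_diag !mul_diag_mx !mxE mulrC => h.
have [->|/mulIf Y0] := eqVneq (Y i j) 0; first by rewrite mul0r mulr0.
by move/Y0 : h => /complexI ->; rewrite mulrC.
Qed.

(* An intertwiner has entries only between matching eigenvalues, hence it intertwines every function. *)
Lemma mxfc_intertwine m n f (g : R -> R) (A : 'M[C]_m) (B : 'M[C]_n) (X : 'M[C]_(n, m)) :
  adj A = A -> X *m A = mxfc (fun x => ((g x)%:C)%C) B *m X ->
  X *m mxfc f A = mxfc (f \o g) B *m X.
Proof.
move=> hA XA; pose Y := spectralmx B *m X *m adj (spectralmx A).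
have YE : Y *m diag_mx (\row_i ((eig A i)%:C)%C) = diag_mx (\row_i ((g (eig B i))%:C)%C) *m Y.
  rewrite -(selfadj_spectral hA) /Y -!mulmxA (mulmxA (adj (spectralmx A))) adj_spectral mul1mx.
  rewrite (mulmxA X) XA !mxfcE !mulmxA spectral_adj mul1mx; congr (_ *m _ *m _ *m _).
have Yf := diag_intertwine f YE.
have := congr1 (fun Z => adj (spectralmx B) *m Z *m spectralmx A) Yf.
rewrite /Y !mxfcE !mulmxA adj_spectral mul1mx => ->.
by rewrite -!mulmxA adj_spectral mulmx1.
Qed.

Lemma mxfc_comm n f (A B : 'M[C]_n) : adj A = A -> B *m A = A *m B ->
  B *m mxfc f A = mxfc f A *m B.
Proof.
by move=> hA BA; apply: (@mxfc_intertwine _ _ f id) => //; rewrite mxfc_id.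
Qed.

(** The eigenbases chosen for [A] and [B] may differ, so this is not a computation on diagonals; the
    identity matrix serves as intertwiner. *)
Lemma mxfc_comp n f (g : R -> R) (A B : 'M[C]_n) : adj A = A ->
  A = mxfc (fun x => ((g x)%:C)%C) B -> mxfc f A = mxfc (f \o g) B.
Proof.
move=> hA AE; rewrite -[LHS]mul1mx -[RHS]mulmx1.
by apply: mxfc_intertwine; rewrite // mulmx1 mul1mx.
Qed.

Lemma mxfc_unitary_conj n f (A U : 'M[C]_n) : adj A = A -> U *m adj U = 1%:M ->
  mxfc f (adj U *m A *m U) = adj U *m mxfc f A *m U.
Proof.
move=> hA UU; have UU' := mulmx1C UU.
rewrite -[LHS]mul1mx -UU' -[RHS]mulmxA -[LHS]mulmxA; congr (_ *m _).
apply: (@mxfc_intertwine _ _ f id); first by rewrite !adjM adjK hA mulmxA.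
by rewrite mxfc_id// !mulmxA UU mul1mx.
Qed.

(* Evaluate on the spectral projections of [T], on which [S *m T] acts as a multiple of [S]. *)
Lemma mxfc_mulmx n (f : R -> C) (S T : 'M[C]_n) : adj S = S -> adj T = T ->
  S *m T = T *m S -> (forall i j, f (eig T i * eig S j) = f (eig T i) * f (eig S j)) ->
  mxfc f (S *m T) = mxfc f S *m mxfc f T.
Proof.
move=> hS hT ST fM.
have hST : adj (S *m T) = S *m T by rewrite adjM hS hT ST.
have col0 i : (mxfc f (S *m T) - mxfc f S *m mxfc f T) *m
    mxfc (fun x => (x == eig T i)%:R) T = 0.
  set Q := mxfc (fun x => (x == eig T i)%:R) T.
  have SQ : S *m Q = Q *m S by apply: mxfc_comm.
  have TQ h : mxfc h T *m Q = h (eig T i) *: Q.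
    rewrite mxfcM mxfcZ; apply: eq_mxfc => j /=.
    by have [->|] := eqVneq (eig T j) (eig T i); rewrite ?mulr1 ?mulr0.
  have hQ : adj Q = Q.
    by rewrite adj_mxfc; apply: eq_mxfc => j /=; case: (_ == _); rewrite ?conjC1 ?conjC0.
  have STQ : Q *m (S *m T) = mxfc (fun x => ((eig T i * x)%:C)%C) S *m Q.
    have -> : mxfc (fun x => ((eig T i * x)%:C)%C) S = ((eig T i)%:C)%C *: S.
      rewrite -[in RHS](mxfc_id hS) mxfcZ; apply: eq_mxfc => j; exact: rmorphM.
    rewrite mulmxA -SQ -mulmxA -scalemxAl scalemxAr; congr (_ *m _).
    by rewrite -[X in Q *m X](mxfc_id hT) -(TQ (fun x => (x%:C)%C)) /Q !mxfcM; apply: eq_mxfc => j; exact: mulrC.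
  have SQf : mxfc f S *m Q = Q *m mxfc f S.
    by apply: esym; apply: mxfc_comm => //; rewrite SQ.
  have QST : Q *m (S *m T) = S *m T *m Q.
    have TQc : T *m Q = Q *m T by apply: mxfc_comm.
    by rewrite mulmxA -SQ -[LHS]mulmxA -TQc mulmxA.
  rewrite mulmxBl -[X in X - _](mxfc_comm f hST QST).
  rewrite (mxfc_intertwine f hST STQ) -[X in _ - X]mulmxA TQ -scalemxAr scalemxAl -mulmxBl.
  suff -> : mxfc (f \o *%R (eig T i)) S = f (eig T i) *: mxfc f S by rewrite subrr mul0mx.
  by rewrite mxfcZ; apply: eq_mxfc => j /=; rewrite fM.
apply/eqP; rewrite -subr_eq0; apply/eqP.
rewrite -[LHS]mulmx1 -(adj_spectral T) mulmxA -[RHS](mul0mx _ (spectralmx T)); congr (_ *m _).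
move: (mxfc f (S *m T) - _) col0 => D col0.
apply/matrixP => i j; have := congr1 (fun Z => (Z *m adj (spectralmx T)) i j) (col0 j).
rewrite !mxfcE mul0mx -!mulmxA spectral_adj mulmx1 mulmxA mul_mx_diag !mxE => {2}<-.
by rewrite eqxx mulr1.
Qed.

Lemma mxcontr_mxfc n (c : R) f (V A : 'M[C]_n) : 0 <= c -> adj V *m V = mxfc f A ->
  (forall i, f (eig A i) <= (((c ^+ 2)%:C)%C)) -> mxcontr c V.
Proof.
move=> c0 VV fc m B; rewrite -(ler_pXn2r (n := 2))// ?nnegrE ?mulr_ge0 ?hs_ge0//.
rewrite exprMn !sqr_hs -lecR -tr_adj_mul adjM -mulmxA (mulmxA (adj V)) VV.
set U := spectralmx A; pose D := U *m B.
have -> : ((c ^+ 2 * hs2 B)%:C)%C = \sum_j \sum_i ((c ^+ 2)%:C)%C * `|D i j| ^+ 2.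
  rewrite rmorphM/= -tr_adj_mul -[X in adj B *m X]mul1mx -(adj_spectral A) -/U mulmxA mulmxA -adjM -mulmxA -/D.
  rewrite mulr_sumr; apply: eq_bigr => j _; rewrite mxE -mulr_sumr; congr (_ * _).
  by apply: eq_bigr => i _; rewrite adjE mulrC normCK.
have -> : adj B *m (mxfc f A *m B) = adj D *m (diag_mx (\row_i f (eig A i)) *m D).
  by rewrite !mxfcE /D adjM -/U !mulmxA.
apply: ler_sum => j _; rewrite mxE; apply: ler_sum => i _.
move: D => D; rewrite adjE mul_diag_mx !mxE mulrCA -normCKC.
by rewrite ler_wpM2r ?exprn_ge0.
Qed.

End functional_calculus.

(** * Positivity and complex powers *)

(* The power [x ^ (s + i y)], with value 0 at [x = 0] also when [s = 0]: imaginary powers of a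
   positive semidefinite matrix are partial isometries. *)
Definition cpow (R : realType) (x s y : R) : R[i] := if 0 < x then cexp (ln x) s y else 0.

HB.lock Definition cpw (R : realType) n (A : 'M[R[i]]_n) s y := mxfc (fun x => cpow x s y) A.

HB.lock Definition trpow (R : realType) n (r : R) (X : 'M[R[i]]_n) : R := \sum_i singval X i `^ r.

Section positivity.
Variable R : realType.
Local Notation C := R[i].
Implicit Types x s y r a b : R.

Lemma quad_mxfc n f (A : 'M[C]_n) (v : 'cV[C]_n) :
  (adj v *m mxfc f A *m v) 0 0 = \sum_i f (eig A i) * `|(spectralmx A *m v) i 0| ^+ 2.
Proof.
set w := spectralmx A *m v.
have -> : adj v *m mxfc f A *m v = adj w *m (diag_mx (\row_i f (eig A i)) *m w).
  by rewrite /w mxfcE adjM !mulmxA.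
move: w => w; rewrite mxE; apply: eq_bigr => i _.
by rewrite adjE mul_diag_mx !mxE mulrCA -normCKC.
Qed.

Lemma psd_mxfc n f (A : 'M[C]_n) : (forall i, 0 <= f (eig A i)) -> psdmx (mxfc f A).
Proof.
by move=> f0 v; rewrite quad_mxfc sumr_ge0// => i _; rewrite mulr_ge0 ?exprn_ge0.
Qed.

Lemma pd_mxfc n f (A : 'M[C]_n) : (forall i, 0 < f (eig A i)) -> pdmx (mxfc f A).
Proof.
move=> f0 v v0; rewrite lt0r psd_mxfc ?andbT; last by move=> i; rewrite ltW.
apply: contra v0; rewrite quad_mxfc psumr_eq0 => [/allP h|i _]; last first.
  by rewrite mulr_ge0 ?exprn_ge0// ltW.
have w0 : spectralmx A *m v = 0.
  apply/colP => i; rewrite [RHS]mxE; have := h i (mem_index_enum _).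
  by rewrite /= mulf_eq0 gt_eqF//= sqrf_eq0 normr_eq0 => /eqP.
by rewrite -[v]mul1mx -(adj_spectral A) -mulmxA w0 mulmx0.
Qed.

Lemma pd_psd n (A : 'M[C]_n) : pdmx A -> psdmx A.
Proof.
move=> pA v; have [->|/pA/ltW//] := eqVneq v 0.
by rewrite mulmx0 mxE lexx.
Qed.

Lemma psd_gram m n (A : 'M[C]_(m, n)) : psdmx (adj A *m A).
Proof.
move=> v; have -> : adj v *m (adj A *m A) *m v = adj (A *m v) *m (A *m v).
  by rewrite adjM !mulmxA.
by rewrite mxE; apply: sumr_ge0 => i _; rewrite adjE -normCKC exprn_ge0.
Qed.

Lemma quad_delta n (A : 'M[C]_n) i j : (adj (delta_mx i 0 : 'cV[C]_n) *m A *m (delta_mx j 0 : 'cV[C]_n)) 0 0 = A i j.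
Proof.
have -> : adj (delta_mx i 0 : 'cV[C]_n) = delta_mx 0 i.
  apply/matrixP => k l; rewrite adjE !mxE andbC.
  by case: (_ && _); rewrite ?conjC1 ?conjC0.
by rewrite -rowE -colE !mxE.
Qed.

(** Polarisation: testing on e_i + c e_j with c = 1 and c = i gives B_ij + B_ji = 0 and B_ij =
    B_ji. *)
Lemma quad_eq0 n (B : 'M[C]_n) : (forall v : 'cV[C]_n, (adj v *m B *m v) 0 0 = 0) -> B = 0.
Proof.
move=> B0; apply/matrixP => i j; rewrite [RHS]mxE.
have entryE (a b a' b' : 'M[C]_1) (x y z : C) :
    (a + x *: b + (y *: a' + z *: b')) 0 0 = a 0 0 + x * b 0 0 + (y * a' 0 0 + z * b' 0 0).
  by rewrite !mxE.
have H (c : C) : c * B i j + Num.conj c * B j i = 0.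
  have := B0 (delta_mx i 0 + c *: delta_mx j 0).
  have := B0 (delta_mx i 0); have := B0 (delta_mx j 0).
  rewrite adjD adjZ !mulmxDl !mulmxDr -!scalemxAl -!scalemxAr !scalerA.
  rewrite entryE !quad_delta => -> ->.
  by rewrite add0r mulr0 addr0.
have h1 := H 1; have h2 := H 'i.
rewrite conjC1 !mul1r in h1; rewrite conjCi mulNr -mulrBr in h2.
have /eqP := h2; rewrite mulf_eq0 (negbTE (neq0Ci _)) /= subr_eq0 => /eqP e.
by move: h1; rewrite -e -mulr2n => /eqP; rewrite mulrn_eq0/= => /eqP.
Qed.

(** The order of C makes the quadratic form real, so the form of [A - adj A] vanishes. *)
Lemma psd_selfadj n (A : 'M[C]_n) : psdmx A -> adj A = A.
Proof.
move=> pA; apply/esym/eqP; rewrite -subr_eq0; apply/eqP/quad_eq0 => v.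
rewrite mulmxBr mulmxBl mxE [X in _ + X]mxE.
have -> : adj v *m adj A *m v = adj (adj v *m A *m v) by rewrite !adjM adjK mulmxA.
by rewrite adjE (conj_Creal (ger0_real (pA v))) subrr.
Qed.

Lemma eig_quad n (A : 'M[C]_n) i : adj A = A ->
  ((eig A i)%:C)%C = (adj (adj (row i (spectralmx A))) *m A *m adj (row i (spectralmx A))) 0 0.
Proof.
move=> hA; set U := spectralmx A.
have -> : adj (row i U) = adj U *m delta_mx i 0.
  by rewrite -colE; apply/colP => k; rewrite adjE !mxE.
rewrite adjM adjK.
have -> : adj (delta_mx i 0 : 'cV[C]_n) *m U *m A *m (adj U *m (delta_mx i 0 : 'cV[C]_n)) =
    adj (delta_mx i 0 : 'cV[C]_n) *m (U *m A *m adj U) *m (delta_mx i 0 : 'cV[C]_n) by rewrite !mulmxA.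
by rewrite quad_delta selfadj_spectral// !mxE eqxx mulr1n.
Qed.

Lemma eig_ge0 n (A : 'M[C]_n) i : psdmx A -> 0 <= eig A i.
Proof. by move=> pA; rewrite -lecR eig_quad ?psd_selfadj. Qed.

Lemma eig_gt0 n (A : 'M[C]_n) i : pdmx A -> 0 < eig A i.
Proof.
move=> pA; rewrite -ltcR eig_quad ?psd_selfadj ?pA//; last exact: pd_psd.
apply/eqP => /(congr1 (@adj R _ _)); rewrite adjK rowE => h.
have := congr1 (fun Z => (Z *m adj (spectralmx A)) 0 i) h.
rewrite -mulmxA spectral_adj mulmx1 mxE !eqxx => /eqP.
have -> : adj (0 : 'cV[C]_n) = 0 by apply/matrixP => k l; rewrite adjE !mxE conjC0.
by rewrite mul0mx [X in _ == X]mxE oner_eq0.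
Qed.

Lemma pd_unit n (A : 'M[C]_n) : pdmx A -> A \in unitmx.
Proof.
move=> pA; have hA := psd_selfadj (pd_psd pA).
suff : A *m mxfc (fun x => ((x^-1)%:C)%C) A = 1%:M by move/mulmx1_unit => [].
rewrite -[X in X *m _](mxfc_id hA) mxfcM -(mxfc1 A); apply: eq_mxfc => i.
by rewrite -rmorphM/= divff// gt_eqF// eig_gt0.
Qed.

Lemma pd_congr n (A G : 'M[C]_n) : G \in unitmx -> pdmx A -> pdmx (adj G *m A *m G).
Proof.
move=> Gu pA v v0; have -> : adj v *m (adj G *m A *m G) *m v = adj (G *m v) *m A *m (G *m v).
  by rewrite adjM !mulmxA.
by apply: pA; apply: contra v0 => /eqP Gv; rewrite -(mulKmx Gu v) Gv mulmx0.
Qed.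

Lemma psd_congr m n (A : 'M[C]_n) (G : 'M[C]_(n, m)) : psdmx A -> psdmx (adj G *m A *m G).
Proof.
move=> pA v; have -> : adj v *m (adj G *m A *m G) *m v = adj (G *m v) *m A *m (G *m v).
  by rewrite adjM !mulmxA.
exact: pA.
Qed.

Lemma pd_lower_bound n (A : 'M[C]_n) : pdmx A -> exists2 c : R, 0 < c & psdmx (A - (c%:C)%C *: 1%:M).
Proof.
move=> pA; have hA := psd_selfadj (pd_psd pA).
have [c c0 cP] : exists2 c : R, 0 < c & forall i, c <= eig A i.
  (* The default value 1 keeps the bound positive in dimension zero. *)
  exists (\big[Num.min/1]_i eig A i); first by rewrite lt_bigmin ?ltr01// => i _; rewrite eig_gt0.
  by move=> i; rewrite bigmin_le_cond.
exists c => //; rewrite -[X in X - _](mxfc_id hA) -(mxfc1 A) mxfcZ -scaleN1r mxfcZ mxfcD.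
apply: psd_mxfc => i; rewrite mulr1 mulN1r subr_ge0; by rewrite lecR.
Qed.

Lemma cpowM x s y s' y' : cpow x s y * cpow x s' y' = cpow x (s + s') (y + y').
Proof. by rewrite /cpow; case: ifP => _; rewrite ?mul0r// cexpD. Qed.

Lemma conj_cpow x s y : Num.conj (cpow x s y) = cpow x s (- y).
Proof. by rewrite /cpow; case: ifP => _; rewrite ?conjC0// cexp_conj. Qed.

Lemma cpowr x s : 0 < x -> cpow x s 0 = ((x `^ s)%:C)%C.
Proof. by move=> x0; rewrite /cpow x0 cexpr /powR gt_eqF// mulrC. Qed.

(** At x = 0 and exponent 0, [powR] equals 1 and [cpow] equals 0, hence the condition on [s]. *)
Lemma cpowr0 x s : 0 <= x -> s != 0 -> cpow x s 0 = ((x `^ s)%:C)%C.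
Proof.
rewrite le_eqVlt => /orP[/eqP <-|x0 _]; last exact: cpowr.
by move=> s0; rewrite /cpow ltxx powR0.
Qed.

Lemma cpow_ge0 x s : 0 <= cpow x s 0.
Proof. by rewrite /cpow; case: ifP => // _; rewrite cexpr lecR expR_ge0. Qed.

Lemma cpow_mul x x' s y : 0 <= x -> 0 <= x' -> cpow (x * x') s y = cpow x s y * cpow x' s y.
Proof.
rewrite le_eqVlt => /orP[/eqP <-|x0]; first by rewrite mul0r /cpow ltxx mul0r.
rewrite le_eqVlt => /orP[/eqP <-|x'0]; first by rewrite mulr0 /cpow ltxx mulr0.
by rewrite /cpow mulr_gt0// x0 x'0 lnM// cexpDl.
Qed.

Lemma exppoly_cpow x a b : exppoly (fun s y => cpow x (a + b * s) (b * y)).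
Proof.
rewrite /cpow; case: (0 < x); last exact: exppoly_cst.
exact: (exppoly_affine a b (exppoly_cexp _)).
Qed.

Lemma cpwE n (A : 'M[C]_n) s y : cpw A s y = mxfc (fun x => cpow x s y) A.
Proof. by rewrite cpw.unlock. Qed.

Lemma cpwM n (A : 'M[C]_n) s y s' y' : cpw A s y *m cpw A s' y' = cpw A (s + s') (y + y').
Proof. by rewrite !cpwE mxfcM; apply: eq_mxfc => i; rewrite cpowM. Qed.

Lemma eq_cpw n (A : 'M[C]_n) s y s' y' : s = s' -> y = y' -> cpw A s y = cpw A s' y'.
Proof. by move=> -> ->. Qed.

Lemma cpw_mul n (A : 'M[C]_n) s y s' y' t u : s + s' = t -> y + y' = u ->
  cpw A s y *m cpw A s' y' = cpw A t u.
Proof. by move=> <- <-; rewrite cpwM. Qed.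

Lemma adj_cpw n (A : 'M[C]_n) s y : adj (cpw A s y) = cpw A s (- y).
Proof. by rewrite !cpwE adj_mxfc; apply: eq_mxfc => i; rewrite conj_cpow. Qed.

Lemma cpw0 n (A : 'M[C]_n) : pdmx A -> cpw A 0 0 = 1%:M.
Proof.
by move=> pA; rewrite cpwE -(mxfc1 A); apply: eq_mxfc => i; rewrite cpowr ?eig_gt0// powRr0.
Qed.

Lemma cpw1 n (A : 'M[C]_n) : psdmx A -> cpw A 1 0 = A.
Proof.
move=> pA; rewrite cpwE -[RHS](mxfc_id (psd_selfadj pA)); apply: eq_mxfc => i.
by rewrite cpowr0 ?eig_ge0 ?oner_eq0// powRr1 ?eig_ge0.
Qed.

Lemma mxpow_cpw n (A : 'M[C]_n) s : pdmx A -> mxpow s A = cpw A s 0.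
Proof.
by move=> pA; rewrite /mxpow mxfunE cpwE; apply: eq_mxfc => i; rewrite cpowr ?eig_gt0.
Qed.

Lemma cpw_comm n (A B : 'M[C]_n) s y : adj A = A -> B *m A = A *m B ->
  B *m cpw A s y = cpw A s y *m B.
Proof. by rewrite cpwE; exact: mxfc_comm. Qed.

Lemma psd_cpw n (A : 'M[C]_n) s : psdmx (cpw A s 0).
Proof. by rewrite cpwE; apply: psd_mxfc => i; rewrite cpow_ge0. Qed.

Lemma pd_cpw n (A : 'M[C]_n) s : pdmx A -> pdmx (cpw A s 0).
Proof. by move=> pA; rewrite cpwE; apply: pd_mxfc => i; rewrite cpowr ?eig_gt0// ltcR powR_gt0 ?eig_gt0. Qed.

Lemma cpw_cpw n (A : 'M[C]_n) a s : cpw (cpw A a 0) s 0 = cpw A (a * s) 0.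
Proof.
pose g x := complex.Re (cpow x a 0).
have cE : cpw A a 0 = mxfc (fun x => ((g x)%:C)%C) A.
  by rewrite cpwE; apply: eq_mxfc => i; rewrite /g RRe_real// ger0_real// cpow_ge0.
have hA : adj (cpw A a 0) = cpw A a 0 by rewrite adj_cpw oppr0.
rewrite [LHS]cpwE (mxfc_comp _ hA cE) cpwE; apply: eq_mxfc => i /=.
rewrite /g /cpow; case: (ltP 0 (eig A i)) => [x0|_]; last by rewrite ltxx.
by rewrite cexpr/= expR_gt0 expRK !cexpr -mulrA mulrCA mulrA.
Qed.

Lemma trpowE n r (X : 'M[C]_n) : trpow r X = \sum_i singval X i `^ r.
Proof. by rewrite trpow.unlock. Qed.

Lemma trpow_ge0 n r (X : 'M[C]_n) : 0 <= trpow r X.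
Proof. by rewrite trpowE; apply: sumr_ge0 => i _; rewrite powR_ge0. Qed.

Lemma tr_cpw_gram n r (X : 'M[C]_n) : 0 < r ->
  \tr (cpw (adj X *m X) (r / 2) 0) = ((trpow r X)%:C)%C.
Proof.
move=> r0; rewrite cpwE tr_mxfc trpowE rmorph_sum; apply: eq_bigr => i _ /=.
have e0 := eig_ge0 i (psd_gram X).
rewrite cpowr0// ?gt_eqF ?divr_gt0//; congr (_%:C)%C.
by rewrite /singval -/(eig _ i) -powR12_sqrt// -powRrM mulrC.
Qed.

Lemma schattenE n r (X : 'M[C]_n) : schatten r%:E X = trpow r X `^ r^-1.
Proof. by rewrite trpowE. Qed.

Lemma schatten_ge0 n (p : \bar R) (X : 'M[C]_n) : 0 <= schatten p X.
Proof.
case: p => [r| |] //=; first exact: powR_ge0.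
by elim/big_rec : _ => // i x _ x0; rewrite le_max x0 orbT.
Qed.

Lemma schatten2 n (X : 'M[C]_n) : schatten 2%:E X = hs X.
Proof.
rewrite schattenE powR12_sqrt ?trpow_ge0// hsE; congr Num.sqrt; apply: complexI.
by rewrite -tr_cpw_gram// divff// cpw1 ?tr_adj_mul//; exact: psd_gram.
Qed.

Lemma mxcontr_schatten n (X : 'M[C]_n) : mxcontr (schatten +oo%E X) X.
Proof.
apply: (@mxcontr_mxfc _ _ _ (fun x => (x%:C)%C) _ (adj X *m X)).
- exact: schatten_ge0.
- by rewrite mxfc_id// adjM adjK.
move=> i; rewrite lecR.
have -> : eig (adj X *m X) i = singval X i ^+ 2.
  by rewrite /singval sqr_sqrtr ?eig_ge0//; exact: psd_gram.
rewrite ler_pXn2r// ?nnegrE ?schatten_ge0 ?sqrtr_ge0//.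
exact: le_bigmax_cond.
Qed.

End positivity.

(** * Hoelder inequality for the amalgamated norm *)

(** For [A] commuting with sigma this is the square of the weighted 4-norm of [A], in the form in
    which Cauchy-Schwarz produces it. *)
HB.lock Definition alpha (R : realType) n (sigma A : 'M[R[i]]_n) : R :=
  hs (cpw sigma (1 / 2) 0 *m (adj A *m A)).

Section holder.
Variable R : realType.
Local Notation C := R[i].

Lemma le_of_eq (x y : R) : x = y -> x <= y.
Proof. by move=> ->. Qed.

Definition mxexp m n (M : R -> R -> 'M[C]_(m, n)) := forall i j, exppoly (fun s y => M s y i j).

Lemma mxexp_cst m n (A : 'M[C]_(m, n)) : mxexp (fun _ _ => A).
Proof. by move=> i j; exact: exppoly_cst. Qed.

Lemma mxexpM m n p (A : R -> R -> 'M[C]_(m, n)) (B : R -> R -> 'M[C]_(n, p)) :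
  mxexp A -> mxexp B -> mxexp (fun s y => A s y *m B s y).
Proof.
move=> hA hB i j.
apply: (@eq_exppoly _ _ (fun s y => \sum_k A s y i k * B s y k j)); first by move=> s y; rewrite mxE.
by apply: exppoly_sum => k; apply: exppolyM.
Qed.

Lemma exppoly_tr n (A : R -> R -> 'M[C]_n) : mxexp A -> exppoly (fun s y => \tr (A s y)).
Proof. by move=> hA; apply: exppoly_sum => i. Qed.

Lemma mxexp_mxfc n (f : R -> R -> R -> C) (A : 'M[C]_n) : (forall x, exppoly (f x)) ->
  mxexp (fun s y => mxfc (fun x => f x s y) A).
Proof.
move=> fe i j.
pose D s y := diag_mx (\row_i f (eig A i) s y).
suff De : mxexp D.
  have h := mxexpM (mxexpM (mxexp_cst (adj (spectralmx A))) De) (mxexp_cst (spectralmx A)).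
  by apply: eq_exppoly (h i j) => s y; rewrite mxfcE.
move=> {i j} i j; case: (eqVneq i j) => [->|ij].
  by apply: eq_exppoly (fe (eig A j)) => s y; rewrite /D !mxE eqxx mulr1n.
by apply: eq_exppoly (exppoly_cst 0) => s y; rewrite /D !mxE (negbTE ij) mulr0n.
Qed.

Lemma mxexp_cpw n (A : 'M[C]_n) a b : mxexp (fun s y => cpw A (a + b * s) (b * y)).
Proof.
move=> i j; have h := @mxexp_mxfc _ (fun x s y => cpow x (a + b * s) (b * y)) A (fun x => exppoly_cpow x a b).
by apply: eq_exppoly (h i j) => s y; rewrite cpwE.
Qed.

(* [M |M| ^ (w - 1)], an analytic family through [M] at [w = 1]. *)
Definition polpow n (M : 'M[C]_n) s y : 'M[C]_n :=
  M *m cpw (adj M *m M) (- (1 / 2) + 1 / 2 * s) (1 / 2 * y).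

Lemma gram_polpow n (M : 'M[C]_n) s y :
  adj (polpow M s y) *m polpow M s y = cpw (adj M *m M) s 0.
Proof.
rewrite /polpow adjM adj_cpw -mulmxA (mulmxA (adj M)).
rewrite -[X in _ *m (X *m _)](cpw1 (psd_gram M)) cpwM.
by apply: cpw_mul; field.
Qed.

(** The zeroth power of [adj M *m M] is its support projection rather than 1; [M] vanishes on the
    complement, as the Hilbert-Schmidt norm shows. *)
Lemma polpow1 n (M : 'M[C]_n) : polpow M 1 0 = M.
Proof.
have h : M *m mxfc (fun x => 1 - cpow x 0 0) (adj M *m M) = 0.
  apply: hs2_eq0; apply: complexI; rewrite -tr_adj_mul adjM -mulmxA (mulmxA (adj M)).
  rewrite adj_mxfc -[X in _ *m (X *m _)](mxfc_id (psd_selfadj (psd_gram M))) !mxfcM tr_mxfc.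
  rewrite big1// => i _; have := eig_ge0 i (psd_gram M); rewrite le_eqVlt => /orP[/eqP <-|e0].
    by rewrite (_ : (0%:C)%C = 0 :> C)// mul0r mulr0.
  by rewrite cpowr// powRr0 subrr !mulr0.
have : M *m mxfc (fun x => 1) (adj M *m M) = polpow M 1 0.
  rewrite /polpow mulr1 addNr mulr0 cpwE; apply/eqP; rewrite -subr_eq0 -mulmxBr -scaleN1r mxfcZ mxfcD.
  by rewrite -[X in _ == X]h; apply/eqP; congr (_ *m _); apply: eq_mxfc => i; rewrite mulN1r.
by rewrite mxfc1 mulmx1.
Qed.

Lemma mxexp_polpow n (M : 'M[C]_n) a b : mxexp (fun s y => polpow M (a + b * s) (b * y)).
Proof.
move=> i j; have h := mxexpM (mxexp_cst M) (mxexp_cpw (adj M *m M) (- (1 / 2) + 1 / 2 * a) (1 / 2 * b)).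
apply: eq_exppoly (h i j) => s y.
rewrite /polpow.
have -> : - (1 / 2) + 1 / 2 * (a + b * s) = - (1 / 2) + 1 / 2 * a + 1 / 2 * b * s by ring.
by have -> : 1 / 2 * (b * y) = 1 / 2 * b * y by ring.
Qed.

Lemma mxcontr_polpow0 n (M : 'M[C]_n) y : mxcontr 1 (polpow M 0 y).
Proof.
apply: (@mxcontr_mxfc _ _ _ (fun x => cpow x 0 0) _ (adj M *m M)) => [//||i]; first by rewrite gram_polpow cpwE.
rewrite expr1n /cpow; case: ifP => _; last by rewrite ler01.
by rewrite cexpr mulr0 expR0.
Qed.

Lemma hs2_polpow n (M : 'M[C]_n) r y : 0 < r -> hs2 (polpow M (r / 2) y) = trpow r M.
Proof. by move=> r0; apply: complexI; rewrite -tr_adj_mul gram_polpow tr_cpw_gram. Qed.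

(** * Calculus in a subalgebra commuting with sigma, and the Hoelder inequality *)

Section subalgebra.
Variables (n : nat) (N : 'M[C]_n -> Prop).
Hypothesis N1 : N 1%:M.
Hypothesis ND : forall A B, N A -> N B -> N (A + B).
Hypothesis NZ : forall c A, N A -> N (c *: A).
Hypothesis NM : forall A B, N A -> N B -> N (A *m B).
Hypothesis Nadj : forall A, N A -> N (adj A).

(** On a finite spectrum every function agrees with a polynomial, built here in Newton form one
    eigenvalue at a time. *)
Lemma N_mxfc f A : adj A = A -> N A -> N (mxfc f A).
Proof.
move=> hA NA.
have Ncst (c : C) : N (mxfc (fun=> c) A).
  have -> : mxfc (fun=> c) A = c *: 1%:M; last exact: NZ.
  by rewrite -(mxfc1 A) mxfcZ; apply: eq_mxfc => i; rewrite mulr1.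
have Nprod (s : seq R) : N (mxfc (fun x => \prod_(t <- s) ((x - t)%:C)%C) A).
  elim: s => [|t s IH]; first by rewrite (eq_mxfc (g := fun=> 1)) // => i; rewrite big_nil.
  rewrite (eq_mxfc (g := fun x => (x%:C + ((- t)%:C))%C * \prod_(t <- s) ((x - t)%:C)%C)).
    by rewrite -mxfcM -mxfcD mxfc_id//; apply: (NM _ IH); apply: ND.
  by move=> i; rewrite big_cons rmorphB rmorphN.
have [g [Ng gE]] : exists g, N (mxfc g A) /\ forall x, x \in codom (eig A) -> g x = f x.
  elim: (codom _) => [|x s [g [Ng gE]]]; first by exists (fun=> 0).
  have [xs|xs] := boolP (x \in s).
    by exists g; split => // z; rewrite inE => /orP[/eqP ->|/gE//]; apply: gE.
  (* Newton coefficient: the correction vanishes at the earlier nodes [s] and repairs the value at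
     [x]. *)
  pose c := (f x - g x) / \prod_(t <- s) ((x - t)%:C)%C.
  exists (fun z => g z + c * \prod_(t <- s) ((z - t)%:C)%C); split.
    have := ND Ng (NZ c (Nprod s)).
    by rewrite mxfcZ mxfcD.
  move=> z; rewrite inE => /orP[/eqP ->|zs].
    suff P0 : \prod_(t <- s) ((x - t)%:C)%C != 0 by rewrite /c divfK// addrC subrK.
    rewrite prodf_seq_neq0; apply/allP => t ts /=.
    by apply: contra xs => /eqP/complexI/eqP; rewrite subr_eq0 => /eqP ->.
  rewrite gE// (_ : \prod_(t <- s) _ = 0) ?mulr0 ?addr0//.
  by apply/eqP; rewrite prodf_seq_eq0; apply/hasP; exists z => //=; rewrite subrr.
rewrite (eq_mxfc (g := g))// => i; by rewrite gE// codom_f.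
Qed.

Lemma N_cpw A s y : adj A = A -> N A -> N (cpw A s y).
Proof. by move=> hA NA; rewrite cpwE; apply: N_mxfc. Qed.

Lemma N_polpow A s y : N A -> N (polpow A s y).
Proof.
move=> NA; apply: NM => //; apply: N_cpw; first by rewrite adjM adjK.
by apply: NM => //; apply: Nadj.
Qed.

Variable sigma : 'M[C]_n.
Hypothesis sigma_pd : pdmx sigma.
Hypothesis sigma_comm : forall A, N A -> A *m sigma = sigma *m A.

Let sigma_sa : adj sigma = sigma := psd_selfadj (pd_psd sigma_pd).

Lemma sigma_cpw_comm A s y : N A -> A *m cpw sigma s y = cpw sigma s y *m A.
Proof. by move=> NA; apply: cpw_comm => //; apply: sigma_comm. Qed.

Lemma tr_sigma_cyc A B : N A -> \tr (sigma *m (A *m B)) = \tr (sigma *m (B *m A)).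
Proof.
move=> NA; rewrite [LHS](_ : _ = \tr (A *m (sigma *m B))); last first.
  by rewrite [in RHS]mulmxA sigma_comm// mulmxA.
by rewrite mxtrace_mulC mulmxA.
Qed.

Local Notation alpha := (alpha sigma).

Lemma alphaE A : alpha A = hs (cpw sigma (1 / 2) 0 *m (adj A *m A)).
Proof. by rewrite alpha.unlock. Qed.

Lemma alpha_ge0 A : 0 <= alpha A.
Proof. by rewrite alphaE hs_ge0. Qed.

Lemma sqr_alphaE A : N A -> ((alpha A ^+ 2)%:C)%C = \tr (sigma *m ((adj A *m A) *m (adj A *m A))).
Proof.
move=> NA; rewrite alphaE sqr_hs -tr_adj_mul; set G := adj A *m A.
have NG : N G by apply: NM => //; apply: Nadj.
have hG : adj G = G by rewrite adjM adjK.
have cG s : G *m cpw sigma s 0 = cpw sigma s 0 *m G := sigma_cpw_comm s 0 NG.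
rewrite adjM hG adj_cpw oppr0 cG -mulmxA (mulmxA G) cG mulmxA mulmxA.
rewrite (@cpw_mul _ _ sigma (1 / 2) 0 (1 / 2) 0 1 0); [|by field|by rewrite addr0].
by rewrite (cpw1 (pd_psd sigma_pd)) mulmxA.
Qed.

Lemma alpha_adj A : N A -> alpha (adj A) = alpha A.
Proof.
move=> NA; apply: sqr_inj_ge0; [exact: alpha_ge0|exact: alpha_ge0|apply: complexI].
rewrite (sqr_alphaE NA) (sqr_alphaE (Nadj NA)) adjK.
by rewrite -[in LHS](mulmxA A) (tr_sigma_cyc _ NA) -!mulmxA.
Qed.

Variables (Z tau : 'M[C]_n).
Hypothesis Z_pd : pdmx Z.
Hypothesis tau_pd : pdmx tau.
Hypothesis N_tau : N tau.
Hypothesis trZ : forall D, N D -> \tr (Z *m Z *m D) = \tr (sigma *m tau *m D).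

Let Z_sa : adj Z = Z := psd_selfadj (pd_psd Z_pd).
Let tau_sa : adj tau = tau := psd_selfadj (pd_psd tau_pd).

Lemma hs_sigma_tau : hs (cpw sigma (1 / 2) 0 *m cpw tau (1 / 2) 0) = hs Z.
Proof.
apply: sqr_inj_ge0; [exact: hs_ge0|exact: hs_ge0|apply: complexI].
rewrite !sqr_hs -!tr_adj_mul adjM !adj_cpw !oppr0 Z_sa.
rewrite -[in RHS](mulmx1 (Z *m Z)) (trZ N1) mulmx1 mulmxA mxtrace_mulC !mulmxA.
rewrite (@cpw_mul _ _ tau (1 / 2) 0 (1 / 2) 0 1 0); [|by field|by rewrite addr0].
rewrite -mulmxA (@cpw_mul _ _ sigma (1 / 2) 0 (1 / 2) 0 1 0); [|by field|by rewrite addr0].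
by rewrite (cpw1 (pd_psd tau_pd)) (cpw1 (pd_psd sigma_pd)) mxtrace_mulC.
Qed.

(** With T the power of tau, the square is the trace of Z^2 against T A (adj A) (adj T), an element
    of N. The trace identity makes it Tr[sigma tau^{1/2} A (adj A)], since the two exponents -1/4
    remove half of tau, and Cauchy-Schwarz applies. *)
Lemma hs_edge1 A y y' : N A ->
  hs (cpw Z 1 y *m cpw tau (- (1 / 4)) y' *m A) <= Num.sqrt (hs Z * alpha A).
Proof.
move=> NA; rewrite -(alpha_adj NA) [hs (_ *m A)]hsE ler_sqrt; last by rewrite mulr_ge0 ?hs_ge0 ?alpha_ge0.
rewrite alphaE adjK.
apply: le_trans (_ : cmod (\tr (cpw sigma (1 / 2) 0 *m cpw tau (1 / 2) 0 *m
   (cpw sigma (1 / 2) 0 *m (A *m adj A)))) <= _); last first.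
  by rewrite -hs_sigma_tau; apply: cauchy_schwarz_tr.
rewrite -[X in X <= _](ger0_norm (hs2_ge0 _)) -cmod_real -tr_adj_mul.
have le_cmod (x z : C) : x = z -> cmod x <= cmod z by move=> ->.
apply: le_cmod.
set T := cpw tau _ y'.
have NT : N T by apply: N_cpw.
have NAA : N (A *m adj A) by apply: NM => //; apply: Nadj.
transitivity (\tr (Z *m Z *m (T *m (A *m adj A) *m adj T))).
  rewrite mxtrace_mulC !adjM adj_cpw -/T !mulmxA mxtrace_mulC !mulmxA.
  rewrite (@cpw_mul _ _ Z (1) (- y) 1 y (1 + 1) (0 + 0)); [|by []|by rewrite addNr addr0].
  by rewrite -[X in X *m Z](cpw1 (pd_psd Z_pd)) -[X in _ *m X *m T](cpw1 (pd_psd Z_pd)) cpwM addr0.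
rewrite (trZ (NM (NM NT NAA) (Nadj NT))).
rewrite mulmxA mxtrace_mulC !mulmxA.
have -> : adj T *m sigma *m tau *m T = sigma *m cpw tau (1 / 2) 0.
  rewrite (sigma_comm (Nadj NT)) -!mulmxA; congr (_ *m _).
  rewrite adj_cpw -[X in _ *m (X *m _)](cpw1 (pd_psd tau_pd)) cpwM.
  by apply: cpw_mul; field.
rewrite -(mulmxA (cpw sigma _ _)) (sigma_cpw_comm _ _ (N_cpw _ _ tau_sa N_tau)) mulmxA.
rewrite (@cpw_mul _ _ sigma (1 / 2) 0 (1 / 2) 0 1 0); [|by field|by rewrite addr0].
by rewrite (cpw1 (pd_psd sigma_pd)).
Qed.

(** One factor Z goes with [A] and the other with [B], so that each side is an instance of
    [hs_edge1] and [V] enters by its operator norm only. *)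
Lemma trace_edge1 A B V c y : 0 <= c -> N A -> N B -> mxcontr c V ->
  cmod (\tr (cpw Z 2 y *m cpw tau (- (1 / 4)) (- (1 / 4) * y) *m A *m V *m B *m cpw tau (- (1 / 4)) (- (1 / 4) * y))) <=
  c * hs Z * Num.sqrt (alpha A * alpha B).
Proof.
move=> c0 NA NB Vc; set T := cpw tau _ _.
have -> : cpw Z 2 y = cpw Z 1 y *m cpw Z 1 0 by rewrite cpwM addr0 -natr1.
have -> : \tr (cpw Z 1 y *m cpw Z 1 0 *m T *m A *m V *m B *m T) =
   \tr ((cpw Z 1 0 *m T *m A) *m (V *m (B *m T *m cpw Z 1 y))).
  by rewrite -!(mulmxA (cpw Z 1 y)) mxtrace_mulC !mulmxA.
apply: le_trans (cauchy_schwarz_tr _ _) _.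
have lB : hs (B *m T *m cpw Z 1 y) <= Num.sqrt (hs Z * alpha B).
  rewrite -hs_adj !adjM !adj_cpw mulmxA -(alpha_adj NB).
  by apply: hs_edge1; apply: Nadj.
have -> : c * hs Z * Num.sqrt (alpha A * alpha B) =
   Num.sqrt (hs Z * alpha A) * (c * Num.sqrt (hs Z * alpha B)).
  rewrite -{1}(sqr_sqrtr (hs_ge0 Z)) !sqrtrM ?hs_ge0 ?alpha_ge0//; ring.
rewrite ler_pM ?hs_ge0// ?hs_edge1//.
by apply: le_trans (Vc _ _) _; rewrite ler_wpM2l.
Qed.

(** On this edge the powers of tau are unitary and [A], [B] are contractions, which leaves
    Cauchy-Schwarz between Z and [V]. *)
Lemma trace_edge0 A B V y : N A -> N B -> mxcontr 1 A -> mxcontr 1 B ->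
  cmod (\tr (cpw Z 1 y *m cpw tau 0 (- (1 / 4) * y) *m A *m V *m B *m cpw tau 0 (- (1 / 4) * y))) <=
  hs Z * hs V.
Proof.
move=> NA NB Ac Bc; set T := cpw tau _ _.
have TT : adj T *m T = 1%:M by rewrite adj_cpw cpwM addNr addr0 cpw0.
have Tc := mxcontr_unitary TT.
have ZZ : hs (cpw Z 1 y) = hs Z.
  rewrite !hsE; congr Num.sqrt; apply: complexI.
  by rewrite -!tr_adj_mul adj_cpw cpwM Z_sa addNr -[in RHS](cpw1 (pd_psd Z_pd)) cpwM addr0.
rewrite -!mulmxA; apply: le_trans (cauchy_schwarz_tr _ _) _; rewrite ZZ ler_wpM2l ?hs_ge0//.
apply: le_trans (Tc _ _) _; rewrite mul1r; apply: le_trans (Ac _ _) _; rewrite mul1r mulmxA.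
apply: le_trans (mxcontr_mulr _ ler01 Tc) _; rewrite mul1r.
by apply: le_trans (mxcontr_mulr _ ler01 Bc) _; rewrite mul1r.
Qed.

(** As [A] commutes with sigma, both sides are the same power of Tr[sigma |A|^{4/g}]; the modulus of
    [polpow A g^-1 0] is |A|^{1/g}. *)
Lemma wnorm_alpha A g : N A -> 0 < g ->
  wnorm sigma (4 / g)%:E A = alpha (polpow A g^-1 0) `^ (g / 2).
Proof.
move=> NA g0; rewrite /wnorm schattenE /Gam/= invf_div.
set S := mxpow _ _; set X := S *m A *m S.
have r0 : 0 < 4 / g by rewrite divr_gt0.
have SE : S = cpw sigma (g / 8) 0 by rewrite /S mxpow_cpw//; apply: eq_cpw => //; field.
have NG : N (adj A *m A) by apply: NM => //; apply: Nadj.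
have hG : adj (adj A *m A) = adj A *m A by rewrite adjM adjK.
have XX : adj X *m X = cpw sigma (g / 2) 0 *m (adj A *m A).
  have -> : X = A *m cpw sigma (g / 4) 0.
    by rewrite /X SE -(sigma_cpw_comm _ _ NA) -mulmxA; congr (_ *m _); apply: cpw_mul; [field|rewrite addr0].
  rewrite adjM adj_cpw oppr0 -mulmxA (mulmxA (adj A)) (sigma_cpw_comm _ _ NG) mulmxA; congr (_ *m _).
  by apply: cpw_mul; [field|rewrite addr0].
have -> : trpow (4 / g) X = alpha (polpow A g^-1 0) ^+ 2.
  apply: complexI; rewrite -tr_cpw_gram// XX sqr_alphaE; last exact: N_polpow.
  rewrite gram_polpow cpwM cpwE mxfc_mulmx//.
  - rewrite -!cpwE cpw_cpw (@eq_cpw _ _ _ _ _ 1 0)//; last by field; rewrite gt_eqF.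
    rewrite (cpw1 (pd_psd sigma_pd)); congr (\tr (_ *m _)); apply: eq_cpw; last by rewrite addr0.
    by field; rewrite gt_eqF.
  - by rewrite adj_cpw oppr0.
  - by rewrite -sigma_cpw_comm.
  - by move=> i j; apply: cpow_mul; apply: eig_ge0; [exact: psd_gram|exact: psd_cpw].
rewrite -powR_mulrn ?alpha_ge0// -powRrM; congr (_ `^ _); by field.
Qed.

(** For infinite p one has gamma = 1 and the wanted point already lies on the edge Re w = 1, so no
    interpolation takes place. *)
Lemma holder_infty A B Y : N A -> N B ->
  cmod (\tr (cpw Z 2 0 *m cpw tau (- (1 / 4)) 0 *m A *m Gam sigma 0 Y *m B *m cpw tau (- (1 / 4)) 0)) <=
  hs Z * (wnorm sigma 4%:E A * wnorm sigma 4%:E B * wnorm sigma +oo%E Y).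
Proof.
move=> NA NB; have := trace_edge1 0 (schatten_ge0 _ _) NA NB (mxcontr_schatten (Gam sigma 0 Y)).
rewrite mulr0 => /le_trans; apply.
have -> : 4%:E = (4 / 1)%:E :> \bar R by rewrite divr1.
rewrite !wnorm_alpha// invr1 !polpow1 div1r !powR12_sqrt ?alpha_ge0//.
by rewrite sqrtrM ?alpha_ge0// /wnorm/=; apply: le_of_eq; ring.
Qed.

(** Interpolates between the Hilbert-Schmidt pairing of [trace_edge0] and the 4-norm bound of
    [trace_edge1], evaluated at w = gamma. *)
Lemma holder_finite A B Y p : 2 < p -> N A -> N B ->
  cmod (\tr (cpw Z (1 + (p - 2) / p) 0 *m cpw tau (- ((p - 2) / p / 4)) 0 *m A *m
    Gam sigma p^-1 Y *m B *m cpw tau (- ((p - 2) / p / 4)) 0)) <=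
  hs Z * (wnorm sigma (4 / ((p - 2) / p))%:E A * wnorm sigma (4 / ((p - 2) / p))%:E B * wnorm sigma p%:E Y).
Proof.
move=> p2 NA NB; set g := (p - 2) / p; set Yh := Gam sigma p^-1 Y.
have p0 : 0 < p by apply: lt_trans p2.
have g0 : 0 < g by rewrite divr_gt0// subr_gt0.
have g1 : g < 1 by rewrite ltr_pdivrMr// mul1r; lra.
pose T s y := cpw tau (0 + - (1 / 4) * s) (- (1 / 4) * y).
(* All powers reach their target at s = g: [A] and [B] because g^-1 * g = 1, and [Yh] because 1 - g
   = 2 / p gives p / 2 * (1 - g) = 1. *)
pose f s y := \tr (cpw Z (1 + 1 * s) (1 * y) *m T s y *m polpow A (0 + g^-1 * s) (g^-1 * y) *m
   polpow Yh (p / 2 + - (p / 2) * s) (- (p / 2) * y) *m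
   polpow B (0 + g^-1 * s) (g^-1 * y) *m T s y).
have fe : exppoly f.
  apply: exppoly_tr; apply: mxexpM; last exact: mxexp_cpw.
  do 3! (apply: mxexpM; last exact: mxexp_polpow).
  by apply: mxexpM; exact: mxexp_cpw.
have f0 y : cmod (f 0 y) <= hs Z * Num.sqrt (trpow p Yh).
  rewrite -(hs2_polpow Yh (- (p / 2) * y) p0) -hsE.
  rewrite /f /T !mulr0 !addr0 mul1r.
  by apply: trace_edge0; first [exact: N_polpow|exact: mxcontr_polpow0].
have f1 y : cmod (f 1 y) <= hs Z * Num.sqrt (alpha (polpow A g^-1 0) * alpha (polpow B g^-1 0)).
  have alphay D : alpha (polpow D g^-1 (g^-1 * y)) = alpha (polpow D g^-1 0).
    by rewrite !alphaE !gram_polpow.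
  have := trace_edge1 y ler01 (N_polpow g^-1 (g^-1 * y) NA) (N_polpow g^-1 (g^-1 * y) NB)
    (mxcontr_polpow0 Yh (- (p / 2) * y)).
  rewrite /f /T !mulr1 !mul1r !add0r subrr !alphay.
  by have -> : 1 + 1 = 2 :> R by [].
have -> : \tr (cpw Z (1 + g) 0 *m cpw tau (- (g / 4)) 0 *m A *m Yh *m B *m cpw tau (- (g / 4)) 0) = f g 0.
  rewrite /f /T !mulr0 !add0r mul1r mulVf ?gt_eqF// !polpow1.
  have -> : p / 2 + - (p / 2) * g = 1 by rewrite /g; field; rewrite gt_eqF.
  have -> : - (1 / 4) * g = - (g / 4) by field.
  by rewrite polpow1.
have g01 : 0 < g < 1 by rewrite g0.
have aAB0 : 0 <= alpha (polpow A g^-1 0) * alpha (polpow B g^-1 0) by rewrite mulr_ge0 ?alpha_ge0.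
have := hadamard_three_lines_ge0 fe _ _ f0 f1 g01.
rewrite !mulr_ge0 ?hs_ge0 ?sqrtr_ge0// => /(_ isT isT) /le_trans; apply; apply: le_of_eq.
rewrite !powRM ?hs_ge0 ?sqrtr_ge0// mulrACA -powRD; last first.
  by rewrite subrK oner_eq0.
rewrite subrK powRr1 ?hs_ge0// -!powR12_sqrt ?trpow_ge0// -!powRrM powRM ?alpha_ge0//.
rewrite !wnorm_alpha// /wnorm schattenE -[Gam _ _ _]/Yh.
have -> : 2^-1 * (1 - g) = p^-1 by rewrite /g; field; rewrite gt_eqF.
by rewrite (mulrC 2^-1) [X in hs Z * X = _]mulrC.
Qed.

End subalgebra.
End holder.

(** * First-order expansions *)

Section first_order.
Variable R : realType.
Local Notation C := R[i].

(** One-sided expansion at 0 with a quadratic remainder on [0, 1]; it is stable under products and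
    sums and is all that the comparison of slopes requires. *)
Definition taylor1 (f : R -> C) (f0 f1 : C) :=
  exists c : R, forall s, 0 <= s <= 1 -> cmod (f s - f0 - (s%:C)%C * f1) <= c * s ^+ 2.

Lemma eq_taylor1 f g f0 f1 : (forall s, f s = g s) -> taylor1 g f0 f1 -> taylor1 f f0 f1.
Proof. by move=> fg [c cP]; exists c => s s01; rewrite fg cP. Qed.

Lemma taylor1_cst z : taylor1 (fun=> z) z 0.
Proof.
by exists 0 => s _; rewrite subrr mulr0 subr0 mul0r ComplexField.Normc.normc0.
Qed.

Lemma taylor1D f g f0 f1 g0 g1 : taylor1 f f0 f1 -> taylor1 g g0 g1 ->
  taylor1 (fun s => f s + g s) (f0 + g0) (f1 + g1).
Proof.
move=> [c cP] [d dP]; exists (c + d) => s s01.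
have -> : f s + g s - (f0 + g0) - (s%:C)%C * (f1 + g1) =
  (f s - f0 - (s%:C)%C * f1) + (g s - g0 - (s%:C)%C * g1) by ring.
by apply: le_trans (le_normcD _ _) _; rewrite mulrDl lerD ?cP ?dP.
Qed.

Lemma taylor1M f g f0 f1 g0 g1 : taylor1 f f0 f1 -> taylor1 g g0 g1 ->
  taylor1 (fun s => f s * g s) (f0 * g0) (f1 * g0 + f0 * g1).
Proof.
move=> [c cP] [d dP].
have c0 : 0 <= c.
  have := cP 1; rewrite ler01 lexx => /(_ isT)/(le_trans (cmod_ge0 _)).
  by rewrite expr1n mulr1.
have d0 : 0 <= d.
  have := dP 1; rewrite ler01 lexx => /(_ isT)/(le_trans (cmod_ge0 _)).
  by rewrite expr1n mulr1.
have normM := @ComplexField.Normc.normcM R.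
exists (c * (d + cmod g0 + cmod g1) + (cmod f0 + cmod f1) * d + cmod f1 * cmod g1) => s s01.
have /andP[s0 s1] := s01.
have sle : s ^+ 2 <= 1 by rewrite exprn_ile1.
have gB : cmod (g s) <= d + cmod g0 + cmod g1.
  have -> : g s = (g s - g0 - (s%:C)%C * g1) + g0 + (s%:C)%C * g1 by ring.
  apply: le_trans (le_normcD _ _) _; apply: lerD.
    apply: le_trans (le_normcD _ _) _; apply: lerD (lexx _).
    by apply: le_trans (dP _ s01) _; rewrite ler_piMr.
  by rewrite normM cmod_real ger0_norm// ler_piMl ?cmod_ge0.
have -> : f s * g s - f0 * g0 - (s%:C)%C * (f1 * g0 + f0 * g1) =
  (f s - f0 - (s%:C)%C * f1) * g s + (f0 + (s%:C)%C * f1) * (g s - g0 - (s%:C)%C * g1)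
  + ((s%:C)%C * (s%:C)%C) * (f1 * g1) by ring.
set T1 := (X in X + _ + _); set T2 := (X in _ + X + _); set T3 := (X in _ + _ + X).
have b1 : cmod T1 <= c * (d + cmod g0 + cmod g1) * s ^+ 2.
  by rewrite normM mulrAC ler_pM ?cmod_ge0// cP.
have b2 : cmod T2 <= (cmod f0 + cmod f1) * d * s ^+ 2.
  rewrite normM -mulrA ler_pM ?cmod_ge0// ?dP//.
  apply: le_trans (le_normcD _ _) _; apply: lerD (lexx _) _.
  by rewrite normM cmod_real ger0_norm// ler_piMl ?cmod_ge0.
have b3 : cmod T3 <= cmod f1 * cmod g1 * s ^+ 2.
  by rewrite 3!normM cmod_real ger0_norm// -expr2 mulrC lexx.
rewrite 2!mulrDl; apply: le_trans (le_normcD _ _) _; apply: lerD _ b3.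
by apply: le_trans (le_normcD _ _) _; apply: lerD b1 b2.
Qed.

Lemma taylor1_sum (I : Type) (l : seq I) (P : pred I) (F : I -> R -> C) (F0 F1 : I -> C) :
  (forall i, taylor1 (F i) (F0 i) (F1 i)) ->
  taylor1 (fun s => \sum_(i <- l | P i) F i s) (\sum_(i <- l | P i) F0 i) (\sum_(i <- l | P i) F1 i).
Proof.
move=> FP; elim: l => [|i l IH].
  by rewrite !big_nil; apply: eq_taylor1 (taylor1_cst 0) => s; rewrite big_nil.
rewrite !big_cons; case Pi : (P i).
  by apply: eq_taylor1 (taylor1D (FP i) IH) => s; rewrite big_cons Pi.
by apply: eq_taylor1 IH => s; rewrite big_cons Pi.
Qed.

Lemma taylor1_cexp a : taylor1 (fun s => cexp a s 0) 1 ((a%:C)%C).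
Proof.
have [c cP] := expR_taylor1 a; exists c => s /cP.
have -> : cexp a s 0 - 1 - (s%:C)%C * (a%:C)%C = ((expR (a * s) - 1 - a * s)%:C)%C.
  by rewrite cexpr; apply/eqP; rewrite eq_complex /=; apply/andP; split; apply/eqP; ring.
by rewrite cmod_real.
Qed.

Lemma taylor1_affine_cexp a b c :
  taylor1 (fun s => cexp a (b + c * s) 0) (cexp a b 0) (((a * c)%:C)%C * cexp a b 0).
Proof.
have h := taylor1M (taylor1_cst (cexp a b 0)) (taylor1_cexp (a * c)).
have -> : ((a * c)%:C)%C * cexp a b 0 = 0 * 1 + cexp a b 0 * ((a * c)%:C)%C by rewrite mul0r add0r mulrC.
rewrite -[X in taylor1 _ X](mulr1 (cexp a b 0)); apply: eq_taylor1 h => s.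
by rewrite -[0 in LHS]addr0 cexpD; congr (_ * _); rewrite !cexpr mulrA.
Qed.

Lemma taylor1_cpow x b c : 0 < x ->
  taylor1 (fun s => cpow x (b + c * s) 0) (cpow x b 0) (((c * ln x)%:C)%C * cpow x b 0).
Proof. by move=> x0; rewrite /cpow x0 mulrC (mulrC c) mulrC; exact: taylor1_affine_cexp. Qed.

(** Both sides equal f0 at s = 0. If the slope on the left were larger by D > 0, then s D <= K s^2
    would hold on (0, 1), which fails for s below D / K. *)
Lemma taylor1_bound f (f0 M : R) f1 : 0 <= f0 -> 0 < M -> taylor1 f ((f0%:C)%C) f1 ->
  (forall s, 0 < s < 1 -> cmod (f s) <= f0 * M `^ s) -> complex.Re f1 <= f0 * ln M.
Proof.
move=> f00 M0 [c cP] fM; have [d dP] := expR_taylor1 (ln M).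
rewrite leNgt; apply/negP => h.
pose D := complex.Re f1 - f0 * ln M.
have D0 : 0 < D by rewrite subr_gt0.
pose K := 1 + `|c| + f0 * `|d|.
have fd0 : 0 <= f0 * `|d| by rewrite mulr_ge0.
have K0 : 0 < K by rewrite /K -addrA ltr_pwDl// addr_ge0.
have key s : 0 < s < 1 -> s * D <= (c + f0 * d) * s ^+ 2.
  move=> s01; have sI : 0 <= s <= 1 by case/andP: s01 => *; rewrite !ltW.
  have h1 : f0 + s * complex.Re f1 - c * s ^+ 2 <= cmod (f s).
    apply: le_trans (le_trans (ler_norm _) (Re_le_cmod (f s))).
    have := le_trans (Re_le_cmod _) (cP s sI).
    have -> : complex.Re (f s - (f0%:C)%C - (s%:C)%C * f1) = complex.Re (f s) - f0 - s * complex.Re f1.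
      by by case: (f s) => a b; case: (f1) => a' b' /=; rewrite mul0r subr0.
    rewrite ler_norml => /andP[]; lra.
  have h2 : M `^ s <= 1 + ln M * s + d * s ^+ 2.
    have := le_trans (ler_norm _) (dP s sI); rewrite /powR gt_eqF// (mulrC s); lra.
  have h3 : f0 * M `^ s <= f0 * (1 + ln M * s + d * s ^+ 2) by rewrite ler_wpM2l.
  have := le_trans h1 (le_trans (fM s s01) h3).
  rewrite /D; move: (complex.Re f1) (ln M) => u v; nra.
pose s := Num.min (1 / 2) (D / (2 * K)).
have s0 : 0 < s by rewrite lt_min divr_gt0// divr_gt0// mulr_gt0.
have s12 : s <= 1 / 2 by rewrite ge_min lexx.
have sK : K * s <= D / 2.
  rewrite mulrC -ler_pdivlMr// /s ge_min; apply/orP; right.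
  by rewrite invfM mulrA mulrAC.
have s1 : 0 < s < 1 by rewrite s0; lra.
have := key s s1; rewrite expr2 mulrA mulrC ler_pM2r// => kk.
have : (c + f0 * d) * s <= K * s.
  rewrite ler_wpM2r ?(ltW s0)// /K.
  have := ler_norm c; have : f0 * d <= f0 * `|d| by rewrite ler_wpM2l// ler_norm.
  lra.
lra.
Qed.

Definition mxtaylor1 m n (M : R -> 'M[C]_(m, n)) (M0 M1 : 'M[C]_(m, n)) :=
  forall i j, taylor1 (fun s => M s i j) (M0 i j) (M1 i j).

Lemma mxtaylor1_cst m n (A : 'M[C]_(m, n)) : mxtaylor1 (fun=> A) A 0.
Proof. by move=> i j; rewrite [X in taylor1 _ _ X]mxE; exact: taylor1_cst. Qed.

Lemma mxtaylor1M m n p (A : R -> 'M[C]_(m, n)) (B : R -> 'M[C]_(n, p)) A0 A1 B0 B1 :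
  mxtaylor1 A A0 A1 -> mxtaylor1 B B0 B1 ->
  mxtaylor1 (fun s => A s *m B s) (A0 *m B0) (A1 *m B0 + A0 *m B1).
Proof.
move=> hA hB i j; rewrite !mxE -big_split/=.
by apply: eq_taylor1 (taylor1_sum _ _ (fun k => taylor1M (hA i k) (hB k j))) => s; rewrite mxE.
Qed.

Lemma taylor1_tr n (A : R -> 'M[C]_n) A0 A1 : mxtaylor1 A A0 A1 ->
  taylor1 (fun s => \tr (A s)) (\tr A0) (\tr A1).
Proof. by move=> hA; apply: taylor1_sum => i. Qed.

Lemma mxtaylor1_mxfc n (f : R -> R -> C) (f0 f1 : R -> C) (A : 'M[C]_n) :
  (forall i, taylor1 (f (eig A i)) (f0 (eig A i)) (f1 (eig A i))) ->
  mxtaylor1 (fun s => mxfc (fun x => f x s) A) (mxfc f0 A) (mxfc f1 A).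
Proof.
move=> fo i j.
pose D s := diag_mx (\row_i f (eig A i) s).
suff De : mxtaylor1 D (diag_mx (\row_i f0 (eig A i))) (diag_mx (\row_i f1 (eig A i))).
  have h := mxtaylor1M (mxtaylor1M (mxtaylor1_cst (adj (spectralmx A))) De) (mxtaylor1_cst (spectralmx A)).
  rewrite !mxfcE; have := h i j; rewrite mul0mx mulmx0 addr0 add0r.
  by apply: eq_taylor1 => s; rewrite mxfcE.
move=> {i j} i j; rewrite !mxE; case: (eqVneq i j) => [->|ij].
  by rewrite !mulr1n; apply: eq_taylor1 (fo j) => s; rewrite /D !mxE eqxx mulr1n.
by rewrite !mulr0n; apply: eq_taylor1 (taylor1_cst 0) => s; rewrite /D !mxE (negbTE ij) mulr0n.
Qed.

Lemma mxtaylor1_cpw n (A : 'M[C]_n) b c : pdmx A ->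
  mxtaylor1 (fun s => cpw A (b + c * s) 0) (cpw A b 0) ((c%:C)%C *: (mxln A *m cpw A b 0)).
Proof.
move=> pA i j.
have h := @mxtaylor1_mxfc n (fun x s => cpow x (b + c * s) 0) (fun x => cpow x b 0)
   (fun x => ((c * ln x)%:C)%C * cpow x b 0) A (fun i => taylor1_cpow b c (eig_gt0 i pA)).
have -> : (c%:C)%C *: (mxln A *m cpw A b 0) = mxfc (fun x => ((c * ln x)%:C)%C * cpow x b 0) A.
  rewrite cpwE /mxln mxfunE mxfcM mxfcZ; apply: eq_mxfc => k.
  by rewrite mulrA; congr (_ * _); rewrite -rmorphM.
by rewrite cpwE; apply: eq_taylor1 (h i j) => s; rewrite cpwE.
Qed.

End first_order.

(** * The semigroup in the spectral basis of its generator *)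

Section entrywise_limits.
Variable R : realType.
Local Notation C := R[i].
Local Open Scope classical_set_scope.

Lemma nbhs_cmod (z : C) (e : R) : 0 < e -> nbhs z [set w : C | cmod (z - w) < e].
Proof.
move=> e0; apply/nbhs_ballP; exists ((e%:C)%C); first by rewrite /= ltcR.
by move=> w; rewrite /ball/= -ltcR.
Qed.

Lemma nbhs_mx_cmod m n (M : 'M[C]_(m, n)) (e : R) : 0 < e ->
  nbhs M [set N : 'M[C]_(m, n) | forall i j, cmod (M i j - N i j) < e].
Proof.
move=> e0; exists (fun i j => [set w : C | cmod (M i j - w) < e]) => //.
by move=> i j; apply: nbhs_cmod.
Qed.

(** Bridge from the matrix topology used to define the semigroup to entrywise estimates of
    moduli. *)
Lemma cvg_mx_unique m n (u : nat -> 'M[C]_(m, n)) (M N : 'M[C]_(m, n)) : u @ \oo --> M ->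
  (forall i j e, 0 < e -> \forall k \near \oo, cmod (u k i j - N i j) < e) -> M = N.
Proof.
move=> uM uN; apply/matrixP => i j; apply/eqP; rewrite -subr_eq0.
apply/eqP/ComplexField.Normc.eq0_normc/eqP; rewrite eq_le cmod_ge0 andbT leNgt; apply/negP => d0.
have e0 : 0 < cmod (M i j - N i j) / 2 by rewrite divr_gt0.
have h1 := uM _ (nbhs_mx_cmod M e0).
have [k _ /(_ k (leqnn k)) [h2 h3]] := @filterI _ \oo _ _ _ h1 (uN i j _ e0).
have : cmod (M i j - N i j) <= cmod (M i j - u k i j) + cmod (u k i j - N i j).
  by apply: le_trans (le_normcD _ _); rewrite addrA subrK lexx.
by have := h2 i j; lra.
Qed.

End entrywise_limits.

Section evolution.
Variable R : realType.
Local Notation C := R[i].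

Lemma mxvec_dot m n (A B : 'M[C]_(m, n)) : \tr (A *m adj B) = (mxvec A *m adj (mxvec B)) 0 0.
Proof.
rewrite mxE (reindex (uncurry (@mxvec_index m n)))/=; last exact: curry_mxvec_bij.
transitivity (\sum_(p : 'I_m * 'I_n) A p.1 p.2 * Num.conj (B p.1 p.2)).
  rewrite -(pair_bigA _ (fun i j => A i j * Num.conj (B i j)))/= /mxtrace.
  by apply: eq_bigr => i _; rewrite mxE; apply: eq_bigr => j _; rewrite adjE.
by apply: eq_bigr => -[i j] _ /=; rewrite adjE !mxvecE.
Qed.

Lemma hs_mxvec m n (A : 'M[C]_(m, n)) : hs (mxvec A) = hs A.
Proof.
rewrite !hsE; congr Num.sqrt; apply: complexI.
by rewrite -!tr_mul_adj [RHS]mxvec_dot trace_mx11.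
Qed.

Variables (k : nat) (T : 'M[C]_k -> 'M[C]_k).
Hypothesis T_lin : linmap T.
Hypothesis T_sa : forall U W, \tr (adj U *m T W) = \tr (adj (T U) *m W).

Let Tl : {linear 'M[C]_k -> 'M[C]_k} := HB.pack T (GRing.isLinear.Build _ _ _ _ T T_lin).
Let S := lin_mx Tl.

Lemma mxvec_supmx W : mxvec W *m S = mxvec (T W).
Proof. by rewrite mul_vec_lin. Qed.

(** Vectorisation carries the Hilbert-Schmidt product to the standard one, so self-adjointness of
    [T] becomes Hermitian symmetry of its matrix. *)
Lemma supmx_sa : adj S = S.
Proof.
have H (u v : 'rV[C]_(k * k)) : u *m S *m adj v = u *m adj S *m adj v.
  rewrite -(vec_mxK u) -(vec_mxK v); move: (vec_mx u) (vec_mx v) => U V.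
  have -> : mxvec U *m adj S *m adj (mxvec V) = mxvec U *m adj (mxvec V *m S).
    by rewrite adjM mulmxA.
  rewrite !mxvec_supmx; apply/matrixP => i j; rewrite !ord1 -!mxvec_dot.
  by rewrite mxtrace_mulC T_sa mxtrace_mulC -[LHS]conjCK -mxtrace_adj adjM adjK mxtrace_mulC -mxtrace_adj adjM adjK mxtrace_mulC.
apply/matrixP => i j; have /matrixP/(_ 0 0) := H (delta_mx 0 i) (delta_mx 0 j).
have E (M : 'M[C]_(k * k)) : ((delta_mx 0 i : 'rV[C]_(k * k)) *m M *m adj (delta_mx 0 j : 'rV[C]_(k * k))) 0 0 = M i j.
  have -> : adj (delta_mx 0 j : 'rV[C]_(k * k)) = delta_mx j 0.
    by apply/matrixP => l l'; rewrite adjE !mxE andbC; case: (_ && _); rewrite ?conjC1 ?conjC0.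
  by rewrite -rowE -colE !mxE.
by rewrite !E.
Qed.

(** This is f(T) applied to [W], by the functional calculus of the superoperator; vectorised
    matrices are rows, hence the multiplication on the right. *)
Definition evolve (f : R -> C) (W : 'M[C]_k) : 'M[C]_k := vec_mx (mxvec W *m mxfc f S).

Lemma evolveM f g W : evolve g (evolve f W) = evolve (fun x => f x * g x) W.
Proof. by rewrite /evolve vec_mxK -mulmxA mxfcM. Qed.

Lemma evolve_id W : evolve (fun x => (x%:C)%C) W = T W.
Proof. by rewrite /evolve mxfc_id ?supmx_sa// mxvec_supmx mxvecK. Qed.

Lemma evolve1 W : evolve (fun=> 1) W = W.
Proof. by rewrite /evolve mxfc1 mulmx1 mxvecK. Qed.

Lemma evolveD f g W : evolve f W + evolve g W = evolve (fun x => f x + g x) W.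
Proof. by rewrite /evolve -linearD -mulmxDr mxfcD. Qed.

Lemma evolveZ c f W : c *: evolve f W = evolve (fun x => c * f x) W.
Proof. by rewrite /evolve -linearZ/= scalemxAr mxfcZ. Qed.

Lemma evolve_iter j W : iter j T W = evolve (fun x => (x%:C)%C ^+ j) W.
Proof.
elim: j => [|j IH]; first by rewrite evolve1.
by rewrite iterS IH -evolve_id evolveM /evolve; congr (vec_mx (_ *m _)); apply: eq_mxfc => i; rewrite exprSr.
Qed.

Lemma hs_evolve f W : (forall x, Num.conj (f x) * f x = 1) -> hs (evolve f W) = hs W.
Proof.
move=> f1; rewrite -hs_mxvec /evolve vec_mxK -(hs_mxvec W) !hsE; congr Num.sqrt; apply: complexI.
rewrite -!tr_mul_adj adjM -mulmxA (mulmxA (mxfc f S)) adj_mxfc mxfcM.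
rewrite (eq_mxfc (g := fun=> 1)) ?mxfc1 ?mul1mx// => i.
by rewrite mulrC f1.
Qed.

Lemma mxexp_evolve W t : mxexp (fun s y => evolve (fun x => cexp (t * x) s y) W).
Proof.
move=> i j.
have h := mxexpM (mxexp_cst (mxvec W)) (mxexp_mxfc S (fun x => exppoly_cexp (t * x))).
by apply: eq_exppoly (h 0 (mxvec_index i j)) => s y; rewrite /evolve mxE.
Qed.

Lemma mxtaylor1_evolve W t :
  mxtaylor1 (fun s => evolve (fun x => cexp (t * x) s 0) W) W ((t%:C)%C *: T W).
Proof.
move=> i j.
have h := mxtaylor1M (mxtaylor1_cst (mxvec W))
  (@mxtaylor1_mxfc _ _ (fun x s => cexp (t * x) s 0) (fun=> 1) (fun x => ((t * x)%:C)%C) S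
    (fun i => taylor1_cexp (t * eig S i))).
have := h 0 (mxvec_index i j).
rewrite mul0mx add0r mxfc1 mulmx1 mxvecE.
have -> : (mxvec W *m mxfc (fun x => ((t * x)%:C)%C) S) 0 (mxvec_index i j) = ((t%:C)%C *: T W) i j.
  rewrite -evolve_id evolveZ /evolve [RHS]mxE; congr ((_ *m _) _ _).
  by apply: eq_mxfc => l; rewrite rmorphM.
by apply: eq_taylor1 => s; rewrite /evolve mxE.
Qed.

End evolution.

(** * Transport of the generator to Hilbert-Schmidt space *)

Section semigroup.
Variable R : realType.
Local Notation C := R[i].

Lemma cmod_entry_hs m n (A : 'M[C]_(m, n)) i j : cmod (A i j) <= hs A.
Proof.
rewrite -(ler_pXn2r (n := 2))// ?nnegrE ?cmod_ge0 ?hs_ge0// sqr_hs hs2.unlock.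
rewrite (bigD1 i)//= (bigD1 j)//= -addrA lerDl addr_ge0//.
  by apply: sumr_ge0 => l _; rewrite sqr_ge0.
by apply: sumr_ge0 => l _; apply: sumr_ge0 => l' _; rewrite sqr_ge0.
Qed.

Lemma mxcontr_mxfc_bound n f (A : 'M[C]_n) e : 0 <= e -> (forall i, cmod (f (eig A i)) <= e) ->
  mxcontr e (mxfc f A).
Proof.
move=> e0 fe; apply: (@mxcontr_mxfc _ _ _ (fun x => Num.conj (f x) * f x) _ A) => // [|i].
  by rewrite adj_mxfc mxfcM.
by rewrite -normCKC normr_cmod -rmorphXn/= lecR lerXn2r// nnegrE cmod_ge0.
Qed.

Variables (k : nat) (sigma : 'M[C]_k) (L : 'M[C]_k -> 'M[C]_k).
Hypothesis sigma_pd : pdmx sigma.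
Hypothesis L_lin : linmap L.
Hypothesis L_rev : reversible L sigma.

Definition gam (W : 'M[C]_k) := cpw sigma (1 / 4) 0 *m W *m cpw sigma (1 / 4) 0.
Definition gam_inv (W : 'M[C]_k) := cpw sigma (- (1 / 4)) 0 *m W *m cpw sigma (- (1 / 4)) 0.

Lemma gamK W : gam_inv (gam W) = W.
Proof.
rewrite /gam_inv /gam !mulmxA cpwM addNr addr0 (cpw0 sigma_pd) mul1mx -mulmxA cpwM addrN addr0.
by rewrite (cpw0 sigma_pd) mulmx1.
Qed.

Lemma gam_invK W : gam (gam_inv W) = W.
Proof.
rewrite /gam_inv /gam !mulmxA cpwM addrN addr0 (cpw0 sigma_pd) mul1mx -mulmxA cpwM addNr addr0.
by rewrite (cpw0 sigma_pd) mulmx1.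
Qed.

Lemma Gam_gam W : Gam sigma (1 / 2) W = gam W.
Proof.
rewrite /Gam /gam mxpow_cpw//; congr (_ *m _ *m _); by apply: eq_cpw => //; field.
Qed.

Lemma adj_gam W : adj (gam W) = gam (adj W).
Proof. by rewrite /gam !adjM adj_cpw oppr0 mulmxA. Qed.

Lemma gam_linear : linmap gam.
Proof. by move=> a X Y; rewrite /gam mulmxDr mulmxDl -scalemxAr -scalemxAl. Qed.

Lemma gam_inv_linear : linmap gam_inv.
Proof. by move=> a X Y; rewrite /gam_inv mulmxDr mulmxDl -scalemxAr -scalemxAl. Qed.

Lemma wip_gam X Y : wip sigma X Y = \tr (adj (gam X) *m gam Y).
Proof.
rewrite /wip (mxpow_cpw _ sigma_pd) adj_gam /gam; set g := cpw sigma (1 / 4) 0.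
have -> : cpw sigma (1 / 2) 0 = g *m g by rewrite /g (@cpw_mul _ _ _ _ _ _ _ (1 / 2) 0) ?addr0//; field.
by rewrite !mulmxA [RHS]mxtrace_mulC !mulmxA.
Qed.

(** [gam] is an isometry from the inner product of sigma to the Hilbert-Schmidt one, so
    reversibility of [L] becomes self-adjointness of [gen]. *)
Definition gen W := gam (L (gam_inv W)).

Lemma gen_lin : linmap gen.
Proof. by move=> a X Y; rewrite /gen gam_inv_linear L_lin gam_linear. Qed.

Lemma gen_sa U W : \tr (adj U *m gen W) = \tr (adj (gen U) *m W).
Proof.
have := L_rev (gam_inv U) (gam_inv W).
by rewrite !wip_gam !gam_invK.
Qed.

Lemma iter_gen j X : iter j L X = gam_inv (iter j gen (gam X)).
Proof.
elim: j => [|j IH]; first by rewrite /= gamK.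
by rewrite !iterS IH /gen gamK.
Qed.

(** Turns uniform closeness of scalar functions on the spectrum into entrywise closeness. The
    spelled-out [lin_mx] term is the matrix that [evolve] uses for [gen]. *)
Lemma gam_inv_evolve_lip W : exists2 c : R, 0 < c & forall f g e, 0 <= e ->
  (forall i, cmod (f (eig (lin_mx (HB.pack gen (GRing.isLinear.Build _ _ _ _ gen gen_lin) : {linear 'M[C]_k -> 'M[C]_k})) i) -
    g (eig (lin_mx (HB.pack gen (GRing.isLinear.Build _ _ _ _ gen gen_lin) : {linear 'M[C]_k -> 'M[C]_k})) i)) <= e) ->
  forall a b, cmod (gam_inv (evolve gen_lin f W) a b - gam_inv (evolve gen_lin g W) a b) <= c * e.
Proof.
set s := cpw sigma (- (1 / 4)) 0; pose cs := schatten +oo%E s.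
have cs0 : 0 <= cs := schatten_ge0 _ _.
exists (1 + cs * cs * hs W).
  by rewrite ltr_pwDl// !mulr_ge0// hs_ge0.
move=> f g e e0 fg a b.
have -> : gam_inv (evolve gen_lin f W) a b - gam_inv (evolve gen_lin g W) a b =
  gam_inv (evolve gen_lin (fun x => f x - g x) W) a b.
  have -> : evolve gen_lin (fun x => f x - g x) W = - 1 *: evolve gen_lin g W + evolve gen_lin f W.
    by rewrite evolveZ evolveD /evolve; congr (vec_mx (_ *m _)); apply: eq_mxfc => i; rewrite mulN1r addrC.
  by rewrite gam_inv_linear [RHS]mxE [X in _ = X + _]mxE mulN1r addrC.
apply: le_trans (cmod_entry_hs _ _ _) _.
have sc := mxcontr_schatten s.
apply: le_trans (mxcontr_mulr _ cs0 sc) _.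
apply: le_trans (_ : cs * (cs * (e * hs W)) <= _).
  rewrite ler_wpM2l//; apply: le_trans (sc _ _) _; rewrite ler_wpM2l//.
  rewrite -[leLHS]hs_mxvec /evolve vec_mxK -(hs_mxvec W).
  by apply: mxcontr_mulr => //; apply: mxcontr_mxfc_bound.
rewrite mulrDl mul1r -!mulrA (mulrC e) lerDr//.
Qed.

Variable P : R -> 'M[C]_k -> 'M[C]_k.
Hypothesis P_exp : is_exp_semigroup L P.

Lemma near_ordinal m (Q : 'I_m -> nat -> Prop) : (forall i, (\forall N \near \oo, Q i N)%classic) ->
  (\forall N \near \oo, forall i, Q i N)%classic.
Proof.
move=> H; have {H}/choice [N0 N0P] : forall i, exists N0, forall N, (N0 <= N)%N -> Q i N.
  by move=> i; have [N0 _ h] := H i; exists N0.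
exists (\max_i N0 i)%N => // N /= hN i; apply: N0P; apply: leq_trans hN; exact: leq_bigmax.
Qed.

(** The partial sums that define [P t] are polynomials in [gen], and the exponential series
    converges at each of its finitely many eigenvalues. *)
Lemma semigroup_evolve t X : 0 <= t ->
  P t X = gam_inv (evolve gen_lin (fun x => cexp (t * x) 1 0) (gam X)).
Proof.
move=> t0; apply: cvg_mx_unique (@P_exp t t0 X) _ => i j e e0.
have [c c0 cP] := gam_inv_evolve_lip (gam X).
pose f N x : C := \sum_(j < N) ((t ^+ j / j`!%:R)%:C)%C * ((x%:C)%C ^+ j).
have uE N : \sum_(j < N) ((t ^+ j / j`!%:R)%:C)%C *: iter j L X = gam_inv (evolve gen_lin (f N) (gam X)).
  elim: N => [|N IH].
    rewrite big_ord0 /evolve (_ : mxfc _ _ = 0); last first.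
      apply: etrans (_ : mxfc (fun x => 0 * 0) _ = _); last by rewrite -mxfcZ scale0r.
      by apply: eq_mxfc => l; rewrite /f big_ord0 mul0r.
    by rewrite mulmx0 linear0 /gam_inv mulmx0 mul0mx.
  rewrite big_ord_recr/= IH iter_gen (evolve_iter gen_lin gen_sa).
  set c' := ((t ^+ N / _)%:C)%C; set A := evolve _ _ _; set B := evolve gen_lin _ (gam X).
  transitivity (c' *: gam_inv B + gam_inv A); first exact: addrC.
  rewrite -gam_inv_linear /A /B evolveZ evolveD; congr gam_inv.
  rewrite /evolve; congr (vec_mx (_ *m _)); apply: eq_mxfc => l; rewrite /f big_ord_recr/=; exact: addrC.
(* After multiplication by the Lipschitz constant [c] this tolerance becomes e / 2, strictly below
   e. *)
have fcvg x : (\forall N \near \oo, cmod (f N x - cexp (t * x) 1 0) <= e / (2 * c))%classic.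
  have e2 : 0 < e / (2 * c) by rewrite divr_gt0// mulr_gt0.
  have : (series (exp_coeff (t * x)) N @[N --> \oo] --> expR (t * x))%classic := is_cvg_series_exp_coeff (t * x).
  move=> /cvgrPdist_le /(_ _ e2); apply: filterS => N /= h.
  suff -> : f N x - cexp (t * x) 1 0 = ((series (exp_coeff (t * x)) N - expR (t * x))%:C)%C.
    by rewrite cmod_real distrC.
  rewrite cexpr mulr1 rmorphB; congr (_ - _); rewrite /series/= big_mkord rmorph_sum.
  by apply: eq_bigr => l _; rewrite /exp_coeff/= exprMn -rmorphXn -rmorphM; congr (_%:C)%C; rewrite mulrAC.
set S := lin_mx _ in cP.
have := near_ordinal (fun l => fcvg (eig S l)); apply: filterS => N hN.
rewrite uE; apply: le_lt_trans (cP _ _ _ _ hN i j) _.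
  by rewrite divr_ge0 ?mulr_ge0// ltW.
rewrite invfM mulrCA -mulrCA (mulrC c) -!mulrA mulVf ?gt_eqF// mulr1.
rewrite ltr_pdivrMr//; lra.
Qed.

End semigroup.

(** * The decoherence-free algebra and its conditional expectation *)

Section conditional_expectation.
Variable R : realType.
Local Notation C := R[i].

Lemma linmap0 k (F : 'M[C]_k -> 'M[C]_k) : linmap F -> F 0 = 0.
Proof.
move=> Fl; have := Fl 1 0 0; rewrite !scale1r addr0 => /eqP.
by rewrite -subr_eq subrr eq_sym => /eqP.
Qed.

Lemma linmapD k (F : 'M[C]_k -> 'M[C]_k) X Y : linmap F -> F (X + Y) = F X + F Y.
Proof. by move=> Fl; have := Fl 1 X Y; rewrite !scale1r. Qed.

Lemma linmapZ k (F : 'M[C]_k -> 'M[C]_k) c X : linmap F -> F (c *: X) = c *: F X.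
Proof. by move=> Fl; have := Fl c X 0; rewrite !addr0 (linmap0 Fl) addr0. Qed.

Lemma selfadj_shift_psd k (H : 'M[C]_k) : adj H = H ->
  exists c : R, psdmx (H + (c%:C)%C *: 1%:M).
Proof.
move=> hH; exists (\sum_i `|eig H i|).
rewrite -[X in X + _](mxfc_id hH) -(mxfc1 H) mxfcZ mxfcD; apply: psd_mxfc => i.
rewrite mulr1 -rmorphD/= lecR (bigD1 i)//= addrA addr_ge0//.
  by rewrite -lerBlDl sub0r -normrN ler_norm.
by apply: sumr_ge0.
Qed.

Lemma adjN m n (A : 'M[C]_(m, n)) : adj (- A) = - adj A.
Proof. by apply/matrixP => i j; rewrite adjE !mxE rmorphN. Qed.

(** Writes X as (A - i B) / 2 with A, B Hermitian; a Hermitian matrix is a positive one minus a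
    multiple of 1, and F maps both to Hermitian matrices. *)
Lemma positive_adj k (F : 'M[C]_k -> 'M[C]_k) : linmap F -> (forall X, psdmx X -> psdmx (F X)) ->
  forall X, F (adj X) = adj (F X).
Proof.
move=> Fl Fp.
have F1 : adj (F 1%:M) = F 1%:M.
  apply: psd_selfadj; apply: Fp.
  by rewrite -(mulmx1 1%:M) -[X in X *m _]adj1; exact: psd_gram.
have Fh H : adj H = H -> adj (F H) = F H.
  move=> hH; have [c /Fp/psd_selfadj] := selfadj_shift_psd hH.
  rewrite (linmapD _ _ Fl) (linmapZ _ _ Fl) adjD adjZ F1 (conj_Creal (x := (c%:C)%C)) ?complex_real// => h.
  by apply: (addIr _ h).
move=> X; pose A := X + adj X; pose B := 'i *: (X - adj X).
have hA : adj A = A by rewrite /A adjD adjK addrC.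
have hB : adj B = B.
  by rewrite /B adjZ adjD adjN adjK conjCi scaleNr -scalerN opprB.
have two : (2 : C) != 0 by rewrite pnatr_eq0.
have half (M : 'M[C]_k) : 2^-1 *: (M + M) = M.
  by rewrite -[M + M]mulr2n -[M *+ 2]scaler_nat scalerA mulVf// scale1r.
have XE : X = 2^-1 *: (A + - 'i *: B).
  have -> : - 'i *: B = X - adj X by rewrite scalerA mulNr -expr2 sqrCi opprK scale1r.
  by rewrite /A addrACA subrr addr0 half.
have aXE : adj X = 2^-1 *: (A + 'i *: B).
  have -> : 'i *: B = adj X - X by rewrite scalerA -expr2 sqrCi scaleN1r opprB.
  by rewrite /A (addrC X) addrACA subrr addr0 half.
move: A B hA hB XE aXE => A B hA hB XE aXE.
have h2 : Num.conj (2^-1 : C) = 2^-1 by rewrite fmorphV/= conjC_nat.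
have hFA := Fh A hA; have hFB := Fh B hB.
rewrite aXE (linmapZ _ _ Fl) (linmapD _ _ Fl) (linmapZ _ _ Fl).
rewrite [in RHS]XE (linmapZ _ _ Fl) (linmapD _ _ Fl) (linmapZ _ _ Fl).
have hi : Num.conj (- 'i : C) = 'i by rewrite rmorphN/= conjCi opprK.
rewrite adjZ adjD adjZ hFA hFB h2 hi; exact: erefl.
Qed.

Lemma tr_nondegenerate k (M : 'M[C]_k) : (forall Y, \tr (M *m Y) = 0) -> M = 0.
Proof. by move=> /(_ (adj M)); rewrite tr_mul_adj => /complexI; exact: hs2_eq0. Qed.

Lemma psd_tr_ge0 k (A : 'M[C]_k) : psdmx A -> 0 <= \tr A.
Proof.
by move=> pA; rewrite -(mxfc_id (psd_selfadj pA)) tr_mxfc sumr_ge0// => i _; rewrite lecR eig_ge0.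
Qed.

Lemma psd_tr_eq0 k (A : 'M[C]_k) : psdmx A -> \tr A = 0 -> A = 0.
Proof.
move=> pA /eqP; rewrite -(mxfc_id (psd_selfadj pA)) tr_mxfc psumr_eq0 => [/allP h|i _].
  have -> : mxfc (fun x => (x%:C)%C) A = mxfc (fun x => 0 * 1) A.
    by apply: eq_mxfc => i; rewrite mul0r; apply/eqP/(h i)/mem_index_enum.
  by rewrite -mxfcZ scale0r.
by rewrite lecR eig_ge0.
Qed.

Variables (k : nat) (P : R -> 'M[C]_k -> 'M[C]_k) (E : 'M[C]_k -> 'M[C]_k) (sigma : 'M[C]_k).
Hypothesis P_one : forall t, 0 <= t -> P t 1%:M = 1%:M.
Hypothesis P_dec : decohering P.
Hypothesis E_N : is_EN P E.
Hypothesis E_sigma : is_sigmaTr E sigma.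

Let N := dfa P.
Let E_lin : linmap E. Proof. by case: E_N => -[h _ _ _ _] _; exact: h. Qed.
Let N_E X : N (E X). Proof. by case: E_N => -[_ h _ _ _] _; exact: h. Qed.
Let E_id A : N A -> E A = A. Proof. by case: E_N => -[_ _ h _ _] _; exact: h. Qed.
Let E_bimod A B X : N A -> N B -> E (A *m X *m B) = A *m E X *m B.
Proof. by case: E_N => -[_ _ _ h _] _; exact: h. Qed.
Let E_pos X : psdmx X -> psdmx (E X). Proof. by case: E_N => -[_ _ _ _ h] _; exact: h. Qed.

Lemma dfa1 : N 1%:M.
Proof. by move=> t t0; rewrite !adj1 !mulmx1 !P_one// adj1 !mulmx1. Qed.

(** Linearity is not visible in the quadratic definition of [dfa]; here and below the algebra
    structure is read off N as the range of the bimodule map [E]. *)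
Lemma dfaD A B : N A -> N B -> N (A + B).
Proof. by move=> NA NB; rewrite -(E_id NA) -(E_id NB) -(linmapD _ _ E_lin). Qed.

Lemma dfaZ c A : N A -> N (c *: A).
Proof. by move=> NA; rewrite -(E_id NA) -(linmapZ _ _ E_lin). Qed.

Lemma dfaM A B : N A -> N B -> N (A *m B).
Proof.
move=> NA NB; have := N_E (A *m 1%:M *m B).
by rewrite (E_bimod _ NA NB) (E_id dfa1) mulmx1.
Qed.

Lemma dfa_adj A : N A -> N (adj A).
Proof. by move=> NA; rewrite -(E_id NA) -(positive_adj E_lin E_pos). Qed.

Lemma E_mull A X : N A -> E (A *m X) = A *m E X.
Proof. by move=> NA; have := E_bimod X NA dfa1; rewrite !mulmx1. Qed.

Lemma E_mulr A X : N A -> E (X *m A) = E X *m A.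
Proof. by move=> NA; have := E_bimod X dfa1 NA; rewrite !mul1mx. Qed.

(** Both Tr[A sigma Y] and Tr[sigma A Y] reduce, by the bimodule property, to the unweighted traces
    of E(Y) A and A E(Y). *)
Lemma sigma_comm_dfa A : N A -> A *m sigma = sigma *m A.
Proof.
move=> NA; apply/eqP; rewrite -subr_eq0; apply/eqP/tr_nondegenerate => Y.
have e1 : \tr (A *m sigma *m Y) = \tr (sigma *m (Y *m A)) by rewrite -mulmxA mxtrace_mulC mulmxA.
rewrite mulmxBl linearB/= e1 -mulmxA !E_sigma (E_mull _ NA) (E_mulr _ NA).
by rewrite [X in X / _ - _]mxtrace_mulC subrr.
Qed.

Lemma tr_sigma_E Y D : N D -> \tr (sigma *m (E Y *m D)) = \tr (sigma *m (Y *m D)).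
Proof. by move=> ND; rewrite -(E_mulr _ ND) !E_sigma (E_id (N_E _)). Qed.

(** The state is invariant, so Tr[rho P_t(X - E X)] is constant in t, while P_t(X - E X) tends to
    0. *)
Lemma tr_rho_E rho :
  (forall t, 0 <= t -> forall X, \tr (rho *m P t X) = \tr (rho *m X)) ->
  forall X, \tr (rho *m E X) = \tr (rho *m X).
Proof.
move=> inv X; apply/eqP; rewrite eq_sym -subr_eq0 -linearB -mulmxBr.
apply/eqP/ComplexField.Normc.eq0_normc/eqP; rewrite eq_le cmod_ge0 andbT leNgt; apply/negP => d0.
set d := cmod _ in d0.
(* With entries of P_t(X - E X) below d / K the trace is at most d (K - 1) / K, which is less than
   d. *)
pose K := 1 + \sum_(i < k) \sum_(j < k) cmod (rho i j).
have K0 : 0 < K by rewrite ltr_pwDl// sumr_ge0// => i _; rewrite sumr_ge0// => j _; rewrite cmod_ge0.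
have e0 : 0 < d / K by rewrite divr_gt0.
case: E_N => _ /(_ X) lim0.
have h := lim0 _ (nbhs_mx_cmod 0 e0).
have [t [t0 ht]] : exists t, 0 <= t /\ forall i j, cmod (P t (X - E X) i j) < d / K.
  have [M [_ hM]] := h; exists (`|M| + 1); split; first by rewrite addr_ge0.
  move=> i j; have := hM (`|M| + 1) _ i j; rewrite mxE sub0r normcN; apply.
  by rewrite (le_lt_trans (ler_norm _))// ltrDl.
have : d <= (d / K) * (\sum_(i < k) \sum_(j < k) cmod (rho i j)).
  have dE : d = cmod (\tr (rho *m P t (X - E X))) by rewrite (inv t t0).
  rewrite {1}dE; apply: le_trans (cmod_sum _ _ _) _; rewrite mulr_sumr.
  apply: ler_sum => i _; rewrite mxE; apply: le_trans (cmod_sum _ _ _) _; rewrite mulr_sumr.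
  apply: ler_sum => j _; rewrite ComplexField.Normc.normcM mulrC ler_wpM2r ?cmod_ge0//.
  exact/ltW/ht.
rewrite -subr_le0 (_ : d - _ = d / K); last first.
  by rewrite /K; field; rewrite gt_eqF.
by rewrite leNgt e0.
Qed.

(** If the form of sigma vanished at v, then E(v (adj v)) would be 0, and so would the form at v of
    the faithful invariant state, by [tr_rho_E]. *)
Lemma sigma_pd : pdmx sigma.
Proof.
move=> v v0; pose V := v *m adj v.
have trV (M : 'M[C]_k) : (adj v *m M *m v) 0 0 = \tr (M *m V).
  by rewrite /V mulmxA mxtrace_mulC mulmxA [RHS]trace_mx11.
have pV : psdmx V by rewrite /V -[X in X *m _]adjK; exact: psd_gram.
have k0 : (0 < k)%N.
  by case: (posnP k) v0 => // kE; rewrite (_ : v = 0) ?eqxx//; apply/colP => -[l hl]; by suff : (l < 0)%N by []; move: hl; rewrite [X in (_ < X)%N -> _]kE.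
rewrite trV E_sigma divr_gt0 ?ltr0n//.
rewrite lt0r psd_tr_ge0 ?andbT; last exact: E_pos.
apply/eqP => /(psd_tr_eq0 (E_pos pV)) EV.
have [rho [rho_pd _ inv]] := P_dec.
by have := rho_pd _ v0; rewrite trV -(tr_rho_E inv) EV mulmx0 linear0 ltxx.
Qed.

Lemma E_pd X : pdmx X -> pdmx (E X).
Proof.
move=> /pd_lower_bound[c c0 /E_pos].
rewrite -scaleNr (linmapD _ _ E_lin) (linmapZ _ _ E_lin) (E_id dfa1) => h v v0.
have -> : E X = E X + (- (c%:C)%C) *: 1%:M + ((c%:C)%C) *: 1%:M by rewrite scaleNr subrK.
rewrite mulmxDr mulmxDl mxE ltr_wpDl//.
rewrite -scalemxAr -scalemxAl mulmx1 mxE mulr_gt0 ?ltcR//.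
rewrite lt0r; apply/andP; split; last first.
  by have := @psd_gram R 1 k (adj v); have := psd_gram v => /(_ 1%:M); rewrite mulmx1 adj1 mul1mx.
apply: contra v0 => /eqP h0; apply/eqP; apply: hs2_eq0; apply: complexI.
by rewrite -tr_adj_mul trace_mx11.
Qed.

Section reference_state.
Variable Z : 'M[C]_k.
Hypothesis Z_pd : pdmx Z.

Definition ref_state := E (cpw sigma (- (1 / 2)) 0 *m (Z *m Z) *m cpw sigma (- (1 / 2)) 0).

Lemma ref_state_dfa : N ref_state.
Proof. exact: N_E. Qed.

Lemma ref_state_pd : pdmx ref_state.
Proof.
apply: E_pd; have hZ := psd_selfadj (pd_psd Z_pd).
have -> : cpw sigma (- (1 / 2)) 0 *m (Z *m Z) *m cpw sigma (- (1 / 2)) 0 =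
  adj (Z *m cpw sigma (- (1 / 2)) 0) *m 1%:M *m (Z *m cpw sigma (- (1 / 2)) 0).
  by rewrite mulmx1 adjM adj_cpw oppr0 hZ !mulmxA.
apply: pd_congr.
  by rewrite unitmx_mul !pd_unit//; apply: pd_cpw sigma_pd.
move=> v v0; rewrite mulmx1; have := @pd_cpw R k sigma 0 sigma_pd.
by rewrite (cpw0 sigma_pd) => /(_ v v0); rewrite mulmx1.
Qed.

(** [E] drops out under Tr[sigma .] against N, and the two factors sigma^{-1/2} cancel sigma because
    [D] commutes with its powers. *)
Lemma tr_ref_state D : N D -> \tr (Z *m Z *m D) = \tr (sigma *m ref_state *m D).
Proof.
move=> ND; rewrite -[X in _ = \tr X]mulmxA (tr_sigma_E _ ND).
set S := cpw sigma (- (1 / 2)) 0; pose S2 := cpw sigma (1 / 2) 0.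
have sS : sigma *m S = S2.
  rewrite -[X in X *m S](cpw1 (pd_psd sigma_pd)); apply: cpw_mul; [by field|by rewrite addr0].
have SS2 : S *m S2 = 1%:M by rewrite cpwM addNr addr0 (cpw0 sigma_pd).
have cD : D *m S2 = S2 *m D.
  by apply: cpw_comm; [exact: psd_selfadj (pd_psd sigma_pd)|exact: sigma_comm_dfa].
have -> : sigma *m (S *m (Z *m Z) *m S *m D) = S2 *m (Z *m Z *m (S *m D)).
  by rewrite !mulmxA sS.
by rewrite [RHS]mxtrace_mulC -[X in _ = \tr X]mulmxA -(mulmxA S) cD (mulmxA S) SS2 mul1mx.
Qed.

End reference_state.

End conditional_expectation.

(** * Two-positivity *)

Section two_positivity.
Variable R : realType.
Local Notation C := R[i].

Lemma adj_mxcol q k m (G : 'I_q -> 'M[C]_(k, m)) : adj (\mxcol_(i < q) G i) = \mxrow_(i < q) adj (G i).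
Proof. by apply/matrixP => i j; rewrite adjE !mxE. Qed.

(** The blocks [G i *m adj (G j)] form a Gram matrix; complete positivity is then tested on the
    column with blocks [v i]. *)
Lemma cpmap_gram k m (Phi : 'M[C]_k -> 'M[C]_k) q (G : 'I_q -> 'M[C]_k) (v : 'I_q -> 'M[C]_(k, m)) : cpmap Phi ->
  0 <= \sum_i \sum_j \tr (adj (v i) *m Phi (G i *m adj (G j)) *m v j).
Proof.
move=> cp.
have blk : psdmx (\mxblock_(i < q, j < q) (G i *m adj (G j))).
  by rewrite -mul_mxcol_mxrow -adj_mxcol -[X in X *m _]adjK; exact: psd_gram.
have {}blk := cp _ _ blk.
have -> : \sum_i \sum_j \tr (adj (v i) *m Phi (G i *m adj (G j)) *m v j) =
    \tr (adj (\mxcol_(i < q) v i) *m \mxblock_(i < q, j < q) Phi (G i *m adj (G j)) *m \mxcol_(i < q) v i).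
  rewrite adj_mxcol mul_mxrow_mxblock mul_mxrow_mxcol linear_sum exchange_big.
  by apply: eq_bigr => j _ /=; rewrite mulmx_suml linear_sum.
exact: psd_tr_ge0 (psd_congr _ blk).
Qed.

Lemma cpmap_pos k (Phi : 'M[C]_k -> 'M[C]_k) X : cpmap Phi -> psdmx X -> psdmx (Phi X).
Proof.
move=> cp pX v; have := @cpmap_gram _ _ _ 1 (fun=> cpw X (1 / 2) 0) (fun=> v) cp.
rewrite !big_ord1 adj_cpw oppr0 (@cpw_mul _ _ _ _ _ _ _ 1 0); [|by field|by rewrite addr0].
by rewrite (cpw1 pX) trace_mx11.
Qed.

(** Since both diagonal traces obey the same bound K, testing one 2 by 2 block matrix gives 2 |t| <=
    2 K, with no rescaling of the factors. *)
Lemma cpmap_cauchy_schwarz k (Phi : 'M[C]_k -> 'M[C]_k) (C1 C2 a b : 'M[C]_k) (K : R) :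
  cpmap Phi -> linmap Phi ->
  cmod (\tr (a *m Phi (C1 *m adj C1) *m adj a)) <= K ->
  cmod (\tr (adj b *m Phi (C2 *m adj C2) *m b)) <= K ->
  cmod (\tr (a *m Phi (C1 *m adj C2) *m b)) <= K.
Proof.
move=> cp Pl h1 h2.
have Padj : forall X, Phi (adj X) = adj (Phi X).
  by apply: (positive_adj Pl) => X; exact: cpmap_pos.
set t := \tr (a *m _ *m b).
have [->|t0] := eqVneq t 0.
  by rewrite ComplexField.Normc.normc0 (le_trans (cmod_ge0 _) h1).
(* This phase makes both off-diagonal traces equal to -|t|. *)
pose th : C := - (Num.conj t / `|t|).
have thth : Num.conj th * th = 1.
  rewrite /th rmorphN mulrNN rmorphM/= conjCK fmorphV/= conj_normC mulrACA -normCK -expr2 exprVn mulfV//.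
  by rewrite expf_neq0// normr_eq0.
have tht : th * t = - `|t|.
  by rewrite /th mulNr mulrAC -normCKC expr2 mulfK// normr_eq0.
have := @cpmap_gram _ _ _ 2 (fun i : 'I_2 => if i == 0 then C1 else C2)
   (fun i : 'I_2 => if i == 0 then adj a else th *: b) cp.
have E2 (F : 'I_2 -> C) : \sum_i F i = F ord0 + F ord_max.
  by rewrite big_ord_recl big_ord1; congr (_ + F _); apply: val_inj.
rewrite !E2 /= adjK.
have -> : \tr (a *m Phi (C1 *m adj C2) *m (th *: b)) = - `|t|.
  by rewrite -scalemxAr linearZ/= -/t tht.
have -> : \tr (adj (th *: b) *m Phi (C2 *m adj C1) *m adj a) = - `|t|.
  have -> : C2 *m adj C1 = adj (C1 *m adj C2) by rewrite adjM adjK.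
  rewrite Padj -!adjM mxtrace_adj -!scalemxAr linearZ/= mulmxA -/t tht rmorphN/= conj_normC.
  by [].
have -> : \tr (adj (th *: b) *m Phi (C2 *m adj C2) *m (th *: b)) = \tr (adj b *m Phi (C2 *m adj C2) *m b).
  by rewrite adjZ -scalemxAr -!scalemxAl scalerA linearZ/= (mulrC th) thth mul1r.
rewrite lecE => /andP[_]; rewrite normr_cmod.
have := le_trans (le_trans (ler_norm _) (Re_le_cmod _)) h1.
have := le_trans (le_trans (ler_norm _) (Re_le_cmod _)) h2.
move: (\tr (a *m _ *m adj a)) (\tr (adj b *m _ *m b)) => -[? ?] [? ?] /=; lra.
Qed.

End two_positivity.

(** * Interpolation *)

Section interpolation.
Variable R : realType.
Local Notation C := R[i].

(** Balanced polar factorisation: W = (W h^{-1/4}) h^{1/4}. The Gram matrices of the two factors are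
    the moduli of [adj W] and of W, so both have the norm of W. *)
Lemma hs_gram_factor k (W : 'M[C]_k) : let h := adj W *m W in
  hs (cpw h (1 / 2) 0) = hs W /\
  hs (W *m cpw h (- (1 / 4)) 0 *m adj (W *m cpw h (- (1 / 4)) 0)) = hs W.
Proof.
move=> h; have pH : psdmx h by exact: psd_gram.
have e1 : hs (cpw h (1 / 2) 0) = hs W.
  rewrite !hsE; congr Num.sqrt; apply: complexI.
  rewrite -!tr_adj_mul adj_cpw oppr0 (@cpw_mul _ _ _ _ _ _ _ 1 0); [|by field|by rewrite addr0].
  by rewrite (cpw1 pH).
split=> //; rewrite -e1.
rewrite !hsE; congr Num.sqrt; apply: complexI.
rewrite -[RHS]tr_adj_mul.
set B := W *m _.
have BB : adj B *m B = cpw h (1 / 2) 0.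
  rewrite /B adjM adj_cpw oppr0 -mulmxA (mulmxA (adj W)) -/h -[X in _ *m (X *m _)](cpw1 pH) cpwM.
  by apply: cpw_mul; [by field|by rewrite !addr0].
have -> : \tr (adj (cpw h (1 / 2) 0) *m cpw h (1 / 2) 0) = \tr (adj B *m B *m (adj B *m B)).
  by rewrite BB adj_cpw oppr0.
rewrite -tr_adj_mul adjM adjK.
by rewrite !mulmxA mxtrace_mulC !mulmxA.
Qed.

Lemma hs_unitary_conj k (u Z : 'M[C]_k) : u *m adj u = 1%:M -> hs (adj u *m Z *m u) = hs Z.
Proof.
move=> uu; rewrite !hsE; congr Num.sqrt; apply: complexI; rewrite -!tr_adj_mul !adjM adjK !mulmxA.
by rewrite -(mulmxA _ u (adj u)) uu mulmx1 mxtrace_mulC !mulmxA uu mul1mx.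
Qed.

Lemma tr_unitary_conj k (u Z D : 'M[C]_k) : u *m adj u = 1%:M ->
  \tr (adj u *m Z *m u *m (adj u *m Z *m u) *m D) = \tr (Z *m Z *m (u *m D *m adj u)).
Proof.
move=> uu; rewrite !mulmxA -(mulmxA _ u (adj u)) uu mulmx1.
by rewrite -!mulmxA mxtrace_mulC !mulmxA.
Qed.

Lemma tr_sandwich k (B b M : 'M[C]_k) :
  \tr (B *m b *m M *m adj (B *m b)) = \tr (adj B *m B *m (b *m M *m adj b)).
Proof. by rewrite adjM !mulmxA mxtrace_mulC !mulmxA. Qed.

Lemma tr_sandwich3 k (W u t s M : 'M[C]_k) : adj t = t -> adj s = s ->
  \tr (W *m (u *m t *m s *m M *m adj (u *m t *m s))) =
  \tr (adj u *m W *m u *m t *m (s *m M *m s) *m t).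
Proof. by move=> ht hs; rewrite !adjM ht hs !mulmxA mxtrace_mulC !mulmxA. Qed.

Lemma tr_rotate k (B t u Q : 'M[C]_k) :
  \tr (B *m B *m (t *m u *m Q *m (u *m t))) = \tr (B *m t *m u *m Q *m (u *m (t *m B))).
Proof. by rewrite -(mulmxA B B) mxtrace_mulC !mulmxA. Qed.

Lemma taylor1_tr_product k (A T S F : R -> 'M[C]_k) (Z A1 T1 S1 F1 : 'M[C]_k) :
  mxtaylor1 A Z A1 -> mxtaylor1 T 1%:M T1 -> mxtaylor1 S 1%:M S1 -> mxtaylor1 F Z F1 ->
  taylor1 (fun s => \tr (A s *m (T s *m S s) *m F s *m (S s *m T s))) (\tr (Z *m Z))
    (\tr ((A1 + Z *m (T1 + S1)) *m Z + Z *m F1 + Z *m Z *m (S1 + T1))).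
Proof.
move=> hA hT hS hF.
have := taylor1_tr (mxtaylor1M (mxtaylor1M (mxtaylor1M hA (mxtaylor1M hT hS)) hF) (mxtaylor1M hS hT)).
by rewrite !mulmx1 !mul1mx.
Qed.

(** Cyclicity gathers the two occurrences of each logarithm [B] and [D]; the coefficient 2 c = -g/2
    then gives the factors 1/2 of Ent. *)
Lemma tr_entropy_derivative k (Z A B D G : 'M[C]_k) (g t c : C) : c = - (g / 4) ->
  \tr ((g *: (A *m Z) + Z *m (c *: B + c *: D)) *m Z + Z *m (t *: G) +
    Z *m Z *m (c *: D + c *: B)) =
  g * \tr (Z *m Z *m (A - (1 / 2 : C) *: B - (1 / 2 : C) *: D)) - t * - \tr (Z *m G).
Proof.
move=> cE.
have tr_cyc (M : 'M[C]_k) : \tr (Z *m M *m Z) = \tr (Z *m Z *m M) by rewrite mxtrace_mulC mulmxA.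
have trA : \tr (A *m Z *m Z) = \tr (Z *m Z *m A) by rewrite -mulmxA mxtrace_mulC.
rewrite -(scaleNr _ B) -(scaleNr _ D) !mulmxDr !mulmxDl -!scalemxAr -!scalemxAl !mxtraceD !mxtraceZ !tr_cyc trA cE.
by field.
Qed.

Lemma tr_square_mul_real k (Z K : 'M[C]_k) : adj Z = Z -> adj K = K -> \tr (Z *m Z *m K) \is Num.real.
Proof. by move=> hZ hK; rewrite CrealE -mxtrace_adj !adjM hK hZ mxtrace_mulC. Qed.

Lemma selfadj_combination k (A B D : 'M[C]_k) (c : C) : Num.conj c = c ->
  adj A = A -> adj B = B -> adj D = D -> adj (A - c *: B - c *: D) = A - c *: B - c *: D.
Proof. by move=> hc hA hB hD; rewrite !adjD !adjN !adjZ hc hA hB hD. Qed.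

Definition gap (p : \bar R) : R := match p with (r%:E)%E => (r - 2) / r | _ => 1 end.

(** The sigma exponent of the interpolant at Re w = 1 is that of Gamma^{1/p}. *)
Lemma gap_einv p : (2%:E < p)%E -> 1 / 4 - gap p / 4 = einv p / 2.
Proof.
case: p => [r| |] //=; last by move=> _; rewrite mul0r subrr.
by rewrite lte_fin => r2; field; rewrite gt_eqF// (lt_trans _ r2).
Qed.

Lemma gap_gt0 p : (2%:E < p)%E -> 0 < gap p.
Proof.
case: p => [r| |] //=; rewrite lte_fin => r2.
by rewrite divr_gt0 ?subr_gt0// (lt_trans _ r2).
Qed.

Lemma pratioE p : (2%:E < p)%E -> pratio p = (gap p)^-1.
Proof.
case: p => [r| |] //=; last by rewrite invr1.
by rewrite invf_div.
Qed.

Lemma two_rE p : (2%:E < p)%E -> two_r 2%:E p = (4 / gap p)%:E%E.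
Proof.
move=> p2; rewrite /two_r/=.
have -> : 2^-1 - einv p = gap p / 2 :> R.
  have := gap_einv p2; move: (gap p) (einv p) => g q; lra.
rewrite mulf_eq0 invr_eq0 (gt_eqF (gap_gt0 p2)) pnatr_eq0/=.
by congr (_%:E)%E; field; rewrite gt_eqF// gap_gt0.
Qed.

Variables (k : nat) (L : 'M[C]_k -> 'M[C]_k) (P : R -> 'M[C]_k -> 'M[C]_k)
  (E : 'M[C]_k -> 'M[C]_k) (sigma : 'M[C]_k) (p : \bar R) (tp Mp : R).
Hypothesis PQ : is_QMS L P.
Hypothesis P_dec : decohering P.
Hypothesis E_N : is_EN P E.
Hypothesis E_sigma : is_sigmaTr E sigma.
Hypothesis L_rev : reversible L sigma.
Hypothesis p2 : (2%:E < p)%E.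
Hypothesis tp0 : 0 < tp.
Hypothesis Mp0 : 0 < Mp.
Hypothesis hyper : forall X, psdmx X ->
  abnorm (dfa P) sigma 2%:E p (P tp X) <= Mp * wnorm sigma 2%:E X.

Let g := gap p.
Let q := einv p.
Let N := dfa P.
Let L_lin : linmap L. Proof. by case: PQ => h _ _; exact: h. Qed.
Let P_exp : is_exp_semigroup L P. Proof. by case: PQ => _ h _; exact: h. Qed.
Let P_one t : 0 <= t -> P t 1%:M = 1%:M. Proof. by case: PQ => _ _ h /h[]. Qed.
Let P_cp t : 0 <= t -> cpmap (P t). Proof. by case: PQ => _ _ h /h[]. Qed.
Let s_pd : pdmx sigma. Proof. exact: (@sigma_pd _ _ P E sigma P_dec E_N E_sigma). Qed.
Let N1 : N 1%:M. Proof. exact: (dfa1 (@P_one)). Qed.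
Let ND A B : N A -> N B -> N (A + B). Proof. exact: (dfaD E_N). Qed.
Let NZ c A : N A -> N (c *: A). Proof. by move=> NA; exact: (@dfaZ _ _ _ _ E_N c A NA). Qed.
Let NM A B : N A -> N B -> N (A *m B). Proof. exact: (dfaM (@P_one) E_N). Qed.
Let Nadj A : N A -> N (adj A). Proof. exact: (dfa_adj E_N). Qed.
Let Nsigma A : N A -> A *m sigma = sigma *m A. Proof. exact: (sigma_comm_dfa (@P_one) E_N E_sigma). Qed.

Section dual_bound.
Variables (Z tau : 'M[C]_k).
Hypothesis Z_pd : pdmx Z.
Hypothesis tau_pd : pdmx tau.
Hypothesis N_tau : N tau.
Hypothesis trZ : forall D, N D -> \tr (Z *m Z *m D) = \tr (sigma *m tau *m D).

(** [A] and [B] commute with the powers of sigma, so they come out of Gamma^{1/p} and leave a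
    Hoelder pairing with [Y]. *)
Lemma dual_factor A B Y : N A -> N B ->
  cmod (\tr (cpw Z (1 + g) 0 *m cpw tau (- (g / 4)) 0 *m Gam sigma q (A *m Y *m B) *m cpw tau (- (g / 4)) 0)) <=
  hs Z * (wnorm sigma (two_r 2%:E p) A * wnorm sigma (two_r 2%:E p) B * wnorm sigma p Y).
Proof.
move=> NA NB.
have -> : Gam sigma q (A *m Y *m B) = A *m Gam sigma q Y *m B.
  rewrite /Gam (mxpow_cpw _ s_pd); set S := cpw sigma _ 0.
  have cA : A *m S = S *m A := sigma_cpw_comm s_pd Nsigma _ _ NA.
  have cB : B *m S = S *m B := sigma_cpw_comm s_pd Nsigma _ _ NB.
  by rewrite !mulmxA -cA -!mulmxA cB.
have tau_sa := psd_selfadj (pd_psd tau_pd).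
have assoc (U T G : 'M[C]_k) : U *m T *m (A *m G *m B) *m T = U *m T *m A *m G *m B *m T.
  by rewrite !mulmxA.
rewrite (two_rE p2) assoc /g /q; case: p p2 => [r r2| _|//].
  exact: (holder_finite N1 ND NZ NM Nadj s_pd Nsigma Z_pd tau_pd N_tau trZ Y r2 NA NB).
have := holder_infty N1 ND NZ NM Nadj s_pd Nsigma Z_pd tau_pd N_tau trZ Y NA NB.
by rewrite divr1.
Qed.

Lemma dual_bound X : psdmx X ->
  cmod (\tr (cpw Z (1 + g) 0 *m cpw tau (- (g / 4)) 0 *m Gam sigma q (P tp X) *m cpw tau (- (g / 4)) 0)) <=
  hs Z * (Mp * hs (gam sigma X)).
Proof.
move=> pX; set c := cmod _.
have fact v : (exists A B Y, [/\ N A, N B, P tp X = A *m Y *m B &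
    v = wnorm sigma (two_r 2%:E p) A * wnorm sigma (two_r 2%:E p) B * wnorm sigma p Y]) -> c <= hs Z * v.
  by move=> [A [B [Y [NA NB PE ->]]]]; rewrite /c PE; exact: dual_factor.
(* The factorisation through 1 shows that the set under [inf] is nonempty; otherwise [inf] would be
   a default value. *)
have triv : exists v, exists A B Y, [/\ N A, N B, P tp X = A *m Y *m B &
    v = wnorm sigma (two_r 2%:E p) A * wnorm sigma (two_r 2%:E p) B * wnorm sigma p Y].
  by eexists; exists 1%:M, 1%:M, (P tp X); split; rewrite ?mul1mx ?mulmx1.
have wn : wnorm sigma 2%:E X = hs (gam sigma X).
  by rewrite /wnorm schatten2 -(Gam_gam s_pd)/= div1r.
have [Z0|ZN] := eqVneq (hs Z) 0.
  by have [v /fact] := triv; rewrite Z0 !mul0r.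
have Zp : 0 < hs Z by rewrite lt0r ZN hs_ge0.
rewrite -ler_pdivrMl// -wn; apply: le_trans (hyper pX).
apply: lb_le_inf => [|v vP]; first by have [v vP] := triv; exists v.
by rewrite ler_pdivrMl// fact.
Qed.

End dual_bound.

(** Left half of the interpolant at w = 1 + i y, with the power of Z shared evenly between both
    sides; the right half is the adjoint of this matrix at -y. *)
Definition phase_mx (Z tau : 'M[C]_k) y := cpw Z ((1 + g) / 2) (g / 2 * y) *m
  cpw tau (- (g / 4)) (- (g / 4) * y) *m cpw sigma (q / 2) (- (g / 4) * y).

(** The phase of Z cancels against its adjoint. Those of tau and sigma form a unitary u, absorbed
    into Z' = (adj u) Z u. Conjugation by u keeps N, since the sigma phases cancel there and the tau
    phases lie in N, so Z' satisfies the trace identity. *)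
Lemma dual_bound_phase (Z tau : 'M[C]_k) y X : pdmx Z -> pdmx tau -> N tau ->
  (forall D, N D -> \tr (Z *m Z *m D) = \tr (sigma *m tau *m D)) -> psdmx X ->
  cmod (\tr (phase_mx Z tau y *m P tp X *m adj (phase_mx Z tau y))) <= hs Z * (Mp * hs (gam sigma X)).
Proof.
move=> Z_pd tau_pd N_tau trZ pX; set a := phase_mx Z tau y; pose w := - (g / 4) * y.
have tau_sa := psd_selfadj (pd_psd tau_pd).
have sig_sa := psd_selfadj (pd_psd s_pd).
have Z_sa := psd_selfadj (pd_psd Z_pd).
have Nt s y' : N (cpw tau s y') := N_cpw N1 ND NZ NM s y' tau_sa N_tau.
have st s y' s' y'' : cpw tau s y' *m cpw sigma s' y'' = cpw sigma s' y'' *m cpw tau s y'.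
  exact: (sigma_cpw_comm s_pd Nsigma _ _ (Nt s y')).
pose u := cpw tau 0 w *m cpw sigma 0 w.
have uu : u *m adj u = 1%:M.
  rewrite /u adjM !adj_cpw -mulmxA (mulmxA (cpw sigma _ _)) cpwM addrN addr0 (cpw0 s_pd) mul1mx.
  by rewrite cpwM addrN addr0 (cpw0 tau_pd).
pose Z' := adj u *m Z *m u.
have Z'_pd : pdmx Z' by apply: pd_congr => //; have := mulmx1_unit uu => -[].
have hsZ' : hs Z' = hs Z.
  exact: hs_unitary_conj.
have trZ' D : N D -> \tr (Z' *m Z' *m D) = \tr (sigma *m tau *m D).
  move=> ND'.
  have ND'' : N (cpw tau 0 w *m D *m cpw tau 0 (- w)) by apply: NM => //; apply: NM.
  have uDu : u *m D *m adj u = cpw tau 0 w *m D *m cpw tau 0 (- w).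
    rewrite /u adjM !adj_cpw !mulmxA -(mulmxA _ (cpw sigma 0 w) D).
    rewrite -(sigma_cpw_comm s_pd Nsigma _ _ ND') !mulmxA -(mulmxA _ (cpw sigma 0 w)) cpwM addrN addr0.
    by rewrite (cpw0 s_pd) mulmx1.
  transitivity (\tr (Z *m Z *m (u *m D *m adj u))).
    exact: tr_unitary_conj.
  rewrite uDu (trZ _ ND'') mulmxA mxtrace_mulC !mulmxA.
  rewrite -(mulmxA (cpw tau 0 (- w))) (mulmxA (cpw tau 0 (- w))) (Nsigma (Nt _ _)) -!mulmxA.
  congr (\tr (_ *m _)); rewrite !mulmxA; congr (_ *m _).
  rewrite -[X in _ *m X *m _](cpw1 (pd_psd tau_pd)) !cpwM -[RHS](cpw1 (pd_psd tau_pd)).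
  by apply: eq_cpw; ring.
rewrite -hsZ'; apply: le_trans (dual_bound Z'_pd tau_pd N_tau trZ' pX).
have -> : cpw Z' (1 + g) 0 = adj u *m cpw Z (1 + g) 0 *m u.
  by rewrite !cpwE mxfc_unitary_conj.
have aE : a = cpw Z ((1 + g) / 2) (g / 2 * y) *m (u *m cpw tau (- (g / 4)) 0 *m cpw sigma (q / 2) 0).
  rewrite /a /phase_mx -/w /u -!mulmxA; congr (_ *m _).
  rewrite (mulmxA (cpw sigma 0 w)) -st !mulmxA cpwM -!mulmxA cpwM -/w.
  by congr (_ *m _); apply: eq_cpw; ring.
rewrite /Gam (mxpow_cpw _ s_pd); set b := u *m _ *m _ in aE.
apply: le_of_eq; congr (cmod _).
have self_cpw (M : 'M[C]_k) s : adj (cpw M s 0) = cpw M s 0 by rewrite adj_cpw oppr0.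
have Z2 : adj (cpw Z ((1 + g) / 2) (g / 2 * y)) *m cpw Z ((1 + g) / 2) (g / 2 * y) = cpw Z (1 + g) 0.
  by rewrite adj_cpw; apply: cpw_mul; [field|rewrite addNr].
by rewrite aE tr_sandwich Z2 /b (tr_sandwich3 _ _ _ (self_cpw tau _) (self_cpw sigma _)).
Qed.

(** * The main interpolant, its edges and its derivative at 0 *)

Section entropy.
Variable X : 'M[C]_k.
Hypothesis X_pd : pdmx X.

Let Z := gam sigma X.
Let tau := ref_state E sigma Z.

Let Z_pd : pdmx Z.
Proof.
have -> : Z = adj (cpw sigma (1 / 4) 0) *m X *m cpw sigma (1 / 4) 0 by rewrite adj_cpw oppr0.
apply: pd_congr => //; apply: pd_unit; exact: pd_cpw.
Qed.

Let tau_pd : pdmx tau. Proof. exact: (ref_state_pd (@P_one) P_dec E_N E_sigma Z_pd). Qed.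
Let N_tau : N tau. Proof. exact: (ref_state_dfa sigma E_N Z). Qed.
Let trZ D : N D -> \tr (Z *m Z *m D) = \tr (sigma *m tau *m D).
Proof. by move=> ND'; exact: (tr_ref_state (@P_one) P_dec E_N E_sigma Z ND'). Qed.

Let gl := gen_lin sigma L_lin.
(** This is Gamma^{1/2}(P_{w tp} X) continued to complex w = s + i y. The products below keep sigma
    next to it, and their leading [0 +] fits [mxexp_cpw]. *)
Let flow s y := evolve gl (fun x => cexp (tp * x) s y) Z.
Let om s y := cpw tau (0 + - (g / 4) * s) (- (g / 4) * y) *m cpw sigma (0 + - (g / 4) * s) (- (g / 4) * y).
Let om' s y := cpw sigma (0 + - (g / 4) * s) (- (g / 4) * y) *m cpw tau (0 + - (g / 4) * s) (- (g / 4) * y).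
Let F s y := \tr (cpw Z (1 + g * s) (g * y) *m om s y *m flow s y *m om' s y).

Lemma interpolant_exppoly : exppoly F.
Proof.
apply: exppoly_tr; apply: mxexpM; last by apply: mxexpM; exact: mxexp_cpw.
apply: mxexpM; last exact: mxexp_evolve.
by apply: mxexpM; [exact: mxexp_cpw|apply: mxexpM; exact: mxexp_cpw].
Qed.

Lemma hs_flow0 y : hs (flow 0 y) = hs Z.
Proof.
apply: hs_evolve => x; rewrite cexp_conj -cexpD addr0 addNr cexpr mulr0 expR0.
exact: erefl.
Qed.

Lemma interpolant_edge0 y : cmod (F 0 y) <= hs Z ^+ 2.
Proof.
have uc (M : 'M[C]_k) s y' : pdmx M -> s = 0 -> mxcontr 1 (cpw M s y').
  move=> pM ->; apply: mxcontr_unitary.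
  by rewrite adj_cpw cpwM addNr addr0 (cpw0 pM).
have z0 : 0 + - (g / 4) * 0 = 0 :> R by rewrite mulr0 addr0.
rewrite /F -!mulmxA; apply: le_trans (cauchy_schwarz_tr _ _) _.
have -> : hs (cpw Z (1 + g * 0) (g * y)) = hs Z.
  rewrite mulr0 addr0 !hsE; congr Num.sqrt; apply: complexI.
  rewrite -!tr_adj_mul adj_cpw cpwM addNr (psd_selfadj (pd_psd Z_pd)).
  by rewrite -[in RHS](cpw1 (pd_psd Z_pd)) cpwM addr0.
rewrite expr2 ler_wpM2l ?hs_ge0// /om /om'.
apply: le_trans (uc _ _ _ tau_pd z0 _ _) _; rewrite mul1r.
apply: le_trans (uc _ _ _ s_pd z0 _ _) _; rewrite mul1r mulmxA.
apply: le_trans (mxcontr_mulr _ ler01 (uc _ _ _ tau_pd z0)) _; rewrite mul1r.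
apply: le_trans (mxcontr_mulr _ ler01 (uc _ _ _ s_pd z0)) _; rewrite mul1r.
by rewrite hs_flow0.
Qed.

(** The semigroup law splits the complex time into an imaginary part, isometric by [hs_flow0], and
    the real time [tp] of the hypothesis. *)
Lemma flow1 y : flow 1 y = gam sigma (P tp (gam_inv sigma (flow 0 y))).
Proof.
rewrite (semigroup_evolve s_pd L_lin L_rev P_exp _ (ltW tp0)) !(gam_invK s_pd).
rewrite /flow evolveM /evolve; congr (vec_mx (_ *m _)); apply: eq_mxfc => i.
by rewrite -cexpD add0r addr0.
Qed.

(** [gam_inv W] factors as C1 (adj C2), where the Gram matrices of C1 and C2 are positive and, after
    [gam], have norm [hs W], which is [hs Z]; [dual_bound_phase] applies to each. *)
Lemma interpolant_edge1 y : cmod (F 1 y) <= hs Z ^+ 2 * Mp.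
Proof.
pose W := flow 0 y; pose h := adj W *m W.
have [h1 h2] := hs_gram_factor W; rewrite -/h in h1 h2.
pose S := cpw sigma (- (1 / 4)) 0.
pose C1 := S *m (W *m cpw h (- (1 / 4)) 0).
pose C2 := S *m cpw h (1 / 4) 0.
have S_sa : adj S = S by rewrite adj_cpw oppr0.
have C12 : C1 *m adj C2 = gam_inv sigma W.
  rewrite /C1 /C2 adjM S_sa adj_cpw oppr0 /gam_inv -/S.
  have -> : S *m (W *m cpw h (- (1 / 4)) 0) *m (cpw h (1 / 4) 0 *m S) =
     S *m (W *m (cpw h (- (1 / 4)) 0 *m cpw h (1 / 4) 0)) *m S by rewrite !mulmxA.
  (* The two powers of h combine to its support projection, which W absorbs. *)
  congr (_ *m _ *m _); rewrite cpwM addNr addr0 -[RHS]polpow1 /polpow -/h.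
  by congr (_ *m _); apply: eq_cpw; [rewrite mulr1 addNr|rewrite mulr0].
have C11 : C1 *m adj C1 = gam_inv sigma (W *m cpw h (- (1 / 4)) 0 *m adj (W *m cpw h (- (1 / 4)) 0)).
  by rewrite /C1 adjM S_sa /gam_inv -/S !mulmxA.
have C22 : C2 *m adj C2 = gam_inv sigma (cpw h (1 / 2) 0).
  rewrite /C2 adjM S_sa adj_cpw oppr0 /gam_inv -/S.
  have -> : cpw h (1 / 2) 0 = cpw h (1 / 4) 0 *m cpw h (1 / 4) 0.
    by apply/esym/cpw_mul; [field|rewrite addr0].
  by rewrite !mulmxA.
have psd_gram' (M : 'M[C]_k) : psdmx (M *m adj M) by rewrite -[X in X *m _]adjK; exact: psd_gram.
have b1 := dual_bound_phase y Z_pd tau_pd N_tau trZ (psd_gram' C1).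
(* The phases enter both sides of the interpolant unconjugated, so the right half is an adjoint only
   after y changes sign. *)
have b2 := dual_bound_phase (- y) Z_pd tau_pd N_tau trZ (psd_gram' C2).
rewrite {2}C11 (gam_invK s_pd) h2 in b1; rewrite {2}C22 (gam_invK s_pd) h1 in b2.
have P_lin : linmap (P tp).
  move=> c U V; rewrite !(semigroup_evolve s_pd L_lin L_rev P_exp _ (ltW tp0)).
  by rewrite (gam_linear sigma) /evolve linearP mulmxDl -scalemxAl linearP (gam_inv_linear sigma).
have := @cpmap_cauchy_schwarz _ _ (P tp) C1 C2 (phase_mx Z tau y) (adj (phase_mx Z tau (- y)))
  _ (P_cp (ltW tp0)) P_lin b1.
rewrite adjK => /(_ b2); rewrite C12.
have -> : hs Z * (Mp * hs (flow 0 y)) = hs Z ^+ 2 * Mp by rewrite hs_flow0; ring.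
apply: le_trans; apply: le_of_eq; congr (cmod _).
rewrite /F flow1 -/W /om /om' /gam !mulr1 !add0r.
set Q := P tp _; set w := - (g / 4) * y.
set sg := cpw sigma (- (g / 4)) w; set ta := cpw tau (- (g / 4)) w.
have -> : cpw Z (1 + g) (g * y) *m (ta *m sg) *m (cpw sigma (1 / 4) 0 *m Q *m cpw sigma (1 / 4) 0) *m (sg *m ta) =
  cpw Z (1 + g) (g * y) *m (ta *m (sg *m cpw sigma (1 / 4) 0) *m Q *m ((cpw sigma (1 / 4) 0 *m sg) *m ta)).
  by rewrite !mulmxA.
have sE1 : sg *m cpw sigma (1 / 4) 0 = cpw sigma (q / 2) w.
  by apply: cpw_mul; rewrite ?addr0// addrC -(gap_einv p2).
have sE2 : cpw sigma (1 / 4) 0 *m sg = cpw sigma (q / 2) w.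
  by apply: cpw_mul; rewrite ?add0r// -(gap_einv p2).
rewrite sE1 sE2 /phase_mx !adjM !adj_cpw.
have -> : - (g / 4) * - y = - w by rewrite /w mulrN.
rewrite !opprK -/ta.
have -> : - (g / 2 * - y) = g / 2 * y by rewrite mulrN opprK.
set B := cpw Z ((1 + g) / 2) (g / 2 * y).
have -> : cpw Z (1 + g) (g * y) = B *m B by apply/esym/cpw_mul; field.
exact: tr_rotate.
Qed.

Lemma interpolant_bound s : 0 < s < 1 -> cmod (F s 0) <= hs Z ^+ 2 * Mp `^ s.
Proof.
move=> s01; have z0 : 0 <= hs Z ^+ 2 by rewrite sqr_ge0.
have := hadamard_three_lines_ge0 interpolant_exppoly z0 (mulr_ge0 z0 (ltW Mp0)) interpolant_edge0 interpolant_edge1 s01.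
move=> /le_trans; apply; apply: le_of_eq.
rewrite (powRM _ z0 (ltW Mp0)) mulrA -powRD; last by rewrite subrK oner_eq0.
by rewrite subrK (powRr1 z0).
Qed.

Lemma interpolant_taylor : taylor1 (fun s => F s 0) (((hs Z ^+ 2)%:C)%C)
  ((g%:C)%C * ent2 E sigma X - (tp%:C)%C * energy2 L sigma X).
Proof.
pose c := - (g / 4).
have hA := mxtaylor1_cpw 1 g Z_pd.
have hT := mxtaylor1_cpw 0 c tau_pd.
have hS := mxtaylor1_cpw 0 c s_pd.
have hF := mxtaylor1_evolve gl (gen_sa s_pd L_rev) Z tp.
rewrite (cpw1 (pd_psd Z_pd)) in hA; rewrite (cpw0 tau_pd) mulmx1 in hT.
rewrite (cpw0 s_pd) mulmx1 in hS.
have := taylor1_tr_product hA hT hS hF.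
have Z_sa := psd_selfadj (pd_psd Z_pd).
have -> : \tr (Z *m Z) = ((hs Z ^+ 2)%:C)%C by rewrite sqr_hs -tr_adj_mul Z_sa.
have enE : energy2 L sigma X = - \tr (Z *m gen sigma L Z).
  by rewrite /energy2 (wip_gam s_pd) -/Z Z_sa /gen (gamK s_pd).
have entE : ent2 E sigma X = \tr (Z *m Z *m (mxln Z - (1 / 2 : C) *: mxln tau - (1 / 2 : C) *: mxln sigma)).
  by rewrite /ent2 (Gam_gam s_pd) (mxpow_cpw _ s_pd).
have cE : (c%:C)%C = - ((g%:C)%C / 4).
  by rewrite /c rmorphN/= rmorphM/= fmorphV/=; congr (- (_ / _)); rewrite rmorph_nat.
rewrite enE entE -(tr_entropy_derivative _ _ _ _ _ _ cE).
apply: eq_taylor1 => s.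
by rewrite /F /om /om' /flow !mulr0.
Qed.

(** The order of R[i] compares only numbers with equal imaginary parts, whereas the comparison of
    slopes yields real parts; hence this lemma and the next. *)
Lemma ent2_real : ent2 E sigma X \is Num.real.
Proof.
rewrite /ent2 (Gam_gam s_pd) (mxpow_cpw _ s_pd) -/Z -/tau; set K := mxln Z - _ - _.
have mxln_sa (M : 'M[C]_k) : adj (mxln M) = mxln M.
  by rewrite /mxln mxfunE adj_mxfc; apply: eq_mxfc => i; rewrite (conj_Creal (x := (_%:C)%C)) ?complex_real.
have half_real : Num.conj (1 / 2 : C) = 1 / 2 by rewrite mul1r fmorphV/= conjC_nat.
apply: tr_square_mul_real; first exact: psd_selfadj (pd_psd Z_pd).
by apply: selfadj_combination => //; exact: mxln_sa.
Qed.

Lemma energy2_real : energy2 L sigma X \is Num.real.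
Proof.
rewrite /energy2 rpredN (wip_gam s_pd) -/Z CrealE -mxtrace_adj adjM adjK.
have := gen_sa s_pd L_rev Z Z; rewrite /gen (gamK s_pd) => ->.
by rewrite eqxx.
Qed.

Lemma lsi_pd : ent2 E sigma X <= (((pratio p * tp)%:C)%C * energy2 L sigma X +
  (((pratio p * ln Mp) * wnorm sigma 2%:E X ^+ 2)%:C)%C).
Proof.
have := taylor1_bound (sqr_ge0 _) Mp0 interpolant_taylor interpolant_bound.
have wn : wnorm sigma 2%:E X = hs Z by rewrite /wnorm schatten2 /Z -(Gam_gam s_pd)/= div1r.
rewrite wn -(RRe_real ent2_real) -(RRe_real energy2_real).
move: (complex.Re (ent2 _ _ _)) (complex.Re (energy2 _ _ _)) => e n.
rewrite -!rmorphM -rmorphB -rmorphD/= lecR => h.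
rewrite (pratioE p2) -/g; have g0 : 0 < g := gap_gt0 p2.
rewrite -(ler_pM2l g0).
have -> : g * (g^-1 * tp * n + g^-1 * ln Mp * hs Z ^+ 2) = tp * n + hs Z ^+ 2 * ln Mp.
  by field; rewrite gt_eqF.
lra.
Qed.

End entropy.
End interpolation.

Theorem theorem4p7 (R : realType) (n : nat)
  (L : 'M[R[i]]_n.+1 -> 'M[R[i]]_n.+1) (P : R -> 'M[R[i]]_n.+1 -> 'M[R[i]]_n.+1)
  (E : 'M[R[i]]_n.+1 -> 'M[R[i]]_n.+1) (sigma : 'M[R[i]]_n.+1)
  (p : \bar R) (tp Mp : R) :
  is_QMS L P -> decohering P ->
  is_EN P E -> is_sigmaTr E sigma ->
  reversible L sigma ->
  (2%:E < p)%E -> 0 < tp -> 0 < Mp ->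
  (forall X : 'M[R[i]]_n.+1, psdmx X ->
     abnorm (dfa P) sigma 2%:E p (P tp X) <= Mp * wnorm sigma 2%:E X) ->
  LSI2 L E sigma (pratio p * tp) (pratio p * @ln R Mp).
Proof.
move=> PQ P_dec E_N E_sigma L_rev p2 tp0 Mp0 hyper X X_pd.
exact: (lsi_pd PQ P_dec E_N E_sigma L_rev p2 tp0 Mp0 hyper X_pd).
Qed.
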